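(* Let $F=F(X)$ be in $L^2(P)$ with mean zero and variance $\sigma^2>0$. Then $$d_K(\sigma^{-1}F,N)\le \frac{\sqrt{\mathrm{Var}(Z)}}{\sigma^2}+\frac{\sqrt{\mathrm{Var}(\bar Z)}}{\sigma^2}+\frac{\sum_{i=1}^\infty\sqrt{E|\mathfrak{D}_iF|^6}}{\sigma^3}+\frac{\sqrt{2\pi}}{4\sigma^3}\mathcal{L}_3(F),$$ where $$Z:=\sum_{i=1}^{\infty}\mathfrak{D}_iF\,E[\mathfrak{D}_iF|\mathcal{F}_i],\qquad \bar Z:=\sum_{i=1}^{\infty}\mathfrak{D}_i\Big(\mathfrak{D}_iF\big(|E[\mathfrak{D}_iF|\mathcal{F}_i]|+E_i|E[\mathfrak{D}_iF|\mathcal{F}_i]|\big)\Big).$$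
   Context: $X=(X_1,X_2,\dots)$ is a sequence of independent random variables (not necessarily identically distributed) on a probability space $(\Omega,\mathfrak{F},P)$ with values in a measurable space $\mathcal{X}$. $F=F(X)$ means that $F$ is a real-valued measurable function of the sequence $X$. $E_i$ denotes the expectation with respect to $X_i$; in particular $E_i[F]=E[F|\sigma(X_k,k\neq i)]$. The difference operators are $\mathfrak{D}_iF=F-E_i[F]$, $i\ge1$, for $F\in L^1(P)$. $\mathcal{F}_i=\sigma(X_k,k\le i)$. Generalized Lyapunov ratio: $\mathcal{L}_r(F):=\sum_{i=1}^\infty E|\mathfrak{D}_iF|^r$, $r>0$. $N$ is a standard normal random variable and, for a random variable $G$, $d_K(G,N)=\sup_{x\in\mathbb{R}}|P(G\le x)-P(N\le x)|$. *)

(* Defs.v *)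
From HB Require Import structures.
From mathcomp Require Import all_boot all_order all_algebra.
From mathcomp Require Import all_classical all_reals all_analysis.

Set Implicit Arguments.
Unset Strict Implicit.
Unset Printing Implicit Defensive.

Import Order.TTheory GRing.Theory Num.Theory.
Import numFieldNormedType.Exports.

Local Open Scope classical_set_scope.
Local Open Scope ring_scope.

(* The sequence is indexed from 0: [X k] stands for the (k+1)-st variable. *)

(* S^nat with its product sigma-algebra, generated by the coordinate maps. *)
Definition seq_space d (S : measurableType d) :=
  g_sigma_algebraType
    (\bigcup_(k in [set: nat])
       preimage_set_system [set: nat -> S] (fun x => x k) measurable).

Section Independence.
Context d (T : measurableType d) d' (S : measurableType d') (R : realType).
Variables (P : probability T R) (X : nat -> {mfun T >-> S}).

Definition independent_seq :=
  forall (J : seq nat) (B : nat -> set S),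
    uniq J -> (forall k, measurable (B k)) ->
    P (\bigcap_(k in [set` J]) (X k @^-1` B k)) =
    (\prod_(k <- J) P (X k @^-1` B k))%E.

(* sigma(X_k, k \in K) *)
Definition sigma_of (K : set nat) : set (set T) :=
  <<s \bigcup_(k in K) g_sigma_algebra_preimage (X k) >>.

End Independence.

Section ConditionalExpectation.
Context d (T : measurableType d) (R : realType) (P : probability T R).

Definition is_condexp (G : set (set T)) (Y V : T -> R) :=
  [/\ V \in Lfun P 1,
      (forall B, measurable B -> G (V @^-1` B)) &
      (forall A, G A ->
         \int[P]_(w in A) (V w)%:E = \int[P]_(w in A) (Y w)%:E)%E].

(* A version of E[Y | G], which exists whenever Y is in L^1(P) and G is a
   sub-sigma-algebra; it is only determined P-almost surely. *)
Definition condexp (G : set (set T)) (Y : T -> R) : T -> R :=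
  xget (cst 0) [set V | is_condexp G Y V].

(* V is the sum of the series of random variables u_i, with convergence of the
   partial sums in L^1(P). *)
Definition is_L1_sum (u : nat -> T -> R) (V : T -> R) :=
  V \in Lfun P 1 /\
  ('E_P[fun w => (`|\sum_(i < n) u i w - V w|)%R] @[n --> \oo] --> 0)%E.

(* Kolmogorov distance between the law of Y and the law nu. *)
Definition kolmogorov_dist (Y : T -> R) (nu : set R -> \bar R) : \bar R :=
  ereal_sup [set `|P [set w | (Y w <= x)%R] - nu (`]-oo, x]%classic : set R)|%E | x in [set: R]].

End ConditionalExpectation.

Section DifferenceOperators.
Context d (T : measurableType d) d' (S : measurableType d') (R : realType).
Variables (P : probability T R) (X : nat -> {mfun T >-> S}).

Definition Ei (i : nat) (F : T -> R) : T -> R :=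
  condexp P (sigma_of X [set k | k != i]) F.

Definition diffop (i : nat) (F : T -> R) : T -> R :=
  fun w => F w - Ei i F w.

(* E[Y | F_i] with F_i = sigma(X_k, k <= i) *)
Definition condexp_past (i : nat) (Y : T -> R) : T -> R :=
  condexp P (sigma_of X [set k | (k <= i)%N]) Y.

Definition lyapunov (r : R) (F : T -> R) : \bar R :=
  (\sum_(0 <= i <oo) 'E_P[fun w => (`|diffop i F w| `^ r)%R])%E.

Definition Z_term (F : T -> R) (i : nat) : T -> R :=
  fun w => diffop i F w * condexp_past i (diffop i F) w.

Definition Zbar_term (F : T -> R) (i : nat) : T -> R :=
  let A := fun w => `|condexp_past i (diffop i F) w| in
  diffop i (fun w => diffop i F w * (A w + Ei i A w)).

End DifferenceOperators.

(* Main.v *)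
(* Write [W = F / sigma], [D_i] for the i-th difference operator and
   [xi_i = E[D_i F | F_i]]. By independence [xi_i] is the martingale increment
   [E[F | F_i] - E[F | F_{i-1}]] and [E_i xi_i = 0], so that, for the solution
   [f] of Stein's equation at [z],
     E[F f(W)] = \sum_i E[xi_i f(W)] = \sum_i E[xi_i (f(W) - E_i f(W))].
   A first order expansion of [f] around [W] gives the main term
   [E[Z f'(W)] / sigma], and [E Z = sigma^2]. The remainder of the expansion is
   quadratic, up to [(a - b) (g a - g b)] with [g] the indicator of
   [z < x], which accounts for the jump of [f'] at [z]; averaging this last
   expression under [E_i] and multiplying by [|xi_i|] yields exactly
   [E[Zbar_i g(W)]].
   The expansion is averaged without an independent copy of [X_i]: it is
   conditioned at every rational base point [a], and then [a] tends to [W] from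
   the left, which is the side on which [f'] and [g] are continuous. *)

Require Import Defs.
From HB Require Import structures.
From mathcomp Require Import all_boot all_order all_algebra.
From mathcomp Require Import all_classical all_reals all_analysis.
From mathcomp Require Import measurable_realfun.
From mathcomp Require Import ring lra.

Set Implicit Arguments.
Unset Strict Implicit.
Unset Printing Implicit Defensive.

Import Order.TTheory GRing.Theory Num.Theory.
Import numFieldNormedType.Exports.

Local Open Scope classical_set_scope.
Local Open Scope ring_scope.


(** * The Gaussian distribution function *)

(** In the quadratic remainder the increment is weighted by [|W| + c], where [c = sqrt (2 pi) / 4]
    is the maximum of the Stein solutions, and this weight explains the last two terms of the bound.
    With everything divided by [sigma], put [V = |xi_i| (D_i ^ 2 + E_i D_i ^ 2)]. The part with
    [|W|] is controlled by Cauchy-Schwarz, [E W ^ 2 <= 1] and [E V ^ 2 <= 4 E |D_i| ^ 6], which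
    produces the root of a sixth moment; the part with [c] uses [E V <= 2 E |D_i| ^ 3]. In both
    cases the resulting 2 cancels the 1/2 of the second order term. The sum over [i] is infinite, so
    estimates are made on partial sums, where [E[xi_i f(W)]] telescopes to [E[M_n f(W)]]. The limit
    needs only two facts on the martingale [M_n]: weak convergence to [F] against bounded functions,
    and [E M_n ^ 2 -> E F ^ 2], which yields the mean of [Z]. Both start from cylinders, on which
    the integral of [M_n] is eventually that of [F]. Independence enters only through one
    commutation rule: conditioning on the variables in [K] and then on those in [L] is conditioning
    on those in the intersection. *)

Section Gaussian.
Context {R : realType}.
Implicit Types x y z : R.

Lemma ge0_is_derive_le (f df : R -> R) (a b : R) : a <= b ->
  (forall x, a <= x <= b -> is_derive x 1 f (df x)) ->
  (forall x, a <= x <= b -> 0 <= df x) -> f a <= f b.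
Proof.
move=> ab fd df0.
have [||c] := @MVT_segment _ f df a b ab.
- by move=> x; rewrite in_itv/= => /andP[ax xb]; apply: fd; rewrite !ltW.
- apply: derivable_within_continuous => x; rewrite in_itv/= => /fd fx.
  exact: ex_derive.
rewrite in_itv/= => /df0 dc0 fab.
by rewrite -subr_ge0 fab mulr_ge0// subr_ge0.
Qed.

Definition gpdf x : R := normal_peak 1 * expR (- (x ^+ 2 / 2)).

Definition gcdf x : R := fine (normal_prob 0 1 (`]-oo, x]%classic : set R)).

Lemma gpdfE : gpdf = normal_pdf 0 1.
Proof.
apply/funext => x; rewrite normal_pdfE ?oner_eq0// /gpdf /normal_fun.
by rewrite subr0 expr1n mulNr mulr2n.
Qed.

Lemma gpdf_gt0 x : 0 < gpdf x.
Proof. by rewrite mulr_gt0 ?expR_gt0// normal_peak_gt0// oner_eq0. Qed.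

Lemma normal_peak1E : normal_peak 1 = (Num.sqrt (2 * pi))^-1 :> R.
Proof. by rewrite /normal_peak expr1n mul1r mulr_natl. Qed.

Lemma gpdf_expR x : gpdf x * (Num.sqrt (2 * pi) * expR (x ^+ 2 / 2)) = 1.
Proof.
rewrite /gpdf normal_peak1E mulrACA mulVf ?mul1r.
  by rewrite -expRD addNr expR0.
by rewrite gt_eqF// sqrtr_gt0 mulr_gt0 ?pi_gt0.
Qed.

Lemma gcdfE x : normal_prob 0 1 (`]-oo, x]%classic : set R) = (gcdf x)%:E.
Proof. by rewrite /gcdf fineK// fin_num_measure. Qed.

Lemma is_derive_gpdf x : is_derive x 1 gpdf (- x * gpdf x).
Proof.
rewrite /gpdf; apply: is_derive_eq.
by rewrite /GRing.scale/=; field.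
Qed.

#[local] Existing Instance is_derive_gpdf.

Lemma is_derive_gcdf x : is_derive x 1 gcdf (gpdf x).
Proof.
have [] := @continuous_FTC1 R gpdf -oo%O x (x + 1).
- by rewrite ltrDl.
- apply: (integrableS measurableT) => //; rewrite gpdfE.
  exact: integrable_normal_pdf.
- by rewrite /= ltNyr.
- by rewrite gpdfE; apply: continuous_normal_pdf; rewrite oner_eq0.
move=> d e; apply: DeriveDef; last by rewrite -derive1E -e gpdfE.
by rewrite gpdfE in d.
Qed.

#[local] Existing Instance is_derive_gcdf.

Lemma gcdf_ge0 x : 0 <= gcdf x. Proof. by rewrite fine_ge0. Qed.

Lemma gcdf_le1 x : gcdf x <= 1.
Proof. by rewrite -lee_fin -gcdfE probability_le1. Qed.

Lemma gcdf_nd : {homo gcdf : x y / x <= y}.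
Proof.
move=> x y xy; apply: (@ge0_is_derive_le gcdf gpdf) => // u _.
exact/ltW/gpdf_gt0.
Qed.

Let idTR : measurableTypeR R -> R := idfun.

#[local] HB.instance Definition _ :=
  @isMeasurableFun.Build _ _ _ _ idTR (@measurable_id _ _ setT).

Let X := (idTR : {RV (normal_prob 0 1 : probability _ R) >-> R}).

Let gcdf_cdf : gcdf = fine \o cdf X. Proof. by []. Qed.

Lemma cvg_gcdfy : gcdf x @[x --> +oo] --> (1 : R).
Proof. by rewrite gcdf_cdf; apply: fine_cvg; exact: cvg_cdfy1. Qed.

Lemma cvg_gcdfNy : gcdf (- x) @[x --> +oo] --> (0 : R).
Proof.
rewrite -(cvgNy_compNP gcdf) gcdf_cdf.
by apply: fine_cvg; exact: cvg_cdfNy0.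
Qed.

Lemma gcdfy_le (x a b c : R) :
  (forall y, x <= y -> a * gcdf y + b <= c) -> a + b <= c.
Proof.
move=> h; apply: (@cvgr_to_le _ (pinfty_nbhs R) _ _ (fun y => a * gcdf y + b)).
- rewrite -[a in nbhs (a + b)]mulr1; apply: cvgD; last exact: cvg_cst.
  by apply: cvgM; [exact: cvg_cst|exact: cvg_gcdfy].
- by near=> y; apply: h; near: y; apply: nbhs_pinfty_ge; exact: num_real.
Unshelve. all: end_near. Qed.

(** The density is even, so [gcdf y + gcdf (- y)] has derivative zero; the constant is found from
    its limit at +oo. *)
Lemma gcdfN x : gcdf (- x) = 1 - gcdf x.
Proof.
have c0 : forall y, 0 <= y -> gcdf y + gcdf (- y) = gcdf 0 + gcdf 0.
  move=> y y0.
  have d (u : R) : is_derive u (1 : R) (fun v : R => gcdf v + gcdf (- v)) 0.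
    apply: is_derive_eq.
    by rewrite /GRing.scale/= /gpdf sqrrN; ring.
  have dN (u : R) : is_derive u (1 : R) (fun v : R => - (gcdf v + gcdf (- v))) 0.
    by apply: is_derive_eq; rewrite oppr0.
  apply/eqP; rewrite eq_le; apply/andP; split.
    by have := ge0_is_derive_le y0 (fun x _ => dN x) (fun x _ => lexx 0);
      rewrite lerN2 oppr0.
  by have := ge0_is_derive_le y0 (fun x _ => d x) (fun x _ => lexx 0);
    rewrite oppr0.
have c1 : gcdf 0 + gcdf 0 = 1.
  have : gcdf y + gcdf (- y) @[y --> +oo] --> (1 + 0 : R).
    by apply: cvgD; [exact: cvg_gcdfy|exact: cvg_gcdfNy].
  rewrite addr0 => h; apply: (cvg_unique _ _ h) => //.
  apply: (cvg_near_cst (gcdf 0 + gcdf 0)).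
  by near=> y; apply: c0; near: y; apply: nbhs_pinfty_ge; exact: num_real.
have [x0|/ltW x0] := leP 0 x.
  by have := c0 _ x0; rewrite c1 => <-; rewrite addrC addKr.
have := c0 (- x); rewrite oppr_ge0 opprK c1 => /(_ x0) <-.
by rewrite addrK.
Unshelve. all: end_near. Qed.

(** Mills' ratio bound. [h] is an antiderivative of [(u - x) * gpdf u], which is nonnegative to the
    right of [x]; compare [h x] with [h y] and let [y] tend to +oo. *)
Lemma mills x : x * (1 - gcdf x) <= gpdf x.
Proof.
have [x0|x0] := leP x 0.
  apply: (@le_trans _ _ 0); last exact/ltW/gpdf_gt0.
  by rewrite mulr_le0_ge0// subr_ge0 gcdf_le1.
rewrite mulrBr mulr1; apply: (@gcdfy_le x) => y xy.
pose h u := x * gcdf x - x * gcdf u - gpdf u.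
have dh (u : R) : is_derive u (1 : R) h ((u - x) * gpdf u).
  by rewrite /h; apply: is_derive_eq; rewrite /GRing.scale/=; ring.
have hxy : h x <= h y.
  apply: (ge0_is_derive_le xy (fun u _ => dh u)) => u /andP[xu _].
  by rewrite mulr_ge0 ?subr_ge0// ltW// gpdf_gt0.
rewrite -subr_ge0 (_ : _ - _ = h y - h x + gpdf y); last by rewrite /h; ring.
by rewrite addr_ge0 ?(ltW (gpdf_gt0 _))// subr_ge0.
Qed.

Lemma millsN x : - x * gcdf x <= gpdf x.
Proof.
have := mills (- x); rewrite gcdfN opprB addrC subrK.
by rewrite /gpdf sqrrN.
Qed.

Lemma gpdf_le x y : 0 <= x -> x <= y -> gpdf y <= gpdf x.
Proof.
move=> x0 xy; rewrite /gpdf ler_pM2l ?normal_peak_gt0 ?oner_eq0// ler_expR.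
by rewrite lerN2 ler_pM2r ?invr_gt0// ler_sqr// nnegrE (le_trans x0).
Qed.

Let G x := gcdf x - 1 / 2.

Let is_derive_G x : is_derive x 1 G (gpdf x).
Proof. by apply: is_derive_eq; rewrite oppr0 addr0. Qed.

#[local] Existing Instance is_derive_G.

Let G0 : G 0 = 0.
Proof. by have := gcdfN 0; rewrite oppr0 /G; lra. Qed.

Let G_ge_pdf y : 0 <= y -> y * gpdf y <= G y.
Proof.
move=> y0; pose h u := G u - u * gpdf u.
have dh (u : R) : is_derive u (1 : R) h (u ^+ 2 * gpdf u).
  by rewrite /h; apply: is_derive_eq; rewrite /GRing.scale/=; ring.
have : h 0 <= h y.
  apply: (ge0_is_derive_le y0 (fun u _ => dh u)) => u _.
  by rewrite mulr_ge0 ?sqr_ge0// ltW// gpdf_gt0.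
by rewrite /h G0 mul0r subrr subr_ge0.
Qed.

(** The slope [G u / u] of the chord from the origin decreases, because concavity puts the tangent
    slope below it; the form without quotients includes [y = 0]. *)
Let G_concave y u : 0 <= y -> y <= u -> G u * y <= G y * u.
Proof.
move=> y0 yu; pose h u := G y * u - G u * y.
have dh (v : R) : is_derive v (1 : R) h (G y - y * gpdf v).
  by rewrite /h; apply: is_derive_eq; rewrite /GRing.scale/=; ring.
have : h y <= h u.
  apply: (ge0_is_derive_le yu (fun u _ => dh u)) => v /andP[yv _].
  rewrite subr_ge0 (le_trans _ (G_ge_pdf y0))//.
  by rewrite ler_wpM2l// gpdf_le.
by rewrite /h subrr subr_ge0.
Qed.

(* Since [G] is concave with [G 0 = 0], the sign of the derivative of
   [4 G ^ 2 - 1 + exp (- x ^ 2 / 2)] changes at most once, from + to -, and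
   this function vanishes at 0 and at +oo. *)
Let G_sqr x : 0 <= x -> 1 - expR (- (x ^+ 2 / 2)) <= 4 * G x ^+ 2.
Proof.
move=> x0; pose k : R := normal_peak 1.
have k0 : 0 < k by rewrite normal_peak_gt0 ?oner_eq0.
pose E (u : R) := expR (- (u ^+ 2 / 2)).
pose h u := 4 * G u ^+ 2 - 1 + E u.
have dh (u : R) : is_derive u (1 : R) h (E u * (8 * k * G u - u)).
  rewrite /h /E; apply: is_derive_eq; rewrite /GRing.scale/= /gpdf -/k.
  by field.
suff : 0 <= h x by rewrite /h /E; lra.
have [[y /andP[y0 yx] Gy]|H] :=
    pselect (exists2 y : R, 0 < y <= x & 8 * k * G y < y).
  have Gu (u : R) : y <= u -> 8 * k * G u <= u.
    move=> yu; rewrite -(ler_pM2r y0).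
    apply: (@le_trans _ _ (8 * k * (G y * u))).
      by rewrite -[leLHS]mulrA ler_wpM2l ?mulr_ge0 ?(ltW k0)// G_concave// ltW.
    by rewrite mulrA [leRHS]mulrC ler_pM2r ?(lt_le_trans y0)// ltW.
  (* From [y] on the function [h] decreases, so [h x] bounds [h u], hence [4 * G u ^+ 2 - 1], for
     all [u >= x]. The left-hand side below is 0, the limit of the latter. *)
  suff : (1 : R) + (4 * (1/2) ^+ 2 - 2) <= h x by lra.
  pose g (u : R) := 4 * gcdf u ^+ 2 - 4 * gcdf u.
  have hg (u : R) : x <= u -> 4 * G u ^+ 2 - 1 <= h x.
    move=> xu; rewrite (@le_trans _ _ (h u))//.
      by rewrite /h lerDl expR_ge0.
    rewrite -lerN2.
    have dhN (v : R) : is_derive v (1 : R) (fun u : R => - h u)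
        (- (E v * (8 * k * G v - v))) by apply: is_derive_eq.
    apply: (ge0_is_derive_le xu (fun v _ => dhN v)) => v /andP[xv _].
    by rewrite oppr_ge0 mulr_ge0_le0 ?expR_ge0// subr_le0 Gu// (le_trans yx).
  apply: (@cvgr_to_le _ (pinfty_nbhs R) _ _ (fun y => 4 * G y ^+ 2 - 1)).
    rewrite (_ : 1 + (4 * (1/2) ^+ 2 - 2) = 4 * (1 - 1/2) ^+ 2 - 1 :> R); last by field.
    apply: cvgB; last exact: cvg_cst.
    apply: cvgM; first exact: cvg_cst.
    apply: (cvg_comp _ (fun z : R => z ^+ 2)); last exact: exprn_continuous.
    by apply: cvgB; [exact: cvg_gcdfy|exact: cvg_cst].
  by near=> u; apply: hg; near: u; apply: nbhs_pinfty_ge; exact: num_real.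
have <- : h 0 = 0 by rewrite /h G0 /E !expr0n/= mul0r oppr0 expR0 mulr0 sub0r addNr.
apply: (ge0_is_derive_le x0 (fun u _ => dh u)) => u /andP[u0 ux].
rewrite mulr_ge0 ?expR_ge0// subr_ge0 leNgt; apply/negP => Gu; apply: H.
exists u => //; rewrite ux andbT lt_neqAle u0 andbT eq_sym.
by apply: contraTN Gu => /eqP ->; rewrite G0 mulr0 ltxx.
Unshelve. all: end_near. Qed.

(** This is [G_sqr], as [4 * gcdf x * (1 - gcdf x) = 1 - 4 * G x ^+ 2]. Equality holds at 0, so the
    bound on Stein solutions drawn from it is sharp. *)
Lemma gcdf_var_le x : 4 * (gcdf x * (1 - gcdf x)) <= expR (- (x ^+ 2 / 2)).
Proof.
wlog x0 : x / 0 <= x.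
  move=> h; have [/h//|/ltW x0] := leP 0 x.
  have := h (- x); rewrite oppr_ge0 => /(_ x0).
  by rewrite gcdfN sqrrN opprB (addrC 1 (_ - 1)) subrK [_ * gcdf x]mulrC.
have := G_sqr x0; rewrite /G; lra.
Qed.

End Gaussian.

(** * Stein's equation *)

Section Stein.
Context {R : realType}.
Implicit Types a b x y z : R.

(** Lets the mean value theorem act on functions with a kink at [z]: both branches are
    differentiable on the whole line, and [h] agrees with both at [z]. *)
Lemma glue_is_derive_le z (h h1 h2 d1 d2 : R -> R) a b : a <= b ->
  (forall x, x <= z -> h x = h1 x) -> (forall x, z <= x -> h x = h2 x) ->
  (forall x, is_derive x (1 : R) h1 (d1 x)) ->
  (forall x, is_derive x (1 : R) h2 (d2 x)) ->
  (forall x, a <= x <= b -> x <= z -> 0 <= d1 x) ->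
  (forall x, a <= x <= b -> z <= x -> 0 <= d2 x) -> h a <= h b.
Proof.
move=> ab hh1 hh2 dh1 dh2 d1ge0 d2ge0.
have [bz|/ltW zb] := leP b z.
  rewrite !hh1// ?(le_trans ab)//.
  apply: (ge0_is_derive_le ab (fun x _ => dh1 x)) => x axb.
  by apply: d1ge0 => //; move/andP: axb => [_ /le_trans]; exact.
have [za|/ltW az] := leP z a.
  rewrite !hh2//.
  apply: (ge0_is_derive_le ab (fun x _ => dh2 x)) => x axb.
  by apply: d2ge0 => //; move/andP: axb => [ax _]; exact: le_trans ax.
apply: (@le_trans _ _ (h z)).
  rewrite !hh1//.
  apply: (ge0_is_derive_le az (fun x _ => dh1 x)) => x /andP[ax xz].
  by apply: d1ge0 => //; rewrite ax (le_trans xz).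
rewrite !hh2//.
apply: (ge0_is_derive_le zb (fun x _ => dh2 x)) => x /andP[zx xb].
by apply: d2ge0 => //; rewrite xb andbT (le_trans az).
Qed.

Let is_derive_id_add s (h : R -> R) x (d : R) : is_derive x (1 : R) h d ->
  is_derive x (1 : R) (fun u => u + s * h u) (1 + s * d).
Proof. by move=> dh; apply: is_derive_eq; rewrite /GRing.scale/=; ring. Qed.

Let is_derive_id_sub (h : R -> R) x (d : R) : is_derive x (1 : R) h d ->
  is_derive x (1 : R) (fun u => h u - u) (d - 1).
Proof. by move=> dh; apply: is_derive_eq. Qed.

Let is_derive_cst_sub c (h : R -> R) x (d : R) : is_derive x (1 : R) h d ->
  is_derive x (1 : R) (fun u => h u - c) d.
Proof. by move=> dh; apply: is_derive_eq; rewrite oppr0 addr0. Qed.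

Let is_derive_taylor s q t a (h : R -> R) x (d : R) : is_derive x (1 : R) h d ->
  is_derive x (1 : R) (fun u => s * (h u - q * u) + t * ((u - a) ^+ 2 / 2))
    (s * (d - q) + t * (x - a)).
Proof. by move=> dh; apply: is_derive_eq; rewrite /GRing.scale/=; field. Qed.

(** The maximum of [stein z x] over [z] and [x], attained at [z = x = 0]; it becomes the constant in
    front of the Lyapunov ratio. *)
Definition stein_cst : R := Num.sqrt (2 * pi) / 4.

Let mx x : R := Num.sqrt (2 * pi) * expR (x ^+ 2 / 2).

(** The bounded solution of [f' x - x * f x = (x <= z) - gcdf z]; [mx] is the reciprocal of the
    Gaussian density. *)
Definition stein z x := mx x *
  (if x <= z then gcdf x * (1 - gcdf z) else gcdf z * (1 - gcdf x)).

(** The derivative of [stein z], read off Stein's equation. At the kink [x = z] the indicator makes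
    it the left derivative, so [dstein z] is left continuous. *)
Definition dstein z x := x * stein z x + ((x <= z)%R)%:R - gcdf z.

Let mx_ge0 x : 0 <= mx x.
Proof. by rewrite mulr_ge0 ?sqrtr_ge0 ?expR_ge0. Qed.

Let gpdf_mx x : gpdf x * mx x = 1. Proof. exact: gpdf_expR. Qed.

Let is_derive_mx x : is_derive x 1 mx (x * mx x).
Proof. by apply: is_derive_eq; rewrite /GRing.scale/= /mx; field. Qed.

#[local] Existing Instance is_derive_mx.
#[local] Existing Instance is_derive_gcdf.

Let f1 z x := mx x * (gcdf x * (1 - gcdf z)).
Let f2 z x := mx x * (gcdf z * (1 - gcdf x)).

Let is_derive_f1 z x : is_derive x 1 (f1 z) (x * f1 z x + (1 - gcdf z)).
Proof.
apply: is_derive_eq; rewrite /GRing.scale/= /f1.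
rewrite (_ : x * (mx x * _) + _ =
  x * (mx x * (gcdf x * (1 - gcdf z))) + (gpdf x * mx x) * (1 - gcdf z)).
  by ring.
by rewrite gpdf_mx mul1r.
Qed.

Let is_derive_f2 z x : is_derive x 1 (f2 z) (x * f2 z x - gcdf z).
Proof.
apply: is_derive_eq; rewrite /GRing.scale/= /f2.
rewrite (_ : x * (mx x * _) - _ =
  x * (mx x * (gcdf z * (1 - gcdf x))) - (gpdf x * mx x) * gcdf z).
  by ring.
by rewrite gpdf_mx mul1r.
Qed.

Lemma stein_ge0 z x : 0 <= stein z x.
Proof.
rewrite /stein mulr_ge0//; case: ifP => _; rewrite mulr_ge0 ?gcdf_ge0//;
by rewrite subr_ge0 gcdf_le1.
Qed.

Let stein1 z x : x <= z -> stein z x = f1 z x.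
Proof. by rewrite /stein => ->. Qed.

Let stein2 z x : z <= x -> stein z x = f2 z x.
Proof.
rewrite le_eqVlt /stein => /predU1P[->|zx]; first by rewrite lexx.
by rewrite leNgt zx.
Qed.

Let mx_var_le x : mx x * (gcdf x * (1 - gcdf x)) <= stein_cst.
Proof.
rewrite /mx /stein_cst -mulrA ler_wpM2l ?sqrtr_ge0//.
rewrite -(ler_pM2l (_ : 0 < 4))// divff// mulrCA.
have := gcdf_var_le x; rewrite expRN => h.
by rewrite (le_trans (ler_wpM2l (expR_ge0 _) h))// divff// gt_eqF// expR_gt0.
Qed.

Let gcdfC_ge0 x : 0 <= 1 - gcdf x :> R.
Proof. by rewrite subr_ge0 gcdf_le1. Qed.

(** The right-hand side is [stein x x]: for fixed [x] the solution is largest at [z = x], by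
    monotonicity of [gcdf]. *)
Let stein_var z x : stein z x <= mx x * (gcdf x * (1 - gcdf x)).
Proof.
rewrite /stein ler_wpM2l//; case: (leP x z) => xz.
  by rewrite ler_wpM2l ?gcdf_ge0// lerB// gcdf_nd.
by rewrite ler_wpM2r// gcdf_nd// ltW.
Qed.

Lemma stein_le z x : stein z x <= stein_cst.
Proof. exact: le_trans (stein_var z x) (mx_var_le x). Qed.

Let mills_mx x : x * mx x * (1 - gcdf x) <= 1.
Proof.
have := ler_wpM2l (mx_ge0 x) (mills x).
by rewrite [leRHS]mulrC gpdf_mx mulrA [mx x * x]mulrC.
Qed.

Let millsN_mx x : - 1 <= x * mx x * gcdf x.
Proof.
have := ler_wpM2l (mx_ge0 x) (millsN x).
rewrite [leRHS]mulrC gpdf_mx mulNr mulrN mulrA [mx x * x]mulrC.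
by rewrite lerNl.
Qed.

(** The derivative of [f1 z] equals [(1 - gcdf z) * (x * mx x * gcdf x + 1)], nonnegative by the
    Mills bound at [- x]. For [x >= 0] the upper bound is [x * f1 z x <= gcdf x <= gcdf z], from
    [stein_var] and the Mills bound at [x]. *)
Let d1_bnd z x : x <= z -> `|x * f1 z x + (1 - gcdf z)| <= 1.
Proof.
move=> xz; rewrite ger0_norm; last first.
  rewrite /f1 [leRHS](_ : _ = (1 - gcdf z) * (x * mx x * gcdf x - - 1)); last by ring.
  by rewrite mulr_ge0// subr_ge0.
have [x0|/ltW x0] := leP x 0.
  rewrite -[leRHS]add0r lerD// ?gerBl ?gcdf_ge0//.
  by rewrite mulr_le0_ge0// -(stein1 xz) stein_ge0.
rewrite addrCA gerDl -(stein1 xz) subr_le0 (le_trans (ler_wpM2l x0 (stein_var z x)))//.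
rewrite (_ : x * _ = gcdf x * (x * mx x * (1 - gcdf x))); last by ring.
by rewrite -[leRHS]mulr1 ler_pM ?gcdf_ge0 ?mulr_ge0// gcdf_nd.
Qed.

Let d2_bnd z x : z <= x -> `|x * f2 z x - gcdf z| <= 1.
Proof.
move=> zx; rewrite ler0_norm; last first.
  rewrite /f2 [leLHS](_ : _ = gcdf z * (x * mx x * (1 - gcdf x) - 1)); last by ring.
  by rewrite mulr_ge0_le0 ?gcdf_ge0// subr_le0.
rewrite opprB; have [x0|/ltW x0] := leP 0 x.
  rewrite lerBlDr (le_trans (gcdf_le1 _))// lerDl.
  by rewrite mulr_ge0// -(stein2 zx) stein_ge0.
rewrite -(stein2 zx) lerBlDr -lerBlDl.
have x0' : 0 <= - x by rewrite oppr_ge0.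
rewrite -lerN2 opprB -mulNr (le_trans (ler_wpM2l x0' (stein_var z x)))//.
rewrite (_ : - x * _ = (1 - gcdf x) * (- (x * mx x * gcdf x))); last by ring.
rewrite -[leRHS]mulr1 ler_pM//; last by rewrite lerNl.
  by rewrite oppr_ge0 mulr_le0_ge0 ?gcdf_ge0// mulr_le0_ge0.
by rewrite lerB// gcdf_nd.
Qed.

Lemma dstein_bnd z x : `|dstein z x| <= 1.
Proof.
rewrite /dstein; case: (leP x z) => xz.
  by rewrite stein1// -addrA d1_bnd.
by rewrite addr0 stein2 ?d2_bnd// ltW.
Qed.

(** [x + s * stein z x] is nondecreasing since the derivative of either branch is at most 1 in
    absolute value; [s = 1] and [s = -1] give the two halves of the Lipschitz bound. *)
Let stein_lip_sign z s a b : `|s| <= 1 -> a <= b ->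
  s * (stein z a - stein z b) <= b - a.
Proof.
move=> s1 ab.
suff : a + s * stein z a <= b + s * stein z b by rewrite mulrBr lerBrDr addrAC lerBlDr [X in _ -> X <= _]addrC.
have dh1 x : is_derive x (1 : R) (fun x : R => x + s * f1 z x)
    (1 + s * (x * f1 z x + (1 - gcdf z))).
  exact/is_derive_id_add/is_derive_f1.
have dh2 x : is_derive x (1 : R) (fun x : R => x + s * f2 z x)
    (1 + s * (x * f2 z x - gcdf z)).
  exact/is_derive_id_add/is_derive_f2.
have ge0 y : `|y| <= 1 -> 0 <= 1 + s * y.
  move=> y1; have : `|s * y| <= 1 by rewrite normrM mulr_ile1.
  by rewrite ler_norml => /andP[+ _]; rewrite -subr_ge0 opprK addrC.
apply: (@glue_is_derive_le z (fun x => x + s * stein z x) _ _ _ _ a b ab _ _ dh1 dh2).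
- by move=> x /stein1 ->.
- by move=> x /stein2 ->.
- by move=> x _ /d1_bnd/ge0.
- by move=> x _ /d2_bnd/ge0.
Qed.

Lemma stein_lipschitz z a b : `|stein z a - stein z b| <= `|a - b|.
Proof.
wlog ab : a b / a <= b.
  by move=> h; have [/h//|/ltW/h] := leP a b; rewrite distrC [leRHS]distrC.
rewrite [leRHS]distrC (ger0_norm (_ : 0 <= b - a)) ?subr_ge0// ler_norml.
have := @stein_lip_sign z 1 a b; rewrite normr1 mul1r => -> //.
have := @stein_lip_sign z (-1) a b; rewrite normrN normr1 mulN1r => /(_ _ ab).
by rewrite lerNl => ->.
Qed.

(** Based at [a], so that only [|a|] enters: write [x * f x - a * f a = a * (f x - f a) + (x - a) *
    f x], with [f] 1-Lipschitz and bounded by [stein_cst]. This is the origin of the weight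
    [|a| + stein_cst] in the remainder. *)
Let xstein_lip z a x :
  `|x * stein z x - a * stein z a| <= (`|a| + stein_cst) * `|x - a|.
Proof.
rewrite (_ : _ - _ = a * (stein z x - stein z a) + (x - a) * stein z x); last by ring.
rewrite (le_trans (ler_normD _ _))// [leRHS]mulrDl.
apply: lerD; rewrite normrM; first by rewrite ler_wpM2l// stein_lipschitz.
by rewrite [leRHS]mulrC ler_wpM2l// (ger0_norm (stein_ge0 _ _)) stein_le.
Qed.

(* Subtracting [min x z] removes the kink of [stein z] at [z]. *)
Let smooth z x := stein z x - Num.min x z.

(** Both branches of [smooth z] have derivative [u * stein z u - gcdf z], with no jump at [z]; the
    quadratic term is there to absorb its variation. *)
Let smooth_glue z s t q a x y : x <= y ->
  (forall u, x <= u <= y -> 0 <= s * (u * stein z u - gcdf z - q) + t * (u - a)) ->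
  s * (smooth z x - q * x) + t * ((x - a) ^+ 2 / 2) <=
  s * (smooth z y - q * y) + t * ((y - a) ^+ 2 / 2).
Proof.
move=> xy ge0.
have dh1 u : is_derive u (1 : R)
    (fun x : R => s * (f1 z x - x - q * x) + t * ((x - a) ^+ 2 / 2))
    (s * (u * f1 z u - gcdf z - q) + t * (u - a)).
  rewrite (_ : _ - gcdf z = u * f1 z u + (1 - gcdf z) - 1); last by ring.
  exact/is_derive_taylor/is_derive_id_sub/is_derive_f1.
have dh2 u : is_derive u (1 : R)
    (fun x : R => s * (f2 z x - z - q * x) + t * ((x - a) ^+ 2 / 2))
    (s * (u * f2 z u - gcdf z - q) + t * (u - a)).
  exact/is_derive_taylor/is_derive_cst_sub/is_derive_f2.
apply: (@glue_is_derive_le z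
  (fun x => s * (smooth z x - q * x) + t * ((x - a) ^+ 2 / 2)) _ _ _ _ x y xy _ _ dh1 dh2).
- by move=> u uz; rewrite /smooth stein1// min_l.
- by move=> u uz; rewrite /smooth stein2// min_r.
- by move=> u uxy uz; rewrite -(stein1 uz) ge0.
- by move=> u uxy uz; rewrite -(stein2 uz) ge0.
Qed.

(** A Taylor bound from a Lipschitz derivative, without a second derivative: with [q] the derivative
    at [a] and [L] the constant of [xstein_lip], adding or subtracting [L * (x - a) ^+ 2 / 2] makes
    [s * (smooth z x - q * x)] monotone on either side of [a]. *)
Let smooth_taylor z a b :
  `|smooth z a - smooth z b - (a * stein z a - gcdf z) * (a - b)| <=
  (`|a| + stein_cst) * ((a - b) ^+ 2 / 2).
Proof.
set q := a * _ - _; set L := `|a| + _.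
have bnd s u : `|s| = 1 -> `|s * (u * stein z u - gcdf z - q)| <= L * `|u - a|.
  move=> s1; rewrite normrM s1 mul1r (le_trans _ (xstein_lip z a u))//.
  by rewrite /q (_ : _ - _ - _ = u * stein z u - a * stein z a)//; ring.
have key s : `|s| = 1 ->
  s * (smooth z b - smooth z a + q * (a - b)) <= L * ((a - b) ^+ 2 / 2).
  move=> s1; have [ab|/ltW ba] := leP a b.
    have : - s * (smooth z a - q * a) <=
        - s * (smooth z b - q * b) + L * ((a - b) ^+ 2 / 2).
      rewrite -[X in X / 2]sqrrN opprB.
      have := @smooth_glue z (- s) L q a a b ab.
      rewrite subrr expr0n/= mul0r mulr0 addr0; apply => u /andP[au ub].
      have := bnd (- s) u; rewrite normrN => /(_ s1).
      rewrite (ger0_norm (_ : 0 <= u - a)) ?subr_ge0// ler_norml => /andP[+ _].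
      by rewrite -subr_ge0 opprK.
    rewrite -lerBlDl => h; apply: le_trans h.
    by rewrite le_eqVlt; apply/orP; left; apply/eqP; ring.
  have : s * (smooth z b - q * b) + - L * ((a - b) ^+ 2 / 2) <=
      s * (smooth z a - q * a).
    rewrite -[X in X / 2]sqrrN opprB.
    have := @smooth_glue z s (- L) q a b a ba.
    rewrite subrr expr0n/= mul0r mulr0 addr0; apply => u /andP[bu ua].
    have := bnd s u s1.
    rewrite (ler0_norm (_ : u - a <= 0)) ?subr_le0// ler_norml => /andP[+ _].
    by rewrite mulrN mulNr opprK -subr_ge0.
  rewrite mulNr lerBlDr -lerBlDl => h; apply: le_trans h.
  by rewrite le_eqVlt; apply/orP; left; apply/eqP; ring.
have k1 := key 1 (normr1 _); have k2 := key (-1).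
rewrite normrN normr1 mulN1r in k2; rewrite mul1r in k1.
rewrite ler_norml lerNl; apply/andP; split.
  by apply: le_trans k1; rewrite le_eqVlt; apply/orP; left; apply/eqP; ring.
by apply: le_trans (k2 erefl); rewrite le_eqVlt; apply/orP; left; apply/eqP; ring.
Qed.

Definition ind_gt z x : R := ((z < x)%R)%:R.

(** The function [min x z] removed in [smooth] leaves [min a z - min b z - (a <= z) * (a - b)]. This
    vanishes unless [z] separates [a] and [b], and is then at most [|a - b|], the value of the last
    term. *)
Lemma stein_taylor z a b :
  `|stein z a - stein z b - dstein z a * (a - b)| <=
  (`|a| + stein_cst) * ((a - b) ^+ 2 / 2) + (a - b) * (ind_gt z a - ind_gt z b).
Proof.
have := smooth_taylor z a b.
rewrite (_ : stein z a - stein z b - _ =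
  (smooth z a - smooth z b - (a * stein z a - gcdf z) * (a - b)) +
  (Num.min a z - Num.min b z - ((a <= z)%R)%:R * (a - b))); last first.
  by rewrite /dstein /smooth; ring.
move=> h; rewrite (le_trans (ler_normD _ _))// lerD// {h} /ind_gt.
case: (leP a z) => az; case: (leP b z) => bz /=.
- by rewrite mul1r !subrr normr0 mulr0.
- rewrite mul1r sub0r mulrN1 ler_norml; apply/andP; split; lra.
- rewrite mul0r !subr0 mulr1 ler_norml; apply/andP; split; lra.
- by rewrite mul0r !subrr normr0 mulr0.
Qed.

End Stein.

(** * Conditional expectations *)

Section ConditionalExpectation.
Context d (T : measurableType d) (R : realType) (P : probability T R).
Implicit Types (C : set (set T)) (Y V f g : T -> R) (A B : set T).

Local Notation L1 f := (P.-integrable [set: T] (EFin \o f)).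

Definition sub_sigma C := forall A, <<s C >> A -> measurable A.

(** The domain is retyped with [<<s C>>] so that the closure properties of measurable functions
    apply to sub-sigma-algebras. *)
Definition gmeas C (f : T -> R) :=
  measurable_fun [set: g_sigma_algebraType C] (f : g_sigma_algebraType C -> R).

Lemma gmeasP C f : gmeas C f <-> forall B : set R, measurable B -> <<s C >> (f @^-1` B).
Proof.
split=> mf.
  by move=> B mB; have := mf measurableT B mB; rewrite setTI.
by move=> _ B mB; rewrite setTI; exact: mf.
Qed.

Lemma gmeas_measurable C f : sub_sigma C -> gmeas C f ->
  measurable_fun [set: T] f.
Proof.
by move=> sC /gmeasP mf _ B mB; rewrite setTI; apply: sC; exact: mf.
Qed.

Section existence.
Context C (sC : sub_sigma C) Y (intY : L1 Y).

Let idC : T -> g_sigma_algebraType C := idfun.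

Let midC : measurable_fun [set: T] idC.
Proof. by move=> _ B mB; rewrite setTI; exact: sC. Qed.

HB.instance Definition _ := @isMeasurableFun.Build _ _ _ _ idC midC.

Let nu := pushforward (induced_charge intY) idC.
Let mu := distribution P (idC : {RV P >-> g_sigma_algebraType C}).

Let nu_mu : nu `<< mu.
Proof.
apply/null_content_dominatesP => A mA A0.
rewrite /nu /pushforward /induced_charge null_set_integral//.
- exact: sC.
- exact: (measurable_funS measurableT _ (measurable_int _ intY)).
Qed.

(** Radon-Nikodym for the charge [A |-> E[Y; A]]. The identity, viewed as a map into [T] with
    [<<s C>>], pushes this charge and [P] forward to the smaller sigma-algebra, so the density is
    measurable for it. *)
Lemma is_condexp_ex : exists V, is_condexp P <<s C >> Y V.
Proof.
pose f := Radon_Nikodym nu mu.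
have fi : mu.-integrable setT (f midC) by exact: Radon_Nikodym_integrable.
have ff x : f midC x \is a fin_num by exact: Radon_Nikodym_fin_num.
pose V : T -> R := fine \o f midC.
have fV : f midC = EFin \o V by apply/funext => x; rewrite /V/= fineK.
have mf := measurable_int _ fi.
have gV : gmeas C V by apply/measurable_EFinP; move: mf; rewrite fV.
have V1 : L1 V.
  apply/integrableP; split.
    by apply/measurable_EFinP; exact: gmeas_measurable gV.
  have /integrableP[_] := fi; rewrite /mu.
  rewrite ge0_integral_pushforward//; first by rewrite preimage_setT /= fV.
  exact: measurableT_comp.
exists V; split; first exact/Lfun1_integrable.
  by apply/gmeasP.
move=> A GA; transitivity (nu A); last by [].
have -> : nu A = (\int[mu]_(x in A) f midC x)%E.
  exact: (@Radon_Nikodym_integral _ _ _ _ mu A nu_mu GA).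
rewrite /mu (integral_pushforward midC)//.
  by rewrite fV.
by rewrite -/idC; apply: (integrableS measurableT) => //; [exact: sC|rewrite fV].
Qed.
End existence.
End ConditionalExpectation.

(** * Integrable and square integrable random variables *)

Section Expectation.
Context d (T : measurableType d) (R : realType) (P : probability T R).
Implicit Types (f g h : T -> R) (A B : set T).

Local Notation E f := (Rintegral P [set: T] f).

Definition L1 f := P.-integrable [set: T] (EFin \o f).

Definition L2 f := measurable_fun [set: T] f /\ L1 (fun w => f w ^+ 2).

Lemma L1_meas f : L1 f -> measurable_fun [set: T] f.
Proof. by move=> /measurable_int/measurable_EFinP. Qed.

Lemma eq_L1 f g : (forall w, f w = g w) -> L1 f -> L1 g.
Proof. by move=> /funext ->. Qed.

Lemma L1D f g : L1 f -> L1 g -> L1 (fun w => f w + g w).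
Proof. by move=> f1 g1; exact: (integrableD measurableT f1 g1). Qed.

Lemma L1B f g : L1 f -> L1 g -> L1 (fun w => f w - g w).
Proof. by move=> f1 g1; exact: (integrableB measurableT f1 g1). Qed.

Lemma L1Z c f : L1 f -> L1 (fun w => c * f w).
Proof. by move=> f1; exact: (integrableZl measurableT c f1). Qed.

Lemma L1_cst c : L1 (fun=> c).
Proof. exact/Lfun1_integrable/Lfun_cst. Qed.

Lemma L1_norm f : L1 f -> L1 (fun w => `|f w|).
Proof. by move=> f1; exact: (integrable_abse f1). Qed.

Lemma L1_sum n (u : nat -> T -> R) : (forall i, (i < n)%N -> L1 (u i)) ->
  L1 (fun w => \sum_(i < n) u i w).
Proof.
elim: n => [|n ih] u1.
  by under eq_fun do rewrite big_ord0; exact: L1_cst.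
under eq_fun do rewrite big_ord_recr/=.
by apply: L1D; [apply: ih => i /ltnW; exact: u1|exact: u1].
Qed.

Lemma L1_dom f g : measurable_fun [set: T] f -> L1 g ->
  (forall w, `|f w| <= g w) -> L1 f.
Proof.
move=> mf g1 fg; apply: (le_integrable measurableT _ _ g1).
  exact/measurable_EFinP.
by move=> w _ /=; rewrite lee_fin (le_trans (fg w))// ler_norm.
Qed.

Lemma L1_bnd f (c : R) : measurable_fun [set: T] f -> (forall w, `|f w| <= c) -> L1 f.
Proof. by move=> mf fc; exact: L1_dom mf (L1_cst c) fc. Qed.

Lemma L1_mul_bnd f h (c : R) : L1 f -> measurable_fun [set: T] h ->
  (forall w, `|h w| <= c) -> L1 (fun w => f w * h w).
Proof.
move=> f1 mh hc; apply: (L1_dom _ (L1Z c (L1_norm f1))).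
  exact: (measurable_funM (L1_meas f1) mh).
by move=> w; rewrite normrM mulrC ler_wpM2r.
Qed.

Lemma indic_meas A : measurable A -> measurable_fun [set: T] (\1_A : T -> R).
Proof. by move=> mA; apply/measurable_indicP. Qed.

Lemma indic_ge0 A (w : T) : 0 <= \1_A w :> R.
Proof. by rewrite indicE ler0n. Qed.

Lemma indic_le1 A (w : T) : \1_A w <= 1 :> R.
Proof. by rewrite indicE; case: (_ \in _). Qed.

Lemma L1_mul_indic f A : L1 f -> measurable A -> L1 (fun w => f w * \1_A w).
Proof.
move=> f1 mA; apply: (@L1_mul_bnd _ _ 1) => //.
by move=> w; rewrite indicE; case: (_ \in _); rewrite ?normr0 ?normr1.
Qed.

Lemma ED f g : L1 f -> L1 g -> E (fun w => f w + g w) = E f + E g.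
Proof. by move=> f1 g1; rewrite RintegralD. Qed.

Lemma EB f g : L1 f -> L1 g -> E (fun w => f w - g w) = E f - E g.
Proof. by move=> f1 g1; rewrite RintegralB. Qed.

Lemma EZ c f : L1 f -> E (fun w => c * f w) = c * E f.
Proof. by move=> f1; rewrite RintegralZl. Qed.

Lemma EN f : L1 f -> E (fun w => - f w) = - E f.
Proof.
by move=> f1; rewrite -mulN1r -EZ//; apply: eq_Rintegral => w _; rewrite mulN1r.
Qed.

Lemma E_cst c : E (fun=> c) = c.
Proof. by rewrite Rintegral_cst//= probability_setT mulr1. Qed.

Lemma Esum n (u : nat -> T -> R) : (forall i, (i < n)%N -> L1 (u i)) ->
  E (fun w => \sum_(i < n) u i w) = \sum_(i < n) E (u i).
Proof.
elim: n => [|n ih] u1.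
  by under eq_fun do rewrite big_ord0; rewrite E_cst big_ord0.
under eq_fun do rewrite big_ord_recr/=.
rewrite ED; [|by apply: L1_sum => i /ltnW; exact: u1|exact: u1].
by rewrite big_ord_recr/= ih// => i /ltnW; exact: u1.
Qed.

Lemma eqE f g : (forall w, f w = g w) -> E f = E g.
Proof. by move=> fg; congr (Rintegral _ _ _); exact/funext. Qed.

Lemma E_le f g : L1 f -> L1 g -> (forall w, f w <= g w) -> E f <= E g.
Proof. by move=> f1 g1 fg; apply: le_Rintegral. Qed.

Lemma E_ge0 f : (forall w, 0 <= f w) -> 0 <= E f.
Proof. by move=> f0; apply: Rintegral_ge0. Qed.

Lemma E_abs f : L1 f -> `|E f| <= E (fun w => `|f w|).
Proof. by move=> f1; exact: le_normr_Rintegral. Qed.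

Lemma EFin_E f : L1 f -> ((E f)%:E = \int[P]_w (f w)%:E)%E.
Proof. by move=> f1; rewrite fineK//; exact: integrable_fin_num. Qed.

Lemma aeP (Q : T -> Prop) : (forall w, Q w) -> {ae P, forall w, Q w}.
Proof. by move=> Qw; apply: filterE. Qed.

Lemma E_eq_ae f g : measurable_fun [set: T] f -> measurable_fun [set: T] g ->
  {ae P, forall w, f w = g w} -> E f = E g.
Proof.
move=> mf mg fg; congr fine; apply: ae_eq_integral => //; [exact/measurable_EFinP..|].
by apply: filterS fg => w /= -> _.
Qed.

Lemma E_ge0_ae f : measurable_fun [set: T] f -> {ae P, forall w, 0 <= f w} -> 0 <= E f.
Proof.
move=> mf f0; rewrite (@E_eq_ae _ (fun w => `|f w|))//.
- exact: E_ge0.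
- exact: measurableT_comp.
- by apply: filterS f0 => w /ger0_norm ->.
Qed.

Lemma E_le_ae f g : L1 f -> L1 g -> {ae P, forall w, f w <= g w} -> E f <= E g.
Proof.
move=> f1 g1 fg; rewrite -subr_ge0 -EB// E_ge0_ae//; first exact/L1_meas/L1B.
by apply: filterS fg => w; rewrite subr_ge0.
Qed.

Lemma L1_dom_ae f g : measurable_fun [set: T] f -> L1 g ->
  {ae P, forall w, `|f w| <= g w} -> L1 f.
Proof.
move=> mf g1 fg; apply/integrableP; split; first exact/measurable_EFinP.
have /integrableP[_] := g1; apply: le_lt_trans.
apply: ae_ge0_le_integral => //=.
- by do 2 apply: measurableT_comp => //.
- by do 2 apply: measurableT_comp => //; exact: L1_meas.
- by apply: filterS fg => w + _; rewrite lee_fin => /le_trans; apply; exact: ler_norm.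
Qed.

Lemma E_abs_eq0 f : L1 f -> E (fun w => `|f w|) = 0 -> {ae P, forall w, f w = 0}.
Proof.
move=> f1 f0.
have : (\int[P]_w `|(EFin \o f) w| = 0)%E.
  by rewrite -[RHS]/(0%:E) -f0 EFin_E//; exact: L1_norm.
move/ae_eq_integral_abs => /(_ measurableT) h.
have {}h := h (measurable_int _ f1).
by apply: filterS h => w /(_ I) [].
Qed.

Lemma L2_meas f : L2 f -> measurable_fun [set: T] f. Proof. by case. Qed.

Lemma L2_mul f g : L2 f -> L2 g -> L1 (fun w => f w * g w).
Proof.
move=> [mf f2] [mg g2]; apply: (L1_dom _ (L1D f2 g2)); first exact: measurable_funM.
move=> w; rewrite normrM -(real_normK (num_real (f w))) -(real_normK (num_real (g w))).
have := sqr_ge0 (`|f w| - `|g w|); have := normr_ge0 (f w); have := normr_ge0 (g w).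
set a := `|f w|; set b := `|g w| => a0 b0; nra.
Qed.

Lemma L2_bnd f c : measurable_fun [set: T] f -> (forall w, `|f w| <= c) -> L2 f.
Proof.
move=> mf fc; split=> //; apply: (@L1_bnd _ (c ^+ 2)); first exact: measurable_funX.
by move=> w; rewrite normrX lerXn2r ?nnegrE// (le_trans _ (fc w)).
Qed.

Lemma L2_L1 f : L2 f -> L1 f.
Proof.
move=> f2; have /(L2_mul f2) : L2 (fun=> 1).
  by apply: (@L2_bnd _ 1) => // w; rewrite normr1.
by under eq_fun do rewrite mulr1.
Qed.

Lemma L2_dom f g : measurable_fun [set: T] f -> L2 g ->
  {ae P, forall w, `|f w| <= `|g w|} -> L2 f.
Proof.
move=> mf g2 fg; split=> //; apply: (L1_dom_ae _ g2.2); first exact: measurable_funX.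
apply: filterS fg => w fg; rewrite (ger0_norm (sqr_ge0 _)) -(real_normK (num_real (f w))) -(real_normK (num_real (g w))).
by rewrite ler_sqr ?nnegrE.
Qed.

Lemma L2D f g : L2 f -> L2 g -> L2 (fun w => f w + g w).
Proof.
move=> f2 g2; split; first exact: measurable_funD f2.1 g2.1.
under eq_fun do rewrite sqrrD.
apply: L1D; last exact: g2.2.
apply: L1D; first exact: f2.2.
by under eq_fun do rewrite -mulr_natl; exact/L1Z/L2_mul.
Qed.

Lemma L2Z c f : L2 f -> L2 (fun w => c * f w).
Proof.
move=> f2; split; first by apply: measurable_funM => //; exact: L2_meas.
by under eq_fun do rewrite exprMn; exact/L1Z/f2.2.
Qed.

Lemma L2B f g : L2 f -> L2 g -> L2 (fun w => f w - g w).
Proof.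
move=> f2 /(L2Z (-1)) /(L2D f2).
by under eq_fun do rewrite mulN1r.
Qed.

Lemma L2_norm f : L2 f -> L2 (fun w => `|f w|).
Proof.
move=> f2; apply: (L2_dom _ f2); last by apply: aeP => w; rewrite normr_id.
by apply: measurableT_comp => //; exact: L2_meas.
Qed.

Lemma L2_mul_bnd f h (c : R) : L2 f -> measurable_fun [set: T] h ->
  {ae P, forall w, `|h w| <= c} -> L2 (fun w => f w * h w).
Proof.
move=> f2 mh hc; apply: (L2_dom _ (L2Z c f2)).
  exact: (measurable_funM (L2_meas f2) mh).
apply: filterS hc => w hc; rewrite !normrM mulrC ler_wpM2r//.
by rewrite (le_trans hc)// ler_norm.
Qed.

Definition trunc (U : T -> R) (k : nat) : set T := [set w | `|U w| <= k%:R].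

Lemma trunc_meas U k : measurable_fun [set: T] U -> measurable (trunc U k).
Proof.
move=> mU; rewrite -[trunc U k]setTI; apply: measurable_fun_le => //.
exact: measurableT_comp.
Qed.

Let trunc_cvg U f w : f w * \1_(trunc U k) w @[k --> \oo] --> f w.
Proof.
apply: (cvg_near_cst (f w)).
near=> k; rewrite indicE mem_set ?mulr1// /trunc/=.
near: k; exact: nbhs_infty_ger.
Unshelve. all: end_near. Qed.

Lemma E_dct (u : nat -> T -> R) f g : (forall n, measurable_fun [set: T] (u n)) ->
  measurable_fun [set: T] f -> L1 g -> (forall n w, `|u n w| <= g w) ->
  (forall w, u n w @[n --> \oo] --> f w) -> E (u n) @[n --> \oo] --> E f.
Proof.
move=> mu mf g1 ug uf.
have f1 : L1 f.
  apply: (L1_dom mf g1) => w.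
  have /cvgr_to_le : `|u n w| @[n --> \oo] --> `|f w| by apply: cvg_norm; exact: uf.
  by apply; apply: nearW.
have [] := @dominated_convergence _ _ _ P setT measurableT
  (fun n w => (u n w)%:E) (EFin \o f) (EFin \o g).
- by move=> n; apply/measurable_EFinP.
- exact/measurable_EFinP.
- by apply: aeP => w _; apply: cvg_EFin; [exact: nearW|exact: uf].
- by [].
- by apply: aeP => w n _; rewrite /= lee_fin.
by move=> _ _ h; apply: fine_cvg; rewrite EFin_E.
Qed.

Lemma E_trunc U f : measurable_fun [set: T] U -> L1 f ->
  E (fun w => f w * \1_(trunc U k) w) @[k --> \oo] --> E f.
Proof.
move=> mU f1; have mf := L1_meas f1.
apply: (@E_dct (fun k w => f w * \1_(trunc U k) w) f _ _ mf (L1_norm f1)) => [k|k w|w].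
- exact: (measurable_funM mf (indic_meas (trunc_meas k mU))).
- by rewrite normrM ler_piMr// ger0_norm ?indic_ge0// indic_le1.
- exact: trunc_cvg.
Qed.

(** Monotone convergence along the sets [|U| <= k]. It serves where integrability is part of the
    claim: a bound uniform in [k] on the truncations yields both conclusions. *)
Lemma L1_trunc U f (M : R) : measurable_fun [set: T] U -> measurable_fun [set: T] f ->
  (forall w, 0 <= f w) -> (forall k, L1 (fun w => f w * \1_(trunc U k) w)) ->
  (forall k, E (fun w => f w * \1_(trunc U k) w) <= M) ->
  L1 f /\ E f <= M.
Proof.
move=> mU mf f0 fk1 fkM.
have lim_w w : limn (fun k => (f w * \1_(trunc U k) w)%:E) = (f w)%:E.
  apply: cvg_lim => //; apply: cvg_EFin; first exact: nearW.
  exact: trunc_cvg.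
have fkge0 k w : 0 <= f w * \1_(trunc U k) w by rewrite mulr_ge0// indicE.
have homo w : {homo (fun k => f w * \1_(trunc U k) w) : n m / (n <= m)%N >-> n <= m}.
  move=> n m nm; rewrite ler_wpM2l// !indicE ler_nat.
  have [wn|] := boolP (w \in trunc U n); last by [].
  rewrite mem_set//; move: wn; rewrite inE /trunc/= => /le_trans; apply.
  by rewrite ler_nat.
have intf : (\int[P]_w (f w)%:E <= M%:E)%E.
  have := @monotone_convergence _ _ _ P setT measurableT
    (fun k w => (f w * \1_(trunc U k) w)%:E).
  under eq_integral do rewrite lim_w.
  move=> ->.
  - apply: lime_le; last by apply: nearW => k; rewrite -EFin_E// lee_fin.
    apply: ereal_nondecreasing_is_cvgn => n m nm; apply: ge0_le_integral => //=; first [by move=> w _; rewrite lee_fin ?homo | exact: measurable_int (fk1 n) | exact: measurable_int (fk1 m)].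
  - by move=> k; exact: measurable_int (fk1 k).
  - by move=> k w _; rewrite lee_fin.
  - by move=> w _ n m nm; rewrite lee_fin homo.
have f1 : L1 f.
  apply/integrableP; split; first exact/measurable_EFinP.
  rewrite (le_lt_trans _ (ltry M))// (le_trans _ intf)//.
  by under eq_integral do rewrite /= ger0_norm//.
by split=> //; rewrite -lee_fin EFin_E.
Qed.

End Expectation.

(** * Order, pull-out and moment inequalities for conditional expectations *)

Section CondexpProperties.
Context d (T : measurableType d) (R : realType) (P : probability T R).
Implicit Types (C : set (set T)) (Y V U f g : T -> R) (A B : set T).

Local Notation E f := (Rintegral P [set: T] f).

(* [V] is a version of [E[Y | <<s C>>]]; real-valued form of [is_condexp]. *)
Definition CE C Y V := [/\ L1 P V, gmeas C V &
  forall A, <<s C >> A -> E (fun w => V w * \1_A w) = E (fun w => Y w * \1_A w)].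

Lemma E_indic f A : L1 P f -> measurable A ->
  (E (fun w => f w * \1_A w))%:E = (\int[P]_(w in A) (f w)%:E)%E.
Proof.
move=> f1 mA; rewrite EFin_E; last exact: L1_mul_indic.
rewrite [RHS]integral_mkcond; apply: eq_integral => w _.
by rewrite patchE indicE; case: ifPn => _; rewrite ?mulr1 ?mulr0.
Qed.

Lemma is_condexpP C Y V : sub_sigma C -> L1 P Y ->
  is_condexp P <<s C >> Y V <-> CE C Y V.
Proof.
move=> sC Y1; split => [[/Lfun1_integrable V1 mV VY]|[V1 mV VY]].
  split=> //; first exact/gmeasP.
  move=> A CA; have /VY : <<s C >> A by [].
  by rewrite -!E_indic//; [case|exact: sC..].
split; [exact/Lfun1_integrable|exact/gmeasP|].
by move=> A CA; rewrite -!E_indic//; [rewrite VY|exact: sC..].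
Qed.

Lemma condexpP C Y : sub_sigma C -> L1 P Y -> CE C Y (condexp P <<s C >> Y).
Proof.
move=> sC Y1; apply/is_condexpP => //; rewrite /condexp.
by apply: xgetPex; exact: is_condexp_ex.
Qed.

Lemma CE_E C Y V : CE C Y V -> E V = E Y.
Proof.
case=> V1 _ /(_ setT (@measurableT _ (g_sigma_algebraType C))).
under eq_Rintegral do rewrite indicT mulr1.
by under [X in _ = X -> _]eq_Rintegral do rewrite indicT mulr1.
Qed.

Lemma CED C Y Y' V V' : L1 P Y -> L1 P Y' -> sub_sigma C ->
  CE C Y V -> CE C Y' V' -> CE C (fun w => Y w + Y' w) (fun w => V w + V' w).
Proof.
move=> Y1 Y1' sC [V1 mV VY] [V1' mV' VY']; split; first exact: L1D.
  exact: measurable_funD mV mV'.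
move=> A CA; have mA := sC _ CA.
under eq_Rintegral do rewrite mulrDl.
under [RHS]eq_Rintegral do rewrite mulrDl.
by rewrite !ED ?VY ?VY'//; exact: L1_mul_indic.
Qed.

Lemma CEZ C c Y V : L1 P Y -> sub_sigma C ->
  CE C Y V -> CE C (fun w => c * Y w) (fun w => c * V w).
Proof.
move=> Y1 sC [V1 mV VY]; split; first exact: L1Z.
  exact: measurable_funM mV.
move=> A CA; have mA := sC _ CA.
under eq_Rintegral do rewrite -mulrA.
under [RHS]eq_Rintegral do rewrite -mulrA.
by rewrite !EZ ?VY//; exact: L1_mul_indic.
Qed.

Lemma CEB C Y Y' V V' : L1 P Y -> L1 P Y' -> sub_sigma C ->
  CE C Y V -> CE C Y' V' -> CE C (fun w => Y w - Y' w) (fun w => V w - V' w).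
Proof.
move=> Y1 Y1' sC VY VY'.
have := CED Y1 (L1Z (-1) Y1') sC VY (CEZ (-1) Y1' sC VY').
under eq_fun do rewrite mulN1r.
by under [X in CE _ _ X]eq_fun do rewrite mulN1r.
Qed.

Lemma CE_id C Y : gmeas C Y -> L1 P Y -> CE C Y Y.
Proof. by move=> mY Y1; split. Qed.

Lemma CE_cst C c : CE C (fun=> c) (fun=> c).
Proof. by apply: CE_id; [exact: measurable_cst|exact: L1_cst]. Qed.

Lemma gmeas_le C f g : gmeas C f -> gmeas C g -> <<s C >> [set w | f w <= g w].
Proof.
move=> mf mg; have := measurable_fun_le (@measurableT _ (g_sigma_algebraType C)) mf mg.
by rewrite setTI.
Qed.

(** Tested on the event [V <= 0], where the integral of [V] is that of [Y], hence nonnegative; so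
    [V] vanishes almost surely there. *)
Lemma CE_ge0 C Y V : L1 P Y -> sub_sigma C -> CE C Y V ->
  {ae P, forall w, 0 <= Y w} -> {ae P, forall w, 0 <= V w}.
Proof.
move=> Y1 sC [V1 mV VY] Y0.
pose A := [set w | V w <= 0].
have CA : <<s C >> A by apply: gmeas_le => //; exact: measurable_cst.
have mA := sC _ CA.
have VA1 : L1 P (fun w => V w * \1_A w) by exact: L1_mul_indic.
suff : {ae P, forall w, V w * \1_A w = 0}.
  apply: filterS => w; rewrite indicE; have [wA|] := boolP (w \in A).
    by rewrite mulr1 => ->.
  by rewrite notin_setE/= => /negP; rewrite -ltNge => /ltW.
apply: E_abs_eq0 => //; apply/eqP; rewrite eq_le; apply/andP; split; last first.
  by apply: E_ge0 => w.
rewrite (@eqE _ _ _ _ _ (fun w => - (V w * \1_A w))); last first.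
  move=> w; rewrite ler0_norm// indicE.
  have [|_] := boolP (w \in A); last by rewrite mulr0.
  by rewrite inE mulr1.
rewrite EN// VY// oppr_le0 E_ge0_ae//.
  exact: L1_meas (L1_mul_indic Y1 mA).
by apply: filterS Y0 => w Y0; rewrite mulr_ge0// indicE.
Qed.

Lemma CE_le C Y Y' V V' : L1 P Y -> L1 P Y' -> sub_sigma C ->
  CE C Y V -> CE C Y' V' -> {ae P, forall w, Y w <= Y' w} ->
  {ae P, forall w, V w <= V' w}.
Proof.
move=> Y1 Y1' sC VY VY' YY'.
have := CE_ge0 (L1B Y1' Y1) sC (CEB Y1' Y1 sC VY' VY).
move=> h; have {}h := h _; apply: filterS (h _) => [w|]; first by rewrite subr_ge0.
by apply: filterS YY' => w; rewrite subr_ge0.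
Qed.

Lemma CE_eq C Y Y' V V' : L1 P Y -> L1 P Y' -> sub_sigma C ->
  CE C Y V -> CE C Y' V' -> {ae P, forall w, Y w = Y' w} ->
  {ae P, forall w, V w = V' w}.
Proof.
move=> Y1 Y1' sC VY VY' YY'.
have le : {ae P, forall w, V w <= V' w}.
  by apply: (CE_le Y1 Y1' sC VY VY'); apply: filterS YY' => w ->.
have ge : {ae P, forall w, V' w <= V w}.
  by apply: (CE_le Y1' Y1 sC VY' VY); apply: filterS YY' => w ->.
apply: filterS2 le ge => w VV' V'V.
by apply/eqP; rewrite eq_le VV' V'V.
Qed.

(* The sum is the integer part of [y], capped at [N]. *)
Let layer_sum (N : nat) (y : R) : 0 <= y ->
  \sum_(j < N) ((j.+1%:R <= y)%R : nat)%:R <= y /\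
  (y <= N%:R -> y - 1 <= \sum_(j < N) ((j.+1%:R <= y)%R : nat)%:R).
Proof.
move=> y0; elim: N => [|N [ih1 ih2]].
  by rewrite big_ord0; split=> // yN; rewrite lerBlDr add0r (le_trans yN).
have full : N%:R <= y -> \sum_(j < N) ((j.+1%:R <= y)%R : nat)%:R = N%:R :> R.
  move=> Ny; under eq_bigr => j _.
    rewrite (_ : (_ <= y) = true)/=; first over.
    by rewrite (le_trans _ Ny)// ler_nat.
  by rewrite sumr_const card_ord.
rewrite big_ord_recr/=; have [Ny|yN] := leP N.+1%:R y.
  have NSN : N%:R <= N.+1%:R :> R by rewrite ler_nat.
  rewrite full; last exact: le_trans Ny.
  rewrite natr1; split=> // yN.
  by rewrite lerBlDr (le_trans yN)// lerDl.
rewrite addr0; split=> // _; have [/ih2//|/ltW/full ->] := leP y N%:R.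
by rewrite lerBlDr natr1 ltW.
Qed.

(** Layer-cake approximation: the range of [U], shifted by [K], is cut into layers of height
    [1 / n.+1 <= e], and the [A j] are the superlevel sets. *)
Lemma layer_approx C U (K : nat) (e : R) : gmeas C U -> (forall w, `|U w| <= K%:R) ->
  0 < e -> exists N (b c : R) (A : nat -> set T), (forall j, <<s C >> (A j)) /\
    forall w, `|U w - (b + c * \sum_(j < N) \1_(A j) w)| <= e.
Proof.
move=> mU UK e0.
pose n := Num.truncn e^-1.
have n0 : 0 < n.+1%:R :> R by rewrite ltr0n.
have ne : n.+1%:R^-1 <= e.
  by rewrite -[leRHS]invrK lef_pV2 ?posrE ?invr_gt0// ltW// truncnS_gt.
pose y w := n.+1%:R * (U w + K%:R).
exists (n.+1 * (K + K))%N, (- K%:R), n.+1%:R^-1, (fun j => [set w | j.+1%:R <= y w]).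
split=> [j|w].
  apply: gmeas_le; first exact: measurable_cst.
  apply: measurable_funM; first exact: measurable_cst.
  by apply: measurable_funD => //; exact: measurable_cst.
have := UK w; rewrite ler_norml => /andP[U1 U2].
have y0 : 0 <= y w by rewrite mulr_ge0// -lerBlDr sub0r.
have yN : y w <= (n.+1 * (K + K))%N%:R.
  by rewrite natrM ler_pM2l// natrD lerD2r.
have [s1 /(_ yN) s2] := layer_sum (n.+1 * (K + K)) y0.
apply: le_trans ne.
have -> : \sum_(j < n.+1 * (K + K)) \1_[set w | j.+1%:R <= y w] w =
    \sum_(j < n.+1 * (K + K)) ((j.+1%:R <= y w)%R : nat)%:R :> R.
  apply: eq_bigr => j _; rewrite indicE; congr (nat_of_bool _)%:R.
  by apply/idP/idP; rewrite ?inE.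
set S := \sum_(_ < _) _ in s1 s2 *.
have -> : U w - (- K%:R + n.+1%:R^-1 * S) = n.+1%:R^-1 * (y w - S).
  by rewrite mulrBr /y mulrA mulVf ?gt_eqF// mul1r; ring.
rewrite normrM gtr0_norm ?invr_gt0// ler_piMr ?invr_ge0 ?(ltW n0)//.
by rewrite ger0_norm ?subr_ge0// lerBlDl -lerBlDr.
Qed.

(** [layer_approx] leads from indicators to bounded test functions, and [M] makes the error uniform
    in [n]. A constant sequence will give the pull-out property, the differences of the martingale
    and its limit the weak convergence. *)
Lemma E_weak_bnd C (h : nat -> T -> R) (M : R) U (K : nat) : sub_sigma C ->
  (forall n, L1 P (h n)) -> (forall n, E (fun w => `|h n w|) <= M) ->
  (forall A, <<s C >> A -> E (fun w => h n w * \1_A w) @[n --> \oo] --> 0) ->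
  gmeas C U -> (forall w, `|U w| <= K%:R) ->
  E (fun w => h n w * U w) @[n --> \oo] --> 0.
Proof.
move=> sC h1 hM h0 mU UK.
have mUT := gmeas_measurable sC mU.
have hT : E (h n) @[n --> \oo] --> 0.
  have := h0 setT (@measurableT _ (g_sigma_algebraType C)).
  rewrite (_ : (fun n => E _) = (fun n => E (h n)))//.
  by apply/funext => n; apply: eqE => w; rewrite indicT mulr1.
have M0 : 0 <= M by rewrite (le_trans _ (hM 0%N))// E_ge0.
apply/cvgr0Pnorm_le => e e0.
have d0 : 0 < e / 2 / (M + 1) by rewrite !divr_gt0// ltr_wpDl.
have [N [b [c [A [CA UA]]]]] := layer_approx mU UK d0.
have mA j := sC _ (CA j).
pose L w := b + c * \sum_(j < N) \1_(A j) w.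
have mL : measurable_fun [set: T] L.
  apply: measurable_funD; first exact: measurable_cst.
  apply: measurable_funM; first exact: measurable_cst.
  by apply: measurable_sum => j; exact: indic_meas.
have hA1 n j : L1 P (fun w => h n w * \1_(A j) w) by exact: L1_mul_indic.
have hU1 n : L1 P (fun w => h n w * U w) by exact: (L1_mul_bnd (h1 n) mUT UK).
have hLE n w : h n w * L w = b * h n w + c * \sum_(j < N) (h n w * \1_(A j) w).
  by rewrite /L mulrDr -big_distrr/=; ring.
have hS1 n : L1 P (fun w => \sum_(j < N) (h n w * \1_(A j) w)).
  exact: (L1_sum (fun j _ => hA1 n j)).
have hL1 n : L1 P (fun w => h n w * L w).
  apply: (@eq_L1 _ _ _ _ (fun w => b * h n w + c * \sum_(j < N) (h n w * \1_(A j) w))).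
    by move=> w; rewrite hLE.
  by apply: L1D; exact: L1Z.
have hL : E (fun w => h n w * L w) @[n --> \oo] --> 0.
  rewrite (_ : (fun n => E _) = (fun n => b * E (h n) +
      c * \sum_(j < N) E (fun w => h n w * \1_(A j) w))); last first.
    apply/funext => n; rewrite (eqE _ (hLE n)) ED ?EZ//; [|exact: L1Z..].
    by rewrite (Esum (fun j _ => hA1 n j)).
  rewrite -[X in _ --> X](_ : b * 0 + c * \sum_(j < N) 0 = 0); last first.
    by rewrite big1// !mulr0 addr0.
  apply: cvgD; first exact: cvgMr.
  apply: cvgMr; elim: {hS1 hLE L mL UA hL1} N => [|N ih].
    by under eq_fun do rewrite big_ord0; rewrite big_ord0; exact: cvg_cst.
  under eq_fun do rewrite big_ord_recr/=; rewrite big_ord_recr/=.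
  by apply: cvgD ih _; exact: h0.
have e2 : 0 < e / 2 by rewrite divr_gt0.
move/cvgr0Pnorm_le : hL => /(_ _ e2); apply: filterS => n hLn.
rewrite (_ : E _ = E (fun w => h n w * L w) + E (fun w => h n w * U w - h n w * L w)).
  rewrite (le_trans (ler_normD _ _))// [leRHS]splitr lerD//.
  rewrite (le_trans (E_abs (L1B (hU1 n) (hL1 n))))//.
  apply: (@le_trans _ _ (E (fun w => e / 2 / (M + 1) * `|h n w|))).
    apply: E_le => [||w]; [exact/L1_norm/L1B|exact/L1Z/L1_norm|].
    by rewrite -mulrBr normrM mulrC ler_wpM2r.
  rewrite EZ; last exact: L1_norm.
  rewrite mulrAC ler_pdivrMr ?ltr_wpDl// ler_wpM2l ?(ltW e2)//.
  by rewrite (le_trans (hM n))// lerDl.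
by rewrite EB// addrC subrK.
Qed.

Let pull_bnd C Y V U (K : nat) : L1 P Y -> sub_sigma C -> CE C Y V -> gmeas C U ->
  (forall w, `|U w| <= K%:R) ->
  E (fun w => V w * U w) = E (fun w => Y w * U w).
Proof.
move=> Y1 sC [V1 mV VY] mU UK.
have mUT := gmeas_measurable sC mU.
have VY1 : L1 P (fun w => V w - Y w) by exact: L1B.
have /(_ _) := @E_weak_bnd C (fun=> fun w => V w - Y w) _ U K sC
  (fun=> VY1) (fun=> lexx _) _ mU UK.
move=> h; have {}h := h _; apply/eqP; rewrite -subr_eq0 -EB; last 2 first.
- exact: (L1_mul_bnd V1 mUT UK).
- exact: (L1_mul_bnd Y1 mUT UK).
rewrite (@eqE _ _ _ _ _ (fun w => (V w - Y w) * U w)); last by move=> w; rewrite mulrBl.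
apply/eqP; apply: (@cvg_unique _ _ (E (fun w => (V w - Y w) * U w) @[n --> \oo])) => //.
  exact: cvg_cst.
apply: h => A CA; rewrite (_ : (fun n => E _) = (fun=> 0)); first exact: cvg_cst.
apply/funext => n; rewrite (@eqE _ _ _ _ _ (fun w => V w * \1_A w - Y w * \1_A w)).
  by rewrite EB ?VY ?subrr//; apply: L1_mul_indic => //; exact: sC.
by move=> w; rewrite mulrBl.
Qed.

(** A sign with value 1 at 0, written through an indicator so that its measurability for [C] is that
    of one event. *)
Definition sgn (V : T -> R) (w : T) : R := 2 * \1_[set w | 0 <= V w] w - 1.

Lemma sgnE V w : V w * sgn V w = `|V w|.
Proof.
rewrite /sgn indicE; have [|] := boolP (w \in _).
  by rewrite inE/= => V0; rewrite ger0_norm//; lra.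
by rewrite notin_setE/= => /negP; rewrite -ltNge => V0; rewrite ltr0_norm//; lra.
Qed.

Lemma sgn_bnd V w : `|sgn V w| <= 1.
Proof. by rewrite /sgn indicE; case: (_ \in _) => /=;
  rewrite ?mulr1 ?mulr0 ler_norml; apply/andP; split; lra. Qed.

Lemma gmeas_sgn C V : gmeas C V -> gmeas C (sgn V).
Proof.
move=> mV; apply: measurable_funB; last exact: measurable_cst.
apply: measurable_funM; first exact: measurable_cst.
by apply/measurable_indicP; apply: gmeas_le => //; exact: measurable_cst.
Qed.

Lemma gmeas_trunc C U k : gmeas C U -> <<s C >> (trunc U k).
Proof.
move=> mU; apply: gmeas_le; last exact: measurable_cst.
exact: measurableT_comp.
Qed.

Let trunc_bnd (U : T -> R) k w : `|U w * \1_(trunc U k) w| <= k%:R.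
Proof.
rewrite indicE; have [|_] := boolP (w \in _); last by rewrite mulr0 normr0.
by rewrite inE mulr1.
Qed.

(** Integrability of [V * U] has to be proved too. Truncating [U] and testing with the signs of [V]
    and [U] gives [E[|V U|; |U| <= k] <= E |Y U|], so [L1_trunc] applies; the equality follows by
    removing the truncation. *)
Lemma pullout C Y V U : L1 P Y -> sub_sigma C -> CE C Y V -> gmeas C U ->
  L1 P (fun w => Y w * U w) ->
  L1 P (fun w => V w * U w) /\ E (fun w => V w * U w) = E (fun w => Y w * U w).
Proof.
move=> Y1 sC VY mU YU1; have [V1 mV _] := VY.
have mUT := gmeas_measurable sC mU.
have mVT := gmeas_measurable sC mV.
have mUk k : gmeas C (fun w => U w * \1_(trunc U k) w).
  apply: measurable_funM => //; apply/measurable_indicP; exact: gmeas_trunc.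
have [aVU1 _] : L1 P (fun w => `|V w * U w|) /\
    E (fun w => `|V w * U w|) <= E (fun w => `|Y w * U w|).
  apply: (L1_trunc mUT) => //.
  - by apply: measurableT_comp => //; exact: measurable_funM.
  - move=> k.
    have /L1_norm : L1 P (fun w => V w * (U w * \1_(trunc U k) w)).
      exact: (L1_mul_bnd V1 (gmeas_measurable sC (mUk k)) (trunc_bnd U k)).
    by apply: eq_L1 => w; rewrite mulrA normrM (ger0_norm (indic_ge0 _ _ _)).
  - move=> k.
    pose s w := sgn V w * (sgn U w * (U w * \1_(trunc U k) w)).
    have sb w : `|s w| <= k%:R.
      rewrite /s normrM (le_trans (ler_piMl _ (sgn_bnd V w)))// normrM.
      by rewrite (le_trans (ler_piMl _ (sgn_bnd U w)))// trunc_bnd.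
    have ms : gmeas C s.
      apply: measurable_funM; first exact: gmeas_sgn.
      by apply: measurable_funM; [exact: gmeas_sgn|exact: mUk].
    rewrite (_ : E _ = E (fun w => V w * s w)); last first.
      apply: eqE => w; rewrite /s mulrA sgnE [sgn U w * _]mulrA [sgn U w * _]mulrC sgnE.
      by rewrite normrM mulrA.
    rewrite (pull_bnd Y1 sC VY ms sb).
    apply: E_le; [|exact: L1_norm|].
      exact: (L1_mul_bnd Y1 (gmeas_measurable sC ms) sb).
    move=> w; apply: (le_trans (ler_norm _)); rewrite !normrM ler_wpM2l//.
    rewrite (le_trans (ler_piMl _ (sgn_bnd V w)))//.
    rewrite (le_trans (ler_piMl _ (sgn_bnd U w)))//.
    by rewrite ler_piMr// indicE; case: (_ \in _); rewrite ?normr0 ?normr1.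
have VU1 : L1 P (fun w => V w * U w).
  exact: (L1_dom (measurable_funM mVT mUT) aVU1 (fun w => lexx _)).
split=> //.
have cV := E_trunc mUT VU1; have cY := E_trunc mUT YU1.
apply: (cvg_unique _ cV) => //; apply: cvg_trans cY; apply: near_eq_cvg.
apply: nearW => k.
have := pull_bnd Y1 sC VY (mUk k) (trunc_bnd U k).
under eq_Rintegral do rewrite mulrA.
by under [X in _ = X -> _]eq_Rintegral do rewrite mulrA.
Qed.

(** Induction: the defect at [p.+1] is [x] times the defect at [p] plus a nonnegative multiple of
    [(x - y) ^+ 2]. With integer exponents this takes the place of the Hoelder and Jensen
    inequalities. *)
Lemma young_nat (p : nat) (x y : R) : 0 <= x -> 0 <= y ->
  p.+1%:R * (x * y ^+ p) <= x ^+ p.+1 + p%:R * y ^+ p.+1.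
Proof.
move=> x0 y0; elim: p => [|p ih]; first by rewrite expr0 expr1 mulr1 mul1r mul0r addr0.
rewrite -subr_ge0.
have -> : x ^+ p.+2 + p.+1%:R * y ^+ p.+2 - p.+2%:R * (x * y ^+ p.+1) =
  x * (x ^+ p.+1 + p%:R * y ^+ p.+1 - p.+1%:R * (x * y ^+ p)) +
  p.+1%:R * y ^+ p * (x - y) ^+ 2.
  by rewrite !exprS -[in LHS]natr1 -[p.+1%:R]natr1; ring.
apply: addr_ge0; first by rewrite mulr_ge0 ?subr_ge0.
by rewrite mulr_ge0 ?sqr_ge0// mulr_ge0 ?ler0n ?exprn_ge0.
Qed.

(* Testing against [sgn V * |V| ^ p], truncated, and Young's inequality. *)
Lemma CE_pow C Y V p : L1 P Y -> sub_sigma C -> CE C Y V ->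
  L1 P (fun w => `|Y w| ^+ p.+1) ->
  L1 P (fun w => `|V w| ^+ p.+1) /\
  E (fun w => `|V w| ^+ p.+1) <= E (fun w => `|Y w| ^+ p.+1).
Proof.
move=> Y1 sC VY Yp; have [V1 mV _] := VY.
have mVT := gmeas_measurable sC mV.
apply: (L1_trunc mVT) => [|w|k|k]; first by apply: measurable_funX; exact: measurableT_comp.
- exact: exprn_ge0.
- apply: (@L1_bnd _ _ _ _ _ (k%:R ^+ p.+1)).
    apply: measurable_funM; last exact/indic_meas/trunc_meas.
    by apply: measurable_funX; exact: measurableT_comp.
  move=> w; rewrite indicE; have [|_] := boolP (w \in _).
    by rewrite inE /trunc/= mulr1 normrX normr_id => h; rewrite lerXn2r// nnegrE.
  by rewrite mulr0 normr0 exprn_ge0.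
set a := fun w => `|V w| ^+ p.+1 * \1_(trunc V k) w.
have a1 : L1 P a.
  apply: (@L1_bnd _ _ _ _ _ (k%:R ^+ p.+1)).
    apply: measurable_funM; last exact/indic_meas/trunc_meas.
    by apply: measurable_funX; exact: measurableT_comp.
  move=> w; rewrite /a indicE; have [|_] := boolP (w \in _).
    by rewrite inE /trunc/= mulr1 normrX normr_id => h; rewrite lerXn2r// nnegrE.
  by rewrite mulr0 normr0 exprn_ge0.
pose s w := sgn V w * (`|V w| ^+ p * \1_(trunc V k) w).
have ms : gmeas C s.
  apply: measurable_funM; first exact: gmeas_sgn.
  apply: measurable_funM; last by apply/measurable_indicP; exact: gmeas_trunc.
  by apply: measurable_funX; exact: measurableT_comp.
have sb w : `|s w| <= (k ^ p)%:R.
  rewrite /s normrM (le_trans (ler_piMl _ (sgn_bnd V w)))// indicE natrX.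
  have [|_] := boolP (w \in _); last by rewrite mulr0 normr0 exprn_ge0.
  by rewrite inE /trunc/= mulr1 normrX normr_id => h; rewrite lerXn2r// nnegrE.
have Ea : E a = E (fun w => Y w * s w).
  rewrite -(pull_bnd Y1 sC VY ms sb); apply: eqE => w.
  by rewrite /a /s mulrA sgnE exprS mulrA.
have Ys1 : L1 P (fun w => Y w * s w).
  exact: (L1_mul_bnd Y1 (gmeas_measurable sC ms) sb).
(* Truncation makes [E a] finite, so [p * E a] cancels and coefficient 1 is left. *)
have le : p.+1%:R * E a <= E (fun w => `|Y w| ^+ p.+1) + p%:R * E a.
  rewrite {1}Ea -!EZ// -ED//; last exact: L1Z.
  apply: E_le; [exact: L1Z|by apply: L1D => //; exact: L1Z|].
  move=> w; apply: (@le_trans _ _ (p.+1%:R * (`|Y w| * (`|V w| ^+ p * \1_(trunc V k) w)))).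
    rewrite ler_wpM2l// (le_trans (ler_norm _))// normrM ler_wpM2l//.
    rewrite /s normrM (le_trans (ler_piMl _ (sgn_bnd V w)))//.
    by rewrite ger0_norm// mulr_ge0 ?exprn_ge0// indicE.
  rewrite /a indicE; have [_|_] := boolP (w \in _).
    by rewrite !mulr1 young_nat.
  by rewrite !mulr0 addr0 exprn_ge0.
by move: le; rewrite -natr1 mulrDl mul1r addrC lerD2r.
Qed.

End CondexpProperties.

(** * Equality of integrals, extended from a pi-system *)

Section PiLambda.
Context d (T : measurableType d) (R : realType) (P : probability T R).
Implicit Types (C G : set (set T)) (f g : T -> R) (A B : set T).

Local Notation E f := (Rintegral P [set: T] f).

Lemma sigma_gen_sub C G : C `<=` <<s G >> -> <<s C >> `<=` <<s G >>.
Proof. by move=> CG; apply: smallest_sub => //; exact: smallest_sigma_algebra. Qed.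

Lemma sub_sigma_gen C : (forall A, C A -> measurable A) -> sub_sigma C.
Proof.
by move=> CM; apply: smallest_sub => //; exact: sigma_algebra_measurable.
Qed.

Lemma sigmaI C A B : <<s C >> A -> <<s C >> B -> <<s C >> (A `&` B).
Proof. exact: (@measurableI _ (g_sigma_algebraType C)). Qed.

Lemma sigmaT C : <<s C >> setT.
Proof. exact: (@measurableT _ (g_sigma_algebraType C)). Qed.

Lemma gmeas_sub C G f : <<s C >> `<=` <<s G >> -> gmeas C f -> gmeas G f.
Proof. by move=> CG /gmeasP mf; apply/gmeasP => B mB; apply: CG; exact: mf. Qed.

Lemma gmeas_indic C A : <<s C >> A -> gmeas C (\1_A : T -> R).
Proof. by move=> CA; apply/measurable_indicP. Qed.

Lemma nd_sets_eventually (F : nat -> set T) w : {homo F : n m / (n <= m)%N >-> (n <= m)%O} ->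
  (\bigcup_i F i) w -> \forall n \near \oo, F n w.
Proof.
move=> ndF [n _ Fnw]; near=> m.
have /subsetPset : (F n <= F m)%O by apply: ndF; near: m; exact: nbhs_infty_ge.
exact.
Unshelve. all: end_near. Qed.


(** Dynkin's argument. [E f = E g] covers the whole space, which [G] may fail to contain. *)
Lemma pi_lambda_E G f g : setI_closed G -> (forall A, G A -> measurable A) ->
  L1 P f -> L1 P g -> E f = E g ->
  (forall A, G A -> E (fun w => f w * \1_A w) = E (fun w => g w * \1_A w)) ->
  forall A, <<s G >> A -> E (fun w => f w * \1_A w) = E (fun w => g w * \1_A w).
Proof.
move=> GI Gm f1 g1 fgE fgG A GA.
pose H := [set A | measurable A /\
  E (fun w => f w * \1_A w) = E (fun w => g w * \1_A w)].
have E_T h : E (fun w => h w * \1_setT w) = E h.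
  by apply: eqE => w; rewrite indicT mulr1.
have E_D h A1 A2 : L1 P h -> measurable A1 -> measurable A2 -> A2 `<=` A1 ->
    E (fun w => h w * \1_(A1 `\` A2) w) =
    E (fun w => h w * \1_A1 w) - E (fun w => h w * \1_A2 w).
  move=> h1 m1 m2 A21; rewrite -EB; [|exact: L1_mul_indic..].
  apply: eqE => w; rewrite -mulrBr !indicE in_setD; congr (_ * _).
  have [w2|w2] := boolP (w \in A2); last by rewrite andbT subr0.
  by rewrite mem_set ?subrr//; apply: A21; rewrite inE in w2.
have E_U h (F : nat -> set T) : L1 P h -> (forall n, measurable (F n)) ->
    {homo F : n m / (n <= m)%N >-> (n <= m)%O} ->
    E (fun w => h w * \1_(F n) w) @[n --> \oo] --> E (fun w => h w * \1_(\bigcup_i F i) w).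
  move=> h1 mF ndF; have mh := L1_meas h1.
  have m1 n : measurable_fun [set: T] (fun w => h w * \1_(F n) w).
    exact: (measurable_funM mh (indic_meas (mF n))).
  have m2 : measurable_fun [set: T] (fun w => h w * \1_(\bigcup_i F i) w).
    apply: (measurable_funM mh); apply: indic_meas; exact: bigcup_measurable.
  apply: (E_dct m1 m2 (L1_norm h1)) => [n w|w].
    by rewrite normrM ler_piMr// ger0_norm ?indic_ge0// indic_le1.
  apply: cvg_near_cst.
  have [wF|nF] := pselect ((\bigcup_i F i) w).
    apply: filterS (nd_sets_eventually ndF wF) => n Fn.
    by rewrite !indicE !mem_set.
  apply: nearW => n; rewrite !indicE !memNset//.
  by move=> Fn; apply: nF; exists n.
have : lambda_system setT H.
  split => //.
  - by split; rewrite ?E_T.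
  - move=> A1 A2 A21 [m1 e1] [m2 e2]; split; first exact: measurableD.
    by rewrite !E_D// e1 e2.
  - move=> F ndF HF.
    have mF n : measurable (F n) by have [] := HF n.
    split; first exact: bigcup_measurable.
    apply: (cvg_unique _ (E_U f F f1 mF ndF)) => //.
    have := E_U g F g1 mF ndF.
    rewrite (_ : (fun n => E _) = (fun n => E (fun w => f w * \1_(F n) w)))//.
    by apply/funext => n; have [_ ->] := HF n.
move=> lH; have GH : G `<=` H.
  by move=> B GB; split; [exact: Gm|exact: fgG].
by have [] := lambda_system_subset GI lH GH (fun _ _ => @subsetT _ _) GA.
Qed.

End PiLambda.

(** * Independence *)

Section Independence.
Context d (T : measurableType d) d' (S : measurableType d') (R : realType).
Variables (P : probability T R) (X : nat -> {mfun T >-> S}).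
Implicit Types (K L : set nat) (A B : set T) (f : T -> R).

Local Notation E f := (Rintegral P [set: T] f).

(** [<<s gen K>>] is [sigma_of X K] by definition; [CE] and [gmeas] take the generators. *)
Definition gen K := \bigcup_(k in K) g_sigma_algebra_preimage (X k).

Lemma sub_sigma_gen_of K : sub_sigma (gen K).
Proof.
apply: sub_sigma_gen => A [k _ [B mB <-]]; exact: measurable_funPT.
Qed.

Lemma gen_sub K L : K `<=` L -> <<s gen K >> `<=` <<s gen L >>.
Proof.
move=> KL; apply: sub_sigma_algebra2 => A [k Kk kA].
by exists k => //; exact: KL.
Qed.

Lemma gen_preimage K k (B : set S) : K k -> measurable B -> <<s gen K >> (X k @^-1` B).
Proof.
move=> Kk mB; apply: sub_sigma_algebra; exists k => //.
by exists B => //; rewrite setTI.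
Qed.

(** Finite-dimensional cylinders: a pi-system on which [independent_seq] gives the probabilities. *)
Definition cyl K := [set A | exists J : seq nat, exists B : nat -> set S,
  [/\ uniq J, [set` J] `<=` K, forall k, measurable (B k) &
      A = \bigcap_(k in [set` J]) (X k @^-1` B k)]].

Lemma cylI K : setI_closed (cyl K).
Proof.
move=> _ _ [J [B [uJ JK mB ->]]] [J' [B' [uJ' JK' mB' ->]]].
(* A coordinate constrained in only one of the cylinders gets the trivial constraint [setT] from the
   other. *)
exists (undup (J ++ J')), (fun k => (if k \in J then B k else setT) `&`
  (if k \in J' then B' k else setT)); split.
- exact: undup_uniq.
- by move=> k /=; rewrite mem_undup mem_cat => /orP[/JK|/JK'].
- by move=> k; apply: measurableI; case: ifP.
- apply/seteqP; split=> w.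
    move=> [wJ wJ'] k /=; rewrite mem_undup mem_cat => _; split.
      by case: ifP => // /wJ.
    by case: ifP => // /wJ'.
  move=> h; split=> k /= kJ.
    have /h[+ _] : k \in undup (J ++ J') by rewrite mem_undup mem_cat kJ.
    by rewrite kJ.
  have /h[_ +] : k \in undup (J ++ J') by rewrite mem_undup mem_cat kJ orbT.
  by rewrite kJ.
Qed.

Lemma cyl_gen K : cyl K `<=` <<s gen K >>.
Proof.
move=> _ [J [B [uJ JK mB ->]]].
apply: (@fin_bigcap_measurable _ (g_sigma_algebraType (gen K))) => // k /JK Kk.
exact: gen_preimage.
Qed.

Lemma cyl_measurable K A : cyl K A -> measurable A.
Proof. by move=> /cyl_gen; exact: sub_sigma_gen_of. Qed.

Lemma gen_cyl K : <<s gen K >> `<=` <<s cyl K >>.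
Proof.
apply: sigma_gen_sub => A [k Kk [B mB <-]]; apply: sub_sigma_algebra.
exists [:: k], (fun=> B); split=> //; first by move=> j /=; rewrite inE => /eqP ->.
rewrite setTI; apply/seteqP; split=> w /=.
  by move=> wB j /=; rewrite inE => /eqP ->.
by apply; rewrite /= inE.
Qed.

Hypothesis hX : independent_seq P X.

Let p A : R := E (\1_A : T -> R).

Let pE A : measurable A -> (p A)%:E = P A.
Proof.
move=> mA; rewrite /p EFin_E; last first.
  by apply: (@L1_bnd _ _ _ _ _ 1) => [|w]; [exact: indic_meas|rewrite ger0_norm ?indic_le1 ?indic_ge0].
by rewrite integral_indic// setIT.
Qed.

Let indep_cyl K L A B : K `&` L = set0 -> cyl K A -> cyl L B ->
  p (A `&` B) = p A * p B.
Proof.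
move=> KL cA cB; have mA := cyl_measurable cA; have mB := cyl_measurable cB.
apply: EFin_inj; rewrite EFinM !pE//; last exact: measurableI.
move: cA cB => [J [F [uJ JK mF ->]]] [J' [F' [uJ' JL mF' ->]]].
have JJ' k : k \in J' -> k \in J = false.
  move=> kJ'; apply/negP => kJ.
  have : (K `&` L) k by split; [exact: JK|exact: JL].
  by rewrite KL.
pose H k := if k \in J then F k else F' k.
have -> : \bigcap_(k in [set` J]) (X k @^-1` F k) `&`
    \bigcap_(k in [set` J']) (X k @^-1` F' k) =
    \bigcap_(k in [set` (J ++ J')]) (X k @^-1` H k).
  apply/seteqP; split=> w.
    move=> [wJ wJ'] k /=; rewrite mem_cat /H; case: ifP => [kJ _|_ /= kJ'].
      exact: wJ.
    exact: wJ'.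
  move=> h; split=> k /= kJ.
    by have := h k; rewrite /= mem_cat kJ /H kJ => /(_ isT).
  by have := h k; rewrite /= mem_cat kJ orbT /H JJ'// => /(_ isT).
rewrite !hX//; last 2 first.
- rewrite cat_uniq uJ uJ' andbT/=; apply/hasPn => k kJ'.
  by rewrite /= JJ'.
- by move=> k; rewrite /H; case: ifP.
rewrite big_cat/=; congr (_ * _)%E; apply: eq_big_seq => k kJ.
  by rewrite /H kJ.
by rewrite /H JJ'.
Qed.

Let indicI A B w : (\1_(A `&` B) w : R) = \1_A w * \1_B w.
Proof. by rewrite !indicE in_setI; case: (_ \in A); case: (_ \in B); rewrite ?mulr1 ?mulr0. Qed.

Let L1_indic A : measurable A -> L1 P (\1_A : T -> R).
Proof.
move=> mA; apply: (@L1_bnd _ _ _ _ _ 1) => [|w]; first exact: indic_meas.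
by rewrite ger0_norm ?indic_le1 ?indic_ge0.
Qed.

(** Independence from [B] read as an equality of integrals over [A], of [\1_B] and of the constant
    [p B], so that [pi_lambda_E] extends it. It will be used for each of two factors in turn. *)
Let indep_ext (G : set (set T)) B : setI_closed G -> (forall A, G A -> measurable A) ->
  measurable B -> (forall A, G A -> p (A `&` B) = p A * p B) ->
  forall A, <<s G >> A -> p (A `&` B) = p A * p B.
Proof.
move=> GI Gm mB GB A GA.
have mA : measurable A by exact: (sub_sigma_gen Gm GA).
have e A' : measurable A' -> E (fun w => p B * \1_A' w) = p A' * p B.
  by move=> mA'; rewrite EZ 1?mulrC//; exact: L1_indic.
have e' A' : E (fun w => \1_B w * \1_A' w) = p (A' `&` B).
  by rewrite setIC; apply: eqE => w; rewrite indicI.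
rewrite -e// -e'; apply: pi_lambda_E GA => //.
- exact: L1_indic.
- exact: L1_cst.
- by rewrite E_cst.
- by move=> A' GA'; rewrite e' e ?GB//; exact: Gm.
Qed.

Lemma indep_sigma K L A B : K `&` L = set0 -> <<s gen K >> A -> <<s gen L >> B ->
  p (A `&` B) = p A * p B.
Proof.
move=> KL KA LB; have mB := sub_sigma_gen_of LB.
apply: (@indep_ext (cyl K)) => //; [exact: cylI|exact: cyl_measurable| |exact: gen_cyl].
move=> A' cA'; have mA' := cyl_measurable cA'.
rewrite setIC mulrC; apply: (@indep_ext (cyl L)) => //;
  [exact: cylI|exact: cyl_measurable| |exact: gen_cyl].
by move=> B' cB'; rewrite setIC mulrC; exact: indep_cyl KL cA' cB'.
Qed.

(** Independence makes the constant [p B] a version of the conditional expectation of [\1_B] given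
    [gen K]; then [f] is pulled out. *)
Lemma indep_E K L f B : K `&` L = set0 -> gmeas (gen K) f -> L1 P f ->
  <<s gen L >> B -> E (fun w => f w * \1_B w) = E f * p B.
Proof.
move=> KL mf f1 LB; have mB := sub_sigma_gen_of LB.
have B1 := L1_indic mB.
have cB : CE P (gen K) (\1_B : T -> R) (fun=> p B).
  split; [exact: L1_cst|exact: measurable_cst|] => A KA.
  have mA := sub_sigma_gen_of KA.
  rewrite EZ; last exact: L1_indic.
  rewrite mulrC -[RHS](_ : p (A `&` B) = _).
    by rewrite (indep_sigma KL).
  by rewrite setIC; apply: eqE => w; rewrite indicI.
have [|_] := pullout B1 (@sub_sigma_gen_of K) cB mf.
  by apply: eq_L1 (L1_mul_indic f1 mB) => w; rewrite mulrC.
rewrite EZ// mulrC => ->.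
by apply: eqE => w; rewrite mulrC.
Qed.

(* Sets of [sigma (X_k, k \in L)] are generated by intersections [B `&` C] with
   [B] depending on [K `&` L] and [C] on [L `\` K], hence independent of [V]. *)
Lemma condexp_commute K L Y V V' : L1 P Y -> CE P (gen K) Y V ->
  CE P (gen (K `&` L)) Y V' -> CE P (gen L) V V'.
Proof.
move=> Y1 VY VY'; have [V1 mV VYA] := VY; have [V1' mV' VYA'] := VY'.
split=> //; first by apply: gmeas_sub mV'; apply: gen_sub => k [].
pose G := [set A | exists B C, [/\ <<s gen (K `&` L) >> B, <<s gen (L `\` K) >> C & A = B `&` C]].
have Gm A : G A -> measurable A.
  by move=> [B [C [/sub_sigma_gen_of mB /sub_sigma_gen_of mC ->]]]; exact: measurableI.
have GI : setI_closed G.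
  move=> _ _ [B [C [KB KC ->]]] [B' [C' [KB' KC' ->]]].
  exists (B `&` B'), (C `&` C'); split; [exact: sigmaI..|].
  by rewrite setIACA.
have LG : <<s gen L >> `<=` <<s G >>.
  apply: sigma_gen_sub => A [k Lk [B mB <-]]; rewrite setTI.
  apply: sub_sigma_algebra; have [Kk|nKk] := pselect (K k).
    exists (X k @^-1` B), setT; rewrite setIT; split=> //; last exact: sigmaT.
    exact: gen_preimage.
  exists setT, (X k @^-1` B); rewrite setTI; split=> //; first exact: sigmaT.
  exact: gen_preimage.
move=> A LA; apply: (pi_lambda_E GI Gm V1' V1) (LG _ LA).
  by rewrite (CE_E VY) (CE_E VY').
move=> _ [B [C [KB KC ->]]].
have mB := sub_sigma_gen_of KB; have mC := sub_sigma_gen_of KC.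
have KB' : <<s gen K >> B by apply: gen_sub KB => k [].
have e f : E (fun w => f w * \1_(B `&` C) w) = E (fun w => (f w * \1_B w) * \1_C w).
  by apply: eqE => w; rewrite indicI mulrA.
rewrite !e (@indep_E (K `&` L) (L `\` K))//; last 3 first.
- by apply/seteqP; split=> k // [[Kk _] [_]].
- exact: (measurable_funM mV' (gmeas_indic KB)).
- exact: L1_mul_indic.
rewrite (@indep_E K (L `\` K) (fun w => V w * \1_B w))//; last 3 first.
- by apply/seteqP; split=> k // [Kk [_]].
- exact: (measurable_funM mV (gmeas_indic KB')).
- exact: L1_mul_indic.
by rewrite VYA// VYA'.
Qed.

End Independence.

(** * Duality, second moments and weak limits *)

Section MoreCondexp.
Context d (T : measurableType d) (R : realType) (P : probability T R).
Implicit Types (C G : set (set T)) (f g Y V U : T -> R) (A B : set T).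

Local Notation E f := (Rintegral P [set: T] f).

Lemma CE_ext C Y Y' V : sub_sigma C -> CE P C Y V ->
  measurable_fun [set: T] Y -> measurable_fun [set: T] Y' ->
  {ae P, forall w, Y w = Y' w} -> CE P C Y' V.
Proof.
move=> sC [V1 mV VY] mY mY' YY'; split=> // A CA; rewrite VY//.
have mA := indic_meas (sC _ CA).
apply: E_eq_ae; [exact: measurable_funM mY (mA _)|exact: measurable_funM mY' (mA _)|].
by apply: filterS YY' => w ->.
Qed.

Lemma CE_pull C Y V U : L1 P Y -> sub_sigma C -> CE P C Y V -> gmeas C U ->
  L1 P (fun w => Y w * U w) -> CE P C (fun w => Y w * U w) (fun w => V w * U w).
Proof.
move=> Y1 sC VY mU YU1; have [V1 mV _] := VY.
have [VU1 _] := pullout Y1 sC VY mU YU1; split=> //; first exact: measurable_funM mV mU.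
move=> A CA.
have mUA : gmeas C (fun w => U w * \1_A w) by exact: (measurable_funM mU (gmeas_indic CA)).
have YUA1 : L1 P (fun w => Y w * (U w * \1_A w)).
  by apply: eq_L1 (L1_mul_indic YU1 (sC _ CA)) => w; rewrite mulrA.
have [_ VYUA] := pullout Y1 sC VY mUA YUA1.
rewrite (@eqE _ _ _ P _ (fun w => V w * (U w * \1_A w))); last by move=> w; rewrite mulrA.
by rewrite VYUA; apply: eqE => w; rewrite mulrA.
Qed.

Lemma CE_L2 C Y V : sub_sigma C -> L2 P Y -> CE P C Y V ->
  L2 P V /\ E (fun w => V w ^+ 2) <= E (fun w => Y w ^+ 2).
Proof.
move=> sC Y2 VY; have [V1 mV _] := VY.
have [|V2 le] := @CE_pow _ _ _ P C Y V 1%N (L2_L1 Y2) sC VY.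
  by apply: eq_L1 Y2.2 => w; rewrite real_normK ?num_real.
split; first split; first exact: gmeas_measurable mV.
  by apply: eq_L1 V2 => w; rewrite real_normK ?num_real.
rewrite (@eqE _ _ _ P _ (fun w => `|V w| ^+ 2)); last by move=> w; rewrite real_normK ?num_real.
apply: (le_trans le); rewrite le_eqVlt; apply/orP; left; apply/eqP.
by apply: eqE => w; rewrite real_normK ?num_real.
Qed.

(** Conditional expectation is self-adjoint: both sides equal [E[V1 V2]]. *)
Lemma CE_swap C Y1 Y2 V1 V2 : sub_sigma C -> L1 P Y1 -> L1 P Y2 ->
  CE P C Y1 V1 -> CE P C Y2 V2 ->
  L1 P (fun w => Y1 w * V2 w) -> L1 P (fun w => Y2 w * V1 w) ->
  E (fun w => Y1 w * V2 w) = E (fun w => Y2 w * V1 w).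
Proof.
move=> sC Y11 Y21 C1 C2 i1 i2; have [_ mV1 _] := C1; have [_ mV2 _] := C2.
have [_ <-] := pullout Y11 sC C1 mV2 i1.
have [_ <-] := pullout Y21 sC C2 mV1 i2.
by apply: eqE => w; rewrite mulrC.
Qed.

Lemma CE_bnd C Y V (c : R) : L1 P Y -> sub_sigma C -> CE P C Y V ->
  (forall w, `|Y w| <= c) -> {ae P, forall w, `|V w| <= c}.
Proof.
move=> Y1 sC VY Yc.
have h1 : {ae P, forall w, V w <= c}.
  apply: (CE_le Y1 (L1_cst P c) sC VY (CE_cst P C c)).
  by apply: aeP => w; rewrite (le_trans _ (Yc w))// ler_norm.
have h2 : {ae P, forall w, - c <= V w}.
  apply: (CE_le (L1_cst P (- c)) Y1 sC (CE_cst P C (- c)) VY).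
  by apply: aeP => w; have := Yc w; rewrite ler_norml => /andP[].
by apply: filterS2 h1 h2 => w V1 V2; rewrite ler_norml V1 V2.
Qed.

Lemma L2_abs_le f (c : R) : L2 P f -> E (fun w => f w ^+ 2) <= c ->
  E (fun w => `|f w|) <= c + 1.
Proof.
move=> f2 fc; apply: (@le_trans _ _ (E (fun w => f w ^+ 2 + 1))).
  apply: E_le; [exact/L1_norm/L2_L1|by apply: L1D; [exact: f2.2|exact: L1_cst]|].
  move=> w; rewrite -real_normK ?num_real//; set a := `|f w|.
  have : 0 <= a by rewrite normr_ge0.
  by have := sqr_ge0 (a - 1); nra.
by rewrite ED ?E_cst ?lerD2r//; [exact: f2.2|exact: L1_cst].
Qed.

(** From [|x| <= e * x ^+ 2 + e^-1]. A common bound on second moments thus makes integrals over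
    small events small, uniformly along a sequence. *)
Lemma L2_indic_le f A (c e : R) : L2 P f -> measurable A -> E (fun w => f w ^+ 2) <= c ->
  0 < e -> `|E (fun w => f w * \1_A w)| <= e * c + e^-1 * E (\1_A : T -> R).
Proof.
move=> f2 mA fc e0.
have fA1 := L1_mul_indic (L2_L1 f2) mA.
have A1 : L1 P (\1_A : T -> R).
  apply: (@L1_bnd _ _ _ _ _ 1) => [|w]; first exact: indic_meas.
  by rewrite ger0_norm ?indic_le1 ?indic_ge0.
rewrite (le_trans (E_abs fA1))//.
apply: (@le_trans _ _ (E (fun w => e * f w ^+ 2 + e^-1 * \1_A w))).
  apply: E_le; [exact: L1_norm|by apply: L1D; apply: L1Z => //; exact: f2.2|].
  move=> w; rewrite normrM (ger0_norm (indic_ge0 _ _ _)) indicE.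
  case: (_ \in _) => /=; rewrite ?mulr0 ?mulr1 ?addr0; last by rewrite mulr_ge0 ?sqr_ge0 ?(ltW e0).
  rewrite -(real_normK (num_real (f w))); set a := `|f w|.
  have a0 : 0 <= a by rewrite normr_ge0.
  have -> : e * a ^+ 2 + e^-1 = a + e^-1 * ((e * a - 1 / 2) ^+ 2 + 3 / 4).
    by field; rewrite gt_eqF.
  by rewrite lerDl mulr_ge0 ?invr_ge0 ?(ltW e0)// addr_ge0 ?sqr_ge0//; lra.
rewrite ED; [|by apply: L1Z; exact: f2.2|exact: L1Z].
by rewrite !EZ//; [rewrite lerD2r ler_wpM2l ?(ltW e0)|exact: f2.2].
Qed.

(** The delicate closure is under increasing unions, where limits in [n] and [k] must be exchanged:
    [L2_indic_le] bounds the integral over the missing part of the union uniformly in [n]. *)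
Lemma pi_lambda_weak G (h : nat -> T -> R) (c : R) : setI_closed G ->
  (forall A, G A -> measurable A) ->
  (forall n, L2 P (h n)) -> (forall n, E (fun w => h n w ^+ 2) <= c) ->
  E (h n) @[n --> \oo] --> 0 ->
  (forall A, G A -> E (fun w => h n w * \1_A w) @[n --> \oo] --> 0) ->
  forall A, <<s G >> A -> E (fun w => h n w * \1_A w) @[n --> \oo] --> 0.
Proof.
move=> GI Gm h2 hc hT hG A GA.
have h1 n := L2_L1 (h2 n).
pose H := [set A | measurable A /\ E (fun w => h n w * \1_A w) @[n --> \oo] --> 0].
have E_D n A1 A2 : measurable A1 -> measurable A2 -> A2 `<=` A1 ->
    E (fun w => h n w * \1_(A1 `\` A2) w) =
    E (fun w => h n w * \1_A1 w) - E (fun w => h n w * \1_A2 w).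
  move=> m1 m2 A21; rewrite -EB; [|exact: L1_mul_indic..].
  apply: eqE => w; rewrite -mulrBr !indicE in_setD; congr (_ * _).
  have [w2|w2] := boolP (w \in A2); last by rewrite andbT subr0.
  by rewrite mem_set ?subrr//; apply: A21; rewrite inE in w2.
have lH : lambda_system setT H.
  split => //.
  - split => //; rewrite (_ : (fun n => E _) = (fun n => E (h n)))//.
    by apply/funext => n; apply: eqE => w; rewrite indicT mulr1.
  - move=> A1 A2 A21 [m1 e1] [m2 e2]; split; first exact: measurableD.
    rewrite (_ : (fun n => E _) = (fun n => E (fun w => h n w * \1_A1 w) -
      E (fun w => h n w * \1_A2 w))); last by apply/funext => n; exact: E_D.
    by rewrite -[X in _ --> X]subr0; exact: cvgB.
  - move=> F ndF HF.
    have mF n : measurable (F n) by have [] := HF n.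
    have mU : measurable (\bigcup_i F i) by exact: bigcup_measurable.
    split => //.
    have c0 : 0 <= c by rewrite (le_trans _ (hc 0%N))// E_ge0// => w; exact: sqr_ge0.
    apply/cvgr0Pnorm_le => e e0.
    (* This weight makes each term of [L2_indic_le] at most [e / 3]; [c + 1] guards against
       [c = 0]. *)
    pose e' := e / 3 / (c + 1).
    have c1 : 0 < c + 1 by rewrite ltr_wpDl.
    have e3 : 0 < e / 3 by rewrite divr_gt0.
    have e'0 : 0 < e' by rewrite divr_gt0.
    have [k Uk] : exists k, E (\1_(\bigcup_i F i `\` F k) : T -> R) <= e' * (e / 3).
      have : E (\1_(\bigcup_i F i `\` F k) : T -> R) @[k --> \oo] --> E (fun=> 0 : R).
        have mD k : measurable_fun [set: T] (\1_(\bigcup_i F i `\` F k) : T -> R).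
          by apply: indic_meas; exact: measurableD.
        apply: (E_dct mD (measurable_cst _) (L1_cst P 1)) => [n w|w].
          by rewrite ger0_norm ?indic_ge0// indic_le1.
        apply: cvg_near_cst.
        have [wF|nF] := pselect ((\bigcup_i F i) w).
          apply: filterS (nd_sets_eventually ndF wF) => n Fn.
          by rewrite indicE memNset// => -[].
        by apply: nearW => n; rewrite indicE memNset// => -[].
      rewrite E_cst => /cvgr0Pnorm_le /(_ _ (mulr_gt0 e'0 e3)) [k _ /(_ k (leqnn k)) hk].
      by exists k; rewrite (le_trans (ler_norm _) hk).
    have [_ /cvgr0Pnorm_le /(_ _ e3)] := HF k; apply: filterS => n hn.
    have -> : E (fun w => h n w * \1_(\bigcup_i F i) w) =
        E (fun w => h n w * \1_(F k) w) + E (fun w => h n w * \1_(\bigcup_i F i `\` F k) w).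
      have Fk : F k `<=` \bigcup_i F i by exact: bigcup_sup.
      by rewrite (E_D n _ _ mU (mF k) Fk) [RHS]addrC subrK.
    rewrite (le_trans (ler_normD _ _))//.
    have mDk : measurable (\bigcup_i F i `\` F k) by exact: measurableD.
    have := L2_indic_le (h2 n) mDk (hc n) e'0.
    have h3 : e' * c <= e / 3.
      rewrite /e' mulrAC ler_pdivrMr// ler_wpM2l ?(ltW e3)// lerDl//.
    have h4 : e'^-1 * E (\1_(\bigcup_i F i `\` F k) : T -> R) <= e / 3.
      by rewrite mulrC ler_pdivrMr// mulrC.
    have tri (x y u v : R) : x <= e / 3 -> u <= e / 3 -> v <= e / 3 ->
      y <= u + v -> x + y <= e by lra.
    exact: tri hn h3 h4.
have GH : G `<=` H by move=> B GB; split; [exact: Gm|exact: hG].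
by have [] := lambda_system_subset GI lH GH (fun _ _ => @subsetT _ _) GA.
Qed.

End MoreCondexp.

(** * Convergence of the martingale of conditional expectations *)

Section Martingale.
Context d (T : measurableType d) d' (S : measurableType d') (R : realType).
Variables (P : probability T R) (X : nat -> {mfun T >-> S}).

Local Notation E f := (Rintegral P [set: T] f).

(** Strict, so that [past 0] is empty and [past i.+1] is the index set of [condexp_past i]. *)
Definition past n := [set k | (k < n)%N].

Variables (F : T -> R) (M : nat -> T -> R).
Hypotheses (F2 : L2 P F) (mF : gmeas (gen X setT) F).
Hypothesis hM : forall n, CE P (gen X (past n)) F (M n).

Let sg K : sub_sigma (gen X K) := @sub_sigma_gen_of _ _ _ _ X K.

Lemma mart_L2 n : L2 P (M n) /\ E (fun w => M n w ^+ 2) <= E (fun w => F w ^+ 2).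
Proof. exact: (CE_L2 (@sg _) F2 (hM n)). Qed.

Let h n w := M n w - F w.

Let h2 n : L2 P (h n). Proof. exact: (L2B (mart_L2 n).1 F2). Qed.

Let h2_le n : E (fun w => h n w ^+ 2) <= 4 * E (fun w => F w ^+ 2).
Proof.
have [M2 Mle] := mart_L2 n.
apply: (@le_trans _ _ (E (fun w => 2 * M n w ^+ 2 + 2 * F w ^+ 2))).
  apply: E_le; [exact: (h2 n).2|by apply: L1D; apply: L1Z; [exact: M2.2|exact: F2.2]|].
  move=> w; rewrite -subr_ge0 /h.
  rewrite (_ : _ - _ = (M n w + F w) ^+ 2) ?sqr_ge0//; ring.
rewrite ED; [|by apply: L1Z; exact: M2.2|by apply: L1Z; exact: F2.2].
rewrite !EZ; [|exact: F2.2|exact: M2.2].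
have arith (x y : R) : x <= y -> 2 * x + 2 * y <= 4 * y by lra.
exact: arith.
Qed.

(** A cylinder involves finitely many coordinates; once [n] exceeds them all, it lies in the
    conditioning sigma-algebra and the integral is exactly zero. *)
Let h_cyl A : cyl X setT A -> E (fun w => h n w * \1_A w) @[n --> \oo] --> 0.
Proof.
move=> [J [B [uJ _ mB ->]]]; set A' := \bigcap_(_ in _) _.
apply: cvg_near_cst; near=> n.
have : cyl X (past n) A'.
  exists J, B; split=> // k /= kJ; rewrite /past/=.
  apply: (@leq_trans (\max_(j <- J) j).+1); first by rewrite ltnS (big_rem k)//= leq_maxl.
  by near: n; exact: nbhs_infty_ge.
move/cyl_gen => cA; have [M1 _ /(_ _ cA) e] := hM n.
have mA := sg cA.
rewrite (@eqE _ _ _ P _ (fun w => M n w * \1_A' w - F w * \1_A' w)); last first.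
  by move=> w; rewrite mulrBl.
by rewrite EB ?e ?subrr//; apply: L1_mul_indic => //; exact: L2_L1.
Unshelve. all: end_near. Qed.

(** Meant for [E[M_n f(W)]] with bounded [f(W)]. The uniform second moment bound carries the
    convergence from cylinders to all events, and from there to bounded functions. *)
Lemma mart_weak U (K : nat) : gmeas (gen X setT) U -> (forall w, `|U w| <= K%:R) ->
  E (fun w => M n w * U w) @[n --> \oo] --> E (fun w => F w * U w).
Proof.
move=> mU UK; have mUT := gmeas_measurable (@sg _) mU.
have hT : E (h n) @[n --> \oo] --> 0.
  apply: cvg_near_cst; apply: nearW => n.
  rewrite /h EB; [|exact: L2_L1 (mart_L2 n).1|exact: L2_L1].
  by rewrite (CE_E (hM n)) subrr.
have hS := pi_lambda_weak (@cylI _ _ _ _ X setT) (@cyl_measurable _ _ _ _ X setT)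
  h2 h2_le hT h_cyl.
have hw : E (fun w => h n w * U w) @[n --> \oo] --> 0.
  apply: (@E_weak_bnd _ _ _ P (gen X setT) h (4 * E (fun w => F w ^+ 2) + 1) U K) => //.
  - by move=> n; exact: L2_L1.
  - by move=> n; exact: L2_abs_le.
  - by move=> A cA; apply: hS; exact: gen_cyl.
rewrite -[X in _ --> X]add0r.
rewrite (_ : (fun n => E _) = (fun n => E (fun w => h n w * U w) + E (fun w => F w * U w))).
  by apply: cvgD => //; exact: cvg_cst.
apply/funext => n; rewrite -ED.
- by apply: eqE => w; rewrite -mulrDl subrK.
- exact: (L1_mul_bnd (L2_L1 (h2 n)) mUT UK).
- exact: (L1_mul_bnd (L2_L1 F2) mUT UK).
Qed.

(* Lower semicontinuity of the norm under weak convergence: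
   [E[M_n ^ 2] >= 2 E[M_n phi] - E[phi ^ 2]] for every truncation [phi] of [F]. *)
Lemma mart_norm : E (fun w => M n w ^+ 2) @[n --> \oo] --> E (fun w => F w ^+ 2).
Proof.
have mFT := L2_meas F2.
apply/cvgrPdist_le => e e0.
have e4 : 0 < e / 4 by rewrite divr_gt0.
have /cvgrPdist_le /(_ _ e4) [K _ /(_ K (leqnn K))] := E_trunc mFT F2.2.
rewrite ler_norml => /andP[_]; rewrite /=.
pose phi w := F w * \1_(trunc F K) w.
have phib w : `|phi w| <= K%:R.
  rewrite /phi indicE; have [|_] := boolP (w \in _); last by rewrite mulr0 normr0.
  by rewrite inE mulr1.
have mphi : gmeas (gen X setT) phi.
  by apply: (measurable_funM mF); apply: gmeas_indic; exact: gmeas_trunc.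
have phi2 : L2 P phi by exact: (L2_bnd P (gmeas_measurable (@sg _) mphi) phib).
set s := E (fun w => F w ^+ 2); set a := E _ => sa.
have phiE : E (fun w => phi w ^+ 2) = a.
  apply: eqE => w; rewrite /phi exprMn indicE; case: (_ \in _) => /=; by rewrite ?expr1n ?expr0n.
have FphiE : E (fun w => F w * phi w) = a.
  by apply: eqE => w; rewrite /phi mulrA -expr2.
have /cvgrPdist_le /(_ _ e4) := mart_weak mphi phib.
apply: filterS => n; rewrite FphiE ler_norml => /andP[_ le2].
have [M2 Mle] := mart_L2 n.
rewrite -/s in Mle *; rewrite ger0_norm ?subr_ge0//.
have : 2 * E (fun w => M n w * phi w) - E (fun w => phi w ^+ 2) <= E (fun w => M n w ^+ 2).
  rewrite -EZ; last exact: L2_mul.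
  rewrite -EB; [|by apply: L1Z; exact: L2_mul|exact: phi2.2].
  apply: E_le; [|exact: M2.2|].
    by apply: L1B; [by apply: L1Z; exact: L2_mul|exact: phi2.2].
  move=> w; rewrite -subr_ge0 (_ : _ - _ = (M n w - phi w) ^+ 2) ?sqr_ge0//; ring.
have arith (x y : R) : s - a <= e / 4 -> a - x <= e / 4 -> 2 * x - a <= y -> s - y <= e.
  by lra.
by rewrite phiE; exact: arith sa le2.
Qed.

End Martingale.

(** * Conditioned Stein expansion *)

Section SteinLimits.
Context {R : realType}.
Implicit Types (x z : R) (a : nat -> R).

Lemma stein_continuous z : continuous (stein z).
Proof.
move=> x; apply/cvgrPdist_le => e e0.
have /cvgrPdist_le /(_ e e0) : y @[y --> x] --> x by exact: cvg_id.
by apply: filterS => y; apply: le_trans; exact: stein_lipschitz.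
Qed.

Lemma measurable_ind_gt z : measurable_fun [set: R] (ind_gt z).
Proof.
apply: nondecreasing_measurable => // x y xy; rewrite /ind_gt ler_nat.
by have [zx|] := ltP z x => //; rewrite (lt_le_trans zx xy).
Qed.

Lemma dsteinE z x : dstein z x = x * stein z x + (1 - ind_gt z x) - gcdf z.
Proof. by rewrite /dstein /ind_gt; case: leP; rewrite ?subrr ?subr0. Qed.

Lemma measurable_stein z : measurable_fun [set: R] (stein z).
Proof. by apply: continuous_measurable_fun; exact: stein_continuous. Qed.

Lemma measurable_dstein z : measurable_fun [set: R] (dstein z).
Proof.
rewrite (_ : dstein z = fun x => x * stein z x + (1 - ind_gt z x) - gcdf z); last first.
  by apply/funext => x; exact: dsteinE.
apply: measurable_funB => //; apply: measurable_funD.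
  by apply: measurable_funM => //; exact: measurable_stein.
by apply: measurable_funB => //; exact: measurable_ind_gt.
Qed.

Lemma stein_cst_ge0 : 0 <= stein_cst :> R.
Proof. by rewrite divr_ge0// sqrtr_ge0. Qed.

Lemma stein_bnd z x : `|stein z x| <= stein_cst.
Proof. by rewrite ger0_norm ?stein_ge0// stein_le. Qed.

Lemma ind_gt_bnd z x : `|ind_gt z x| <= 1.
Proof. by rewrite /ind_gt; case: (_ < _); rewrite ?normr0 ?normr1. Qed.

Lemma ind_gt_left z x a : (forall n, a n <= x) -> a n @[n --> \oo] --> x ->
  ind_gt z (a n) @[n --> \oo] --> ind_gt z x.
Proof.
move=> ax cax; apply: cvg_near_cst; have [xz|zx] := leP x z.
  by apply: nearW => n; rewrite /ind_gt !ltNge xz (le_trans (ax n) xz).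
near=> n; rewrite /ind_gt zx (_ : z < a n)//.
by near: n; exact: (cvgr_gt x).
Unshelve. all: end_near. Qed.

Lemma dstein_left z x a : (forall n, a n <= x) -> a n @[n --> \oo] --> x ->
  dstein z (a n) @[n --> \oo] --> dstein z x.
Proof.
move=> ax cax; rewrite dsteinE; under eq_fun do rewrite dsteinE.
apply: cvgB; last exact: cvg_cst.
apply: cvgD.
  by apply: cvgM => //; apply: continuous_cvg => //; exact: stein_continuous.
by apply: cvgB; [exact: cvg_cst|exact: ind_gt_left].
Qed.

(** Approximation from the left by rationals, hence within a countable set. *)
Definition lfloor (n : nat) x : R := (Num.floor (n.+1%:R * x))%:~R / n.+1%:R.

Lemma lfloor_le n x : lfloor n x <= x.
Proof. by rewrite ler_pdivrMr// mulrC; exact: floor_le. Qed.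

Lemma lfloor_cvg x : lfloor n x @[n --> \oo] --> x.
Proof.
apply: (@squeeze_cvgr _ _ _ _ (fun n => x - n.+1%:R^-1) (fun=> x)).
- near=> n; rewrite lfloor_le andbT /lfloor ler_pdivlMr// mulrBl mulVf//.
  by rewrite lerBlDr [x * _]mulrC ltW// -[X in _ + X](mulr1z 1) -intrD floorD1_gt.
- rewrite -[X in _ --> X]subr0; apply: cvgB; first exact: cvg_cst.
  exact: cvg_harmonic.
- exact: cvg_cst.
Unshelve. all: end_near. Qed.

End SteinLimits.

(** * Substitution of a random base point *)

Section Conditional.
Context d (T : measurableType d) (R : realType) (P : probability T R).
Implicit Types (W : T -> R).

Local Notation E f := (Rintegral P [set: T] f).

(** The null set where [H a] is negative depends on [a], so [a = W w] cannot be substituted at once.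
    Off the countable union of these sets over rational [a], the inequality passes to the limit
    along [lfloor n (W w)]. *)
Lemma ae_subst_left (H : R -> T -> R) W :
  (forall a, {ae P, forall w, 0 <= H a w}) ->
  (forall w (a : nat -> R), (forall n, a n <= W w) -> a n @[n --> \oo] --> W w ->
    H (a n) w @[n --> \oo] --> H (W w) w) ->
  {ae P, forall w, 0 <= H (W w) w}.
Proof.
move=> aeH lH.
have ae1 : {ae P, forall w, forall n m : nat, 0 <= H (m%:R / n.+1%:R) w}.
  by apply: ae_foralln => n; apply: ae_foralln => m; exact: aeH.
have ae2 : {ae P, forall w, forall n m : nat, 0 <= H ((- m%:R) / n.+1%:R) w}.
  by apply: ae_foralln => n; apply: ae_foralln => m; exact: aeH.
apply: filterS2 ae1 ae2 => w h1 h2.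
apply: (cvgr_to_ge (lH w (lfloor ^~ (W w)) _ _)) => [n||].
- exact: lfloor_le.
- exact: lfloor_cvg.
- apply: nearW => n; rewrite /lfloor.
  case: (Num.floor _) => m; first exact: h1.
  by rewrite NegzE mulrNz; exact: h2.
Qed.

End Conditional.

(** * The estimate for one increment *)

Section OneStep.
Context d (T : measurableType d) (R : realType) (P : probability T R).
Implicit Types (f g h : T -> R).

Local Notation E f := (Rintegral P [set: T] f).

Lemma L1_pow_le f n k : measurable_fun [set: T] f -> (k <= n)%N ->
  L1 P (fun w => `|f w| ^+ n) -> L1 P (fun w => `|f w| ^+ k).
Proof.
move=> mf kn fn; apply: (L1_dom _ (L1D (L1_cst P 1) fn)).
  by apply: measurable_funX; exact: measurableT_comp.
move=> w; rewrite ger0_norm ?exprn_ge0//.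
have [f1|/ltW f1] := leP `|f w| 1.
  by rewrite (le_trans (exprn_ile1 _ (normr_ge0 _) f1))// lerDl exprn_ge0.
by rewrite (le_trans (ler_weXn2l f1 kn))// lerDr.
Qed.

Lemma L2_of_pow6 f : measurable_fun [set: T] f -> L1 P (fun w => `|f w| ^+ 6) -> L2 P f.
Proof.
move=> mf f6; split=> //; have := L1_pow_le mf (isT : (2 <= 6)%N) f6.
by apply: eq_L1 => w; rewrite real_normK ?num_real.
Qed.

Lemma L2_sqr_of_pow6 f : measurable_fun [set: T] f -> L1 P (fun w => `|f w| ^+ 6) ->
  L2 P (fun w => f w ^+ 2).
Proof.
move=> mf f6; split; first exact: measurable_funX.
have := L1_pow_le mf (isT : (4 <= 6)%N) f6.
by apply: eq_L1 => w; rewrite -exprM -normrX ger0_norm// (exprM _ 2 2) sqr_ge0.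
Qed.

Context (C : set (set T)) (sC : sub_sigma C).
(** [C] stands for the sigma-algebra of the variables other than [X i], and [W], [xi] for [F] and
    its martingale increment divided by the standard deviation; [m], [N], [EU] are versions of
    [E_i W], [E_i |xi|], [E_i U]. *)
Variables (W m xi N U EU : T -> R) (z : R).

Let Dl w := W w - m w.

Hypotheses (W2 : L2 P W) (EW : E (fun w => W w ^+ 2) <= 1) (hm : CE P C W m).
Hypothesis D6 : L1 P (fun w => `|Dl w| ^+ 6).
Hypotheses (mxi : measurable_fun [set: T] xi) (hxi : CE P C xi (fun=> 0)).
Hypotheses (xi6 : L1 P (fun w => `|xi w| ^+ 6))
  (xi3D : E (fun w => `|xi w| ^+ 3) <= E (fun w => `|Dl w| ^+ 3))
  (xi6D : E (fun w => `|xi w| ^+ 6) <= E (fun w => `|Dl w| ^+ 6)).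
Hypotheses (hN : CE P C (fun w => `|xi w|) N)
  (hU : forall w, U w = Dl w * (`|xi w| + N w)) (hEU : CE P C U EU).

Let c : R := stein_cst.
Let f w := stein z (W w).
Let f' w := dstein z (W w).
Let g w := ind_gt z (W w).

Let mW : measurable_fun [set: T] W. Proof. exact: L2_meas W2. Qed.
Let mf : measurable_fun [set: T] f. Proof. by apply: measurableT_comp => //; exact: measurable_stein. Qed.
Let mf' : measurable_fun [set: T] f'. Proof. by apply: measurableT_comp => //; exact: measurable_dstein. Qed.
Let mg : measurable_fun [set: T] g. Proof. by apply: measurableT_comp => //; exact: measurable_ind_gt. Qed.

Let f2 : L2 P f. Proof. by apply: (L2_bnd P mf) => w; exact: stein_bnd. Qed.
Let g2 : L2 P g. Proof. by apply: (L2_bnd P mg) => w; exact: ind_gt_bnd. Qed.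
Let Wg2 : L2 P (fun w => W w * g w).
Proof. by apply: (L2_mul_bnd (c := 1) W2 mg); apply: aeP => w; exact: ind_gt_bnd. Qed.

Let m2 : L2 P m. Proof. exact: (CE_L2 sC W2 hm).1. Qed.
Let D2 : L2 P Dl. Proof. exact: L2B. Qed.
Let mD : measurable_fun [set: T] Dl. Proof. exact: L2_meas D2. Qed.
Let DD2 : L2 P (fun w => Dl w ^+ 2). Proof. exact: L2_sqr_of_pow6. Qed.
Let xi2 : L2 P xi. Proof. exact: L2_of_pow6. Qed.
Let A2 : L2 P (fun w => `|xi w|). Proof. exact: L2_norm. Qed.
Let N2 : L2 P N. Proof. exact: (CE_L2 sC A2 hN).1. Qed.

Let e0 := condexp P <<s C >> f.
Let e3 := condexp P <<s C >> g.
Let e4 := condexp P <<s C >> (fun w => W w * g w).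
Let q := condexp P <<s C >> (fun w => Dl w ^+ 2).

Let ce0 : CE P C f e0. Proof. exact: (condexpP sC (L2_L1 f2)). Qed.
Let ce3 : CE P C g e3. Proof. exact: (condexpP sC (L2_L1 g2)). Qed.
Let ce4 : CE P C (fun w => W w * g w) e4. Proof. exact: (condexpP sC (L2_L1 Wg2)). Qed.
Let cq : CE P C (fun w => Dl w ^+ 2) q. Proof. exact: (condexpP sC (L2_L1 DD2)). Qed.

Let e02 : L2 P e0. Proof. exact: (CE_L2 sC f2 ce0).1. Qed.
Let e32 : L2 P e3. Proof. exact: (CE_L2 sC g2 ce3).1. Qed.
Let e42 : L2 P e4. Proof. exact: (CE_L2 sC Wg2 ce4).1. Qed.
Let q2 : L2 P q. Proof. exact: (CE_L2 sC DD2 cq).1. Qed.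
Let e3b : {ae P, forall w, `|e3 w| <= 1}.
Proof. by apply: (CE_bnd (L2_L1 g2) sC ce3) => w; exact: ind_gt_bnd. Qed.

Let gm h V : CE P C h V -> gmeas C V. Proof. by case. Qed.

Let gmm : gmeas C m := gm hm.
Let gmN : gmeas C N := gm hN.
Let gme3 : gmeas C e3 := gm ce3.

Let mm1 : L1 P (fun w => m w * m w). Proof. exact: L2_mul. Qed.
Let Wm1 : L1 P (fun w => W w * m w). Proof. exact: L2_mul. Qed.
Let WW1 : L1 P (fun w => W w ^+ 2). Proof. exact: W2.2. Qed.

(** A version of [E[W ^+ 2 | C]], in the shape given by [W ^+ 2 = Dl ^+ 2 + 2 * W * m - m * m] so
    that [q] appears in the remainder. *)
Let e2 w := q w + 2 * (m w * m w) - m w * m w.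

Let cW2 : CE P C (fun w => W w ^+ 2) e2.
Proof.
have D1 := L2_L1 DD2; have Wm2 : L1 P (fun w => 2 * (W w * m w)) by exact: L1Z.
have mmg : gmeas C (fun w => m w * m w) by exact: (measurable_funM gmm gmm).
have h := CEB (L1D D1 Wm2) mm1 sC
  (CED D1 Wm2 sC cq (CEZ 2 Wm1 sC (CE_pull (L2_L1 W2) sC hm gmm Wm1)))
  (CE_id mmg mm1).
apply: (CE_ext sC h); first exact: (L1_meas (L1B (L1D D1 Wm2) mm1)).
  exact: measurable_funX.
by apply: aeP => w; rewrite /Dl; ring.
Qed.

Let rem a w := stein z a - e0 w - dstein z a * (a - m w).

(** [bndW a] is the bound of [stein_taylor] around the fixed [a], expanded so that conditioning acts
    term by term, and [bnd a] is the conditioned form. [remW a] and [rem a] are related in the same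
    way. *)
Let bnd a w := (`|a| + c) * (2^-1 * (a ^+ 2 - 2 * a * m w + e2 w)) +
  (a * ind_gt z a - ind_gt z a * m w - a * e3 w + e4 w).

Let remW a w := stein z a - f w - dstein z a * (a - W w).

Let bndW a w := (`|a| + c) * (2^-1 * (a ^+ 2 - 2 * a * W w + W w ^+ 2)) +
  (a * ind_gt z a - ind_gt z a * W w - a * g w + W w * g w).

Let ae_rem a : {ae P, forall w, 0 <= bnd a w - `|rem a w|}.
Proof.
have W1 := L2_L1 W2; have f1 := L2_L1 f2; have g1 := L2_L1 g2; have Wg1 := L2_L1 Wg2.
have cst1 k : L1 P (fun=> k) by exact: L1_cst.
have ccst k : CE P C (fun=> k) (fun=> k) by exact: CE_cst.
have aW1 := L1B (cst1 a) W1; have caW := CEB (cst1 a) W1 sC (ccst a) hm.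
have sf1 := L1B (cst1 (stein z a)) f1.
have r1 : L1 P (remW a) := L1B sf1 (L1Z (dstein z a) aW1).
have cr : CE P C (remW a) (rem a) := CEB sf1 (L1Z (dstein z a) aW1) sC
  (CEB (cst1 _) f1 sC (ccst _) ce0) (CEZ _ aW1 sC caW).
have W1' k := L1Z k W1; have cW' k := CEZ k W1 sC hm.
have b11 := L1B (cst1 (a ^+ 2)) (W1' (2 * a)).
have cb11 := CEB (cst1 (a ^+ 2)) (W1' (2 * a)) sC (ccst _) (cW' _).
have b1 := L1D b11 WW1; have cb1 := CED b11 WW1 sC cb11 cW2.
have b1' := L1Z 2^-1 b1; have cb1' := CEZ 2^-1 b1 sC cb1.
have b21 := L1B (cst1 (a * ind_gt z a)) (W1' (ind_gt z a)).
have cb21 := CEB (cst1 (a * ind_gt z a)) (W1' (ind_gt z a)) sC (ccst _) (cW' _).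
have b22 := L1B b21 (L1Z a g1); have cb22 := CEB b21 (L1Z a g1) sC cb21 (CEZ a g1 sC ce3).
have b2 := L1D b22 Wg1; have cb2 := CED b22 Wg1 sC cb22 ce4.
have B1 : L1 P (bndW a) := L1D (L1Z (`|a| + c) b1') b2.
have cB : CE P C (bndW a) (bnd a) :=
  CED (L1Z (`|a| + c) b1') b2 sC (CEZ (`|a| + c) b1' sC cb1') cb2.
have le w : `|remW a w| <= bndW a w.
  rewrite (le_trans (stein_taylor z a (W w)))// le_eqVlt; apply/orP; left; apply/eqP.
  by rewrite /bndW /g /c; field.
have h1 : {ae P, forall w, rem a w <= bnd a w}.
  apply: (CE_le r1 B1 sC cr cB); apply: aeP => w.
  exact: le_trans (ler_norm _) (le w).
have h2 : {ae P, forall w, -1 * rem a w <= bnd a w}.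
  apply: (CE_le (L1Z (-1) r1) B1 sC (CEZ (-1) r1 sC cr) cB); apply: aeP => w.
  by rewrite mulN1r (le_trans _ (le w))// -normrN ler_norm.
apply: filterS2 h1 h2 => w; rewrite mulN1r => h1 h2.
by rewrite subr_ge0 ler_norml h1 andbT lerNl.
Qed.

Let ae_remW : {ae P, forall w, 0 <= bnd (W w) w - `|rem (W w) w|}.
Proof.
apply: (@ae_subst_left _ _ _ P (fun a w => bnd a w - `|rem a w|) W ae_rem) => w a aW cv.
have cc k : (fun=> k) @ \oo --> (k : R) by exact: cvg_cst.
have cg := ind_gt_left aW cv; have cd := dstein_left aW cv.
have cf : stein z (a n) @[n --> \oo] --> stein z (W w).
  by apply: continuous_cvg => //; exact: stein_continuous.
have cn : `|a n| @[n --> \oo] --> `|W w| by exact: cvg_norm.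
have cs : a n ^+ 2 @[n --> \oo] --> W w ^+ 2.
  by rewrite expr2; under eq_fun do rewrite expr2; exact: cvgM.
apply: cvgB; last first.
  apply: cvg_norm; apply: cvgB; first exact: cvgB.
  by apply: cvgM => //; exact: cvgB.
apply: cvgD.
  apply: cvgM; first exact: cvgD.
  apply: cvgM => //; apply: cvgD => //; apply: cvgB => //.
  by apply: cvgM => //; exact: cvgM.
apply: cvgD => //; apply: cvgB; last exact: cvgM.
by apply: cvgB; exact: cvgM.
Qed.

Let r w := f w - e0 w - f' w * Dl w.

Let V w := `|xi w| * (Dl w ^+ 2 + q w).

(** With [W'] a conditionally independent copy of [W] given [C], this would be the average over [W']
    of [(W - W') * (ind_gt z W - ind_gt z W')]: the jump part of the remainder. *)
Let TB w := W w * g w - m w * g w - W w * e3 w + e4 w.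

Let f'D2 : L2 P (fun w => Dl w * f' w).
Proof. by apply: (L2_mul_bnd (c := 1) D2 mf'); apply: aeP => w; exact: dstein_bnd. Qed.

Let We32 : L2 P (fun w => W w * e3 w).
Proof. exact: (L2_mul_bnd W2 (L2_meas e32) e3b). Qed.

Let mg2 : L2 P (fun w => m w * g w).
Proof. by apply: (L2_mul_bnd (c := 1) m2 mg); apply: aeP => w; exact: ind_gt_bnd. Qed.

Let TB2 : L2 P TB.
Proof. by apply: L2D => //; apply: L2B => //; exact: L2B. Qed.

Let ae_r : {ae P, forall w, `|r w| <= 2^-1 * ((`|W w| + c) * (Dl w ^+ 2 + q w)) + TB w}.
Proof.
apply: filterS ae_remW => w; rewrite subr_ge0.
rewrite (_ : bnd (W w) w = 2^-1 * ((`|W w| + c) * (Dl w ^+ 2 + q w)) + TB w).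
  by rewrite /rem /r /f /f' /Dl.
by rewrite /bnd /TB /e2 /Dl /g; ring.
Qed.

Let q3 : L1 P (fun w => `|q w| ^+ 3) /\
  E (fun w => `|q w| ^+ 3) <= E (fun w => `|Dl w| ^+ 6).
Proof.
have e w : `|Dl w ^+ 2| ^+ 3 = `|Dl w| ^+ 6 by rewrite normrX -exprM.
have DD3 : L1 P (fun w => `|Dl w ^+ 2| ^+ 3) by apply: eq_L1 D6 => w; rewrite e.
have [q31 le] := CE_pow (L2_L1 DD2) sC cq DD3; split=> //.
by rewrite (le_trans le)// (eqE _ e).
Qed.

Let N3 : L1 P (fun w => `|N w| ^+ 3) /\
  E (fun w => `|N w| ^+ 3) <= E (fun w => `|Dl w| ^+ 3).
Proof.
have e w : `| `|xi w| | ^+ 3 = `|xi w| ^+ 3 by rewrite normr_id.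
have xi3 := L1_pow_le mxi (isT : (3 <= 6)%N) xi6.
have xi3' : L1 P (fun w => `| `|xi w| | ^+ 3) by apply: eq_L1 xi3 => w; rewrite e.
have [N31 le] := CE_pow (L2_L1 A2) sC hN xi3'; split=> //.
by rewrite (le_trans le)// (eqE _ e).
Qed.

(** Use [(Dl ^+ 2 + q) ^+ 2 <= 2 * Dl ^+ 4 + 2 * q ^+ 2], then Young with exponents 3 and 3/2 on the
    products with [xi ^+ 2]. This leaves [4 / 3] times three terms, each with expectation at most
    that of [|Dl| ^+ 6]. *)
Let V2 : L2 P V /\ E (fun w => V w ^+ 2) <= 4 * E (fun w => `|Dl w| ^+ 6).
Proof.
have [q31 q3le] := q3.
have bound1 := L1Z (4 / 3) (L1D (L1D xi6 D6) q31).
have mV : measurable_fun [set: T] V.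
  apply: measurable_funM; first exact: L2_meas A2.
  by apply: measurable_funD; [exact: L2_meas DD2|exact: L2_meas q2].
have le w : V w ^+ 2 <= 4 / 3 * (`|xi w| ^+ 6 + `|Dl w| ^+ 6 + `|q w| ^+ 3).
  rewrite /V -[Dl w ^+ 2](real_normK (num_real (Dl w))).
  set a := `|xi w|; set b := `|Dl w|; set p := `|q w|.
  have y1 : 3 * (a ^+ 2 * (b ^+ 2) ^+ 2) <= (a ^+ 2) ^+ 3 + 2 * (b ^+ 2) ^+ 3.
    by apply: (@young_nat _ 2); rewrite sqr_ge0.
  have y2 : 3 * (a ^+ 2 * p ^+ 2) <= (a ^+ 2) ^+ 3 + 2 * p ^+ 3.
    by apply: (@young_nat _ 2); rewrite ?sqr_ge0 ?normr_ge0.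
  have y3 : (b ^+ 2 + q w) ^+ 2 <= 2 * (b ^+ 2) ^+ 2 + 2 * p ^+ 2.
    rewrite /p (real_normK (num_real (q w))) -subr_ge0.
    by rewrite [leRHS](_ : _ = (b ^+ 2 - q w) ^+ 2) ?sqr_ge0//; ring.
  have y4 : a ^+ 2 * (b ^+ 2 + q w) ^+ 2 <= a ^+ 2 * (2 * (b ^+ 2) ^+ 2 + 2 * p ^+ 2).
    by rewrite ler_wpM2l// sqr_ge0.
  rewrite exprMn (le_trans y4)//.
  rewrite -!exprM in y1 y2 *.
  have -> : a ^+ 2 * (2 * b ^+ (2 * 2) + 2 * p ^+ 2) =
    2 / 3 * (3 * (a ^+ 2 * b ^+ (2 * 2)) + 3 * (a ^+ 2 * p ^+ 2)) by field.
  have -> : 4 / 3 * (a ^+ 6 + b ^+ 6 + p ^+ 3) =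
    2 / 3 * (a ^+ (2 * 3) + 2 * b ^+ (2 * 3) + (a ^+ (2 * 3) + 2 * p ^+ 3)).
    by rewrite (_ : (2 * 3)%N = 6%N)//; field.
  by rewrite ler_wpM2l ?lerD// divr_ge0.
have VV1 : L1 P (fun w => V w ^+ 2).
  apply: (L1_dom _ bound1); first exact: measurable_funX.
  by move=> w; rewrite ger0_norm ?sqr_ge0.
split; first by split.
apply: le_trans (E_le VV1 bound1 le) _.
rewrite EZ; last by apply: L1D => //; exact: L1D.
rewrite ED//; last exact: L1D.
rewrite ED//.
have arith (x y p : R) : x <= y -> p <= y -> 4 / 3 * (x + y + p) <= 4 * y by lra.
exact: arith xi6D q3le.
Qed.

(** [CE_swap] first turns the product of [|xi|] and [q] into that of [N] and [Dl ^+ 2]: a direct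
    estimate would involve the power 3/2 of [q], while [CE_pow] handles integer powers. Young then
    bounds each half by the third moment of [Dl]. *)
Let EV : E V <= 2 * E (fun w => `|Dl w| ^+ 3).
Proof.
have D3 := L1_pow_le mD (isT : (3 <= 6)%N) D6.
have xi3 := L1_pow_le mxi (isT : (3 <= 6)%N) xi6.
have [N31 N3le] := N3.
have AD1 : L1 P (fun w => `|xi w| * Dl w ^+ 2) by exact: L2_mul.
have Aq1 : L1 P (fun w => `|xi w| * q w) by exact: L2_mul.
have DN1 : L1 P (fun w => Dl w ^+ 2 * N w) by exact: L2_mul.
have -> : E V = E (fun w => `|xi w| * Dl w ^+ 2) + E (fun w => `|xi w| * q w).
  by rewrite -ED//; apply: eqE => w; rewrite /V mulrDr.
rewrite (CE_swap sC (L2_L1 A2) (L2_L1 DD2) hN cq Aq1 DN1).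
have young w (h : T -> R) : h w * Dl w ^+ 2 <=
    3^-1 * (`|h w| ^+ 3 + 2 * `|Dl w| ^+ 3).
  rewrite -[Dl w ^+ 2](real_normK (num_real (Dl w))) -(ler_pM2l (_ : 0 < 3 :> R))//.
  rewrite [leRHS]mulrA divff// mul1r.
  apply: (@le_trans _ _ (3 * (`|h w| * `|Dl w| ^+ 2))).
    by rewrite ler_wpM2l// ler_wpM2r ?sqr_ge0// ler_norm.
  exact: (@young_nat _ 2).
have b1 (h : T -> R) : L1 P (fun w => `|h w| ^+ 3) ->
    L1 P (fun w => 3^-1 * (`|h w| ^+ 3 + 2 * `|Dl w| ^+ 3)).
  by move=> h3; apply: L1Z; apply: L1D => //; exact: L1Z.
have bE (h : T -> R) : L1 P (fun w => `|h w| ^+ 3) ->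
    E (fun w => 3^-1 * (`|h w| ^+ 3 + 2 * `|Dl w| ^+ 3)) =
    3^-1 * (E (fun w => `|h w| ^+ 3) + 2 * E (fun w => `|Dl w| ^+ 3)).
  move=> h3; rewrite EZ; last by apply: L1D => //; exact: L1Z.
  by rewrite ED ?EZ//; exact: L1Z.
have l1 : E (fun w => `|xi w| * Dl w ^+ 2) <=
    3^-1 * (E (fun w => `|xi w| ^+ 3) + 2 * E (fun w => `|Dl w| ^+ 3)).
  rewrite -(bE _ xi3); apply: (E_le AD1 (b1 _ xi3)) => w.
  by have := young w (fun w => `|xi w|); rewrite normr_id.
have l2 : E (fun w => Dl w ^+ 2 * N w) <=
    3^-1 * (E (fun w => `|N w| ^+ 3) + 2 * E (fun w => `|Dl w| ^+ 3)).
  rewrite -(bE _ N31); apply: (E_le DN1 (b1 _ N31)) => w.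
  by rewrite mulrC; exact: young.
have arith (x y n p u : R) : x <= y -> n <= y -> p <= 3^-1 * (x + 2 * y) ->
  u <= 3^-1 * (n + 2 * y) -> p + u <= 2 * y by lra.
exact: arith xi3D N3le l1 l2.
Qed.

Let WV1 : L1 P (fun w => `|W w| * V w).
Proof. by apply: L2_mul; [exact: L2_norm|exact: V2.1]. Qed.

(* AM-GM with weight [v]; [e] avoids dividing by zero when [Dl] vanishes. *)
Let EWV : E (fun w => `|W w| * V w) <= 2 * Num.sqrt (E (fun w => `|Dl w| ^+ 6)).
Proof.
set D6E := E (fun w => `|Dl w| ^+ 6).
have D60 : 0 <= D6E by apply: E_ge0 => w; rewrite exprn_ge0.
apply/ler_addgt0Pr => e epos.
pose v := Num.sqrt D6E + e / 2.
have v0 : 0 < v by rewrite ltr_wpDl ?sqrtr_ge0 ?divr_gt0.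
have [[_ VV1] VVle] := V2.
have b1 : L1 P (fun w => v * W w ^+ 2 + (4 * v)^-1 * V w ^+ 2).
  by apply: L1D; exact: L1Z.
have le w : `|W w| * V w <= v * W w ^+ 2 + (4 * v)^-1 * V w ^+ 2.
  rewrite -[W w ^+ 2](real_normK (num_real (W w))) -subr_ge0.
  have -> : v * `|W w| ^+ 2 + (4 * v)^-1 * V w ^+ 2 - `|W w| * V w =
    v * (`|W w| - (2 * v)^-1 * V w) ^+ 2 by field; rewrite gt_eqF.
  by rewrite mulr_ge0 ?sqr_ge0 ?(ltW v0).
apply: le_trans (E_le WV1 b1 le) _.
rewrite ED ?EZ//; [|exact: L1Z..].
have h1 : v * E (fun w => W w ^+ 2) <= v by rewrite ler_piMr// ltW.
have h2 : (4 * v)^-1 * E (fun w => V w ^+ 2) <= v.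
  rewrite mulrC ler_pdivrMr ?mulr_gt0//.
  apply: (le_trans VVle); rewrite -/D6E mulrCA ler_pM2l// -[D6E]sqr_sqrtr// expr2.
  by rewrite ler_pM ?sqrtr_ge0// lerDl ltW// divr_gt0.
have arith (x y : R) : x <= v -> y <= v -> x + y <= 2 * Num.sqrt D6E + e.
  by rewrite /v; lra.
exact: arith h1 h2.
Qed.

(* Both sides are expanded and matched by moving conditional expectations from
   one factor to the other; [E[Dl N e3] = 0] as [N e3] is measurable for [C]. *)
Let swapTB : E (fun w => `|xi w| * TB w) = E (fun w => (U w - EU w) * g w).
Proof.
have gb w : `|g w| <= 1 by exact: ind_gt_bnd.
have Ne32 : L2 P (fun w => N w * e3 w) by exact: (L2_mul_bnd N2 (L2_meas e32) e3b).
have me32 : L2 P (fun w => m w * e3 w) by exact: (L2_mul_bnd m2 (L2_meas e32) e3b).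
have AW := L2_mul A2 Wg2; have Am := L2_mul A2 mg2; have AWe := L2_mul A2 We32.
have Ae := L2_mul A2 e42; have Ame := L2_mul A2 me32.
have NW := L2_mul N2 Wg2; have Nm := L2_mul N2 mg2.
have DNe := L2_mul D2 Ne32; have NmL := L2_mul N2 m2.
have U1 : L1 P U.
  apply: (eq_L1 (f := fun w => Dl w * `|xi w| + Dl w * N w)).
    by move=> w; rewrite hU mulrDr.
  by apply: L1D; exact: L2_mul.
have [EU1 gmEU _] := hEU.
have Ug1 : L1 P (fun w => U w * g w) by exact: (L1_mul_bnd U1 mg gb).
have EUg1 : L1 P (fun w => EU w * g w) by exact: (L1_mul_bnd EU1 mg gb).
have gEU1 : L1 P (fun w => g w * EU w) by apply: eq_L1 EUg1 => w; rewrite mulrC.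
have Ue1 : L1 P (fun w => U w * e3 w).
  apply: (L1_dom_ae _ (L1_norm U1)); first exact: (measurable_funM (L1_meas U1) (L2_meas e32)).
  by apply: filterS e3b => w e3w; rewrite normrM ler_piMr.
have -> : E (fun w => (U w - EU w) * g w) = E (fun w => U w * g w) - E (fun w => U w * e3 w).
  rewrite (CE_swap sC U1 (L2_L1 g2) hEU ce3 Ue1 gEU1) -EB//.
  by apply: eqE => w; rewrite mulrBl [g w * _]mulrC.
have -> : E (fun w => U w * g w) =
    (E (fun w => `|xi w| * (W w * g w)) - E (fun w => `|xi w| * (m w * g w))) +
    (E (fun w => N w * (W w * g w)) - E (fun w => N w * (m w * g w))).
  rewrite -!EB// -ED; [|exact: L1B..].
  by apply: eqE => w; rewrite hU /Dl; ring.
have DNe0 : E (fun w => Dl w * (N w * e3 w)) = 0.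
  have cD : CE P C Dl (fun w => m w - m w) := CEB (L2_L1 W2) (L2_L1 m2) sC hm (CE_id gmm (L2_L1 m2)).
  have [_ <-] := pullout (L2_L1 D2) sC cD (measurable_funM gmN gme3) DNe.
  rewrite -[RHS](E_cst P 0); apply: eqE => w; by rewrite subrr mul0r.
have -> : E (fun w => U w * e3 w) =
    E (fun w => `|xi w| * (W w * e3 w)) - E (fun w => `|xi w| * (m w * e3 w)).
  rewrite -[RHS]addr0 -DNe0 -EB// -ED//; last exact: L1B.
  by apply: eqE => w; rewrite hU /Dl; ring.
have -> : E (fun w => `|xi w| * (m w * e3 w)) = E (fun w => N w * (m w * g w)).
  have [_ <-] := pullout (L2_L1 A2) sC hN (measurable_funM gmm gme3) Ame.
  have gNm : L1 P (fun w => g w * (N w * m w)).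
    by apply: eq_L1 (L1_mul_bnd NmL mg gb) => w; rewrite mulrC.
  have [_ h] := pullout (L2_L1 g2) sC ce3 (measurable_funM gmN gmm) gNm.
  transitivity (E (fun w => e3 w * (N w * m w))); first by apply: eqE => w /=; ring.
  by apply: etrans h _; apply: eqE => w /=; ring.
have -> : E (fun w => `|xi w| * TB w) =
    E (fun w => `|xi w| * (W w * g w)) - E (fun w => `|xi w| * (m w * g w)) -
    E (fun w => `|xi w| * (W w * e3 w)) + E (fun w => `|xi w| * e4 w).
  rewrite -EB// -EB//; last exact: L1B.
  rewrite -ED//; last by apply: L1B => //; exact: L1B.
  by apply: eqE => w; rewrite /TB; ring.
have WgN1 : L1 P (fun w => W w * g w * N w) by exact: L2_mul.
rewrite (CE_swap sC (L2_L1 A2) (L2_L1 Wg2) hN ce4 Ae WgN1).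
rewrite (@eqE _ _ _ P (fun w => W w * g w * N w) (fun w => N w * (W w * g w))); last first.
  by move=> w; rewrite mulrC.
move: (E _) (E _) (E _) (E _) (E _) => a1 a2 a3 a4 a5; ring.
Qed.

(** As [e0] is measurable for [C], [E[xi e0] = 0] may be subtracted, and the remainder [r] appears.
    The factor 1/2 of its quadratic part cancels the 2 in [EWV] and [EV]; [swapTB] turns its jump
    part into the last term. *)
Lemma one_step :
  `|E (fun w => xi w * stein z (W w)) - E (fun w => Dl w * xi w * dstein z (W w))| <=
  Num.sqrt (E (fun w => `|Dl w| ^+ 6)) + stein_cst * E (fun w => `|Dl w| ^+ 3) +
  E (fun w => (U w - EU w) * ind_gt z (W w)).
Proof.
have xif1 := L2_mul xi2 f2; have xie1 := L2_mul xi2 e02; have xiD1 := L2_mul xi2 f'D2.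
have e00 : E (fun w => xi w * e0 w) = 0.
  have [_ <-] := pullout (L2_L1 xi2) sC hxi (gm ce0) xie1.
  by rewrite -[RHS](E_cst P 0); apply: eqE => w; rewrite mul0r.
have r2 : L2 P r.
  have f'D2' : L2 P (fun w => f' w * Dl w).
    by rewrite (_ : (fun w => _) = (fun w => Dl w * f' w))//; apply/funext => w; rewrite mulrC.
  by apply: L2B => //; exact: L2B.
have xir1 := L2_mul xi2 r2.
have -> : E (fun w => xi w * stein z (W w)) - E (fun w => Dl w * xi w * dstein z (W w)) =
    E (fun w => xi w * r w).
  rewrite -[X in X - _]subr0 -e00 -EB//.
  rewrite (@eqE _ _ _ P (fun w => Dl w * xi w * dstein z (W w))
    (fun w => xi w * (Dl w * f' w))); last by move=> w; rewrite /f'; ring.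
  rewrite -EB//; last exact: L1B.
  by apply: eqE => w; rewrite /r /f; ring.
rewrite (le_trans (E_abs xir1))//.
have V1 := L2_L1 V2.1; have ATB1 := L2_mul A2 TB2.
have s1 : L1 P (fun w => `|W w| * V w + c * V w) by apply: L1D => //; exact: L1Z.
have b1 : L1 P (fun w => 2^-1 * (`|W w| * V w + c * V w) + `|xi w| * TB w).
  by apply: L1D => //; exact: L1Z.
have le : {ae P, forall w, `|xi w * r w| <= 2^-1 * (`|W w| * V w + c * V w) + `|xi w| * TB w}.
  apply: filterS ae_r => w rw; rewrite normrM.
  apply: (le_trans (ler_wpM2l (normr_ge0 (xi w)) rw)).
  by rewrite le_eqVlt; apply/orP; left; apply/eqP; rewrite /V; ring.
apply: (le_trans (E_le_ae (L1_norm xir1) b1 le)).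
rewrite ED//; last exact: L1Z.
rewrite swapTB lerD2r EZ// ED//; last exact: L1Z.
rewrite EZ// -/c.
have c0 : 0 <= c by exact: stein_cst_ge0.
have arith (x y v p : R) : x <= 2 * v -> y <= 2 * p -> 2^-1 * (x + c * y) <= v + c * p.
  move=> xv yp; have := ler_wpM2l c0 yp; lra.
exact: arith EWV EV.
Qed.

End OneStep.

(** * Variance bounds and series in L^1 *)

Section Variance.
Context d (T : measurableType d) (R : realType) (P : probability T R).
Implicit Types (f g h U V Z : T -> R).

Local Notation E f := (Rintegral P [set: T] f).

Lemma expectationE f : 'E_P[f]%E = (\int[P]_w (f w)%:E)%E.
Proof. by rewrite unlock. Qed.

Lemma L1_expectation f : L1 P f -> 'E_P[f]%E = (E f)%:E.
Proof. by move=> f1; rewrite expectationE EFin_E. Qed.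

Lemma L1_ge0 f : measurable_fun [set: T] f -> (forall w, 0 <= f w) ->
  ('E_P[f] < +oo)%E -> L1 P f.
Proof.
move=> mf f0; rewrite expectationE => foo; apply/integrableP; split.
  exact/measurable_EFinP.
by under eq_integral do rewrite /= ger0_norm//.
Qed.

(** Cauchy-Schwarz from [2 * a * |h| - a ^+ 2 <= h ^+ 2] with the optimal [a = E |h|]. *)
Lemma E_abs_le_sqrt h : L2 P h -> E (fun w => `|h w|) <= Num.sqrt (E (fun w => h w ^+ 2)).
Proof.
move=> h2; set a := E _; have a0 : 0 <= a by apply: E_ge0.
rewrite -(ger0_norm a0) -sqrtr_sqr ler_sqrt; last by apply: E_ge0 => w; exact: sqr_ge0.
have ah1 := L1_norm (L2_L1 h2).
have b1 : L1 P (fun w => 2 * a * `|h w| - a ^+ 2) by apply: L1B; [exact: L1Z|exact: L1_cst].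
have -> : a ^+ 2 = E (fun w => 2 * a * `|h w| - a ^+ 2).
  by rewrite EB; [rewrite EZ// E_cst -/a; ring|exact: L1Z|exact: L1_cst].
apply: (E_le b1 h2.2) => w.
rewrite -(real_normK (num_real (h w))) -subr_ge0.
by rewrite [leRHS](_ : _ = (`|h w| - a) ^+ 2) ?sqr_ge0//; ring.
Qed.

Lemma L2_of_Lfun f : f \in Lfun P 2%:E -> L2 P f.
Proof.
move=> f2; split; last exact: Lfun2_integrable_sqr.
by move: f2; rewrite inE => /andP[+ _]; rewrite inE.
Qed.

(** When the variance is infinite the bound is trivial; otherwise [Z - E Z] is in L^2 and
    Cauchy-Schwarz applies. *)
Lemma var_abs Z : L1 P Z -> ((E (fun w => `|Z w - E Z|))%:E <= sqrte 'V_P[Z])%E.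
Proof.
move=> Z1; pose h w := Z w - E Z.
have h1 : L1 P h by apply: L1B => //; exact: L1_cst.
have VE : 'V_P[Z]%E = 'E_P[fun w => (h w ^+ 2)%R]%E.
  rewrite /variance covariance.unlock (L1_expectation Z1).
  by congr expectation; apply/funext => w; rewrite expr2.
rewrite VE; have mh2 := measurable_funX 2 (L1_meas h1).
have [oo|] := leP +oo%E ('E_P[fun w => (h w ^+ 2)%R])%E.
  by move: oo; rewrite leye_eq => /eqP ->; rewrite /= leey.
move=> /(L1_ge0 mh2 (fun w => sqr_ge0 (h w))) hh1.
have h2 : L2 P h by split=> //; exact: (L1_meas h1).
by rewrite L1_expectation// lee_fin; exact: E_abs_le_sqrt.
Qed.

Lemma L1_sum_cvg (u : nat -> T -> R) V U : (forall i, L1 P (u i)) ->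
  is_L1_sum P u V -> measurable_fun [set: T] U -> (forall w, `|U w| <= 1) ->
  \sum_(i < n) E (fun w => u i w * U w) @[n --> \oo] --> E (fun w => V w * U w).
Proof.
move=> u1 [/Lfun1_integrable V1 cV] mU U1.
have uU i : L1 P (fun w => u i w * U w) by exact: (L1_mul_bnd (u1 i) mU U1).
have VU : L1 P (fun w => V w * U w) by exact: (L1_mul_bnd V1 mU U1).
have S1 n : L1 P (fun w => \sum_(i < n) u i w) by exact: (L1_sum (fun i _ => u1 i)).
have SV1 n : L1 P (fun w => `|\sum_(i < n) u i w - V w|) by apply: L1_norm; exact: L1B.
have c0 : E (fun w => `|\sum_(i < n) u i w - V w|) @[n --> \oo] --> 0.
  have := cV; rewrite (_ : (fun n => 'E_P[_]%E) =
    (fun n => (E (fun w => `|\sum_(i < n) u i w - V w|))%:E)); last first.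
    by apply/funext => n; rewrite L1_expectation.
  by move/fine_cvg.
apply/subr_cvg0/norm_cvg0P.
apply: (@squeeze_cvgr _ _ _ _ (fun=> 0) (fun n => E (fun w => `|\sum_(i < n) u i w - V w|))).
- apply: nearW => n; rewrite normr_ge0/=.
  have SU1 : L1 P (fun w => \sum_(i < n) u i w * U w) by exact: (L1_sum (fun i _ => uU i)).
  have B1 := L1B SU1 VU.
  rewrite -(Esum (fun i _ => uU i)) -EB//.
  apply: (le_trans (E_abs B1)); apply: (E_le (L1_norm B1) (SV1 n)) => w.
  by rewrite -big_distrl/= -mulrBl normrM ler_piMr.
- exact: cvg_cst.
- exact: c0.
Qed.

End Variance.

Lemma nneseries_partial_le (R : realType) (u : nat -> R) (S : R) n :
  (forall i, 0 <= u i) -> (\sum_(0 <= i <oo) (u i)%:E = S%:E)%E ->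
  \sum_(i < n) u i <= S.
Proof.
move=> u0 uS; rewrite -lee_fin -uS -(big_mkord xpredT u) -sumEFin.
by apply: nneseries_lim_ge => i _ _; rewrite lee_fin.
Qed.

(** * The increments of the martingale *)

Section Main.
Context d (T : measurableType d) d' (S : measurableType d') (R : realType).
Variables (P : probability T R) (X : nat -> {mfun T >-> S}).
Hypothesis hX : independent_seq P X.

Local Notation E f := (Rintegral P [set: T] f).

Lemma gmeas_seq (f : (nat -> S) -> R) :
  measurable_fun [set: seq_space S] (f : seq_space S -> R) ->
  gmeas (gen X setT) (fun w => f (fun k => X k w)).
Proof.
move=> mf.
apply: (@measurableT_comp _ _ _ (g_sigma_algebraType (gen X setT)) (seq_space S) _ f _
  (fun w : T => (fun k => X k w))) => //.
apply: measurability => // _ [_ [k _ [B mB <-]] <-].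
by rewrite !setTI; exact: gen_preimage.
Qed.

Variables (F : T -> R) (s : R).
Hypotheses (F2 : L2 P F) (mF : gmeas (gen X setT) F) (F0 : E F = 0).
Hypotheses (s0 : 0 < s) (Fs : E (fun w => F w ^+ 2) = s ^+ 2).

Let sg K : sub_sigma (gen X K) := @sub_sigma_gen_of _ _ _ _ X K.

Let F1 : L1 P F := L2_L1 F2.

Let others (i : nat) := [set k : nat | k != i].

Let M n := condexp P (sigma_of X (past n)) F.

Let hM n : CE P (gen X (past n)) F (M n).
Proof. exact: (condexpP (@sg _) F1). Qed.

Let D i := diffop P X i F.
Let m i := Ei P X i F.
Let xi i := condexp_past P X i (D i).

Let hm i : CE P (gen X (others i)) F (m i).
Proof. exact: (condexpP (@sg _) F1). Qed.

Let m2 i : L2 P (m i). Proof. exact: (CE_L2 (@sg _) F2 (hm i)).1. Qed.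
Let D2 i : L2 P (D i). Proof. exact: (L2B F2 (m2 i)). Qed.

Lemma L2_diffop i : L2 P (diffop P X i F). Proof. exact: D2. Qed.

Let hxi i : CE P (gen X (past i.+1)) (D i) (xi i).
Proof. exact: (condexpP (@sg _) (L2_L1 (D2 i))). Qed.

Let xi2 i : L2 P (xi i). Proof. exact: (CE_L2 (@sg _) (D2 i) (hxi i)).1. Qed.

Let others_past i : others i `&` past i.+1 = past i.
Proof.
apply/seteqP; split=> k /=; rewrite /others /past /= ltnS; first by case=> ki; rewrite ltn_neqAle ki.
by rewrite ltn_neqAle => /andP.
Qed.

(** Conditioning [m i] on [past i.+1] gives [M i] by [condexp_commute], because [others i] and
    [past i.+1] meet in [past i]. *)
Let xiE i : {ae P, forall w, xi i w = M i.+1 w - M i w}.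
Proof.
have hm' : CE P (gen X (past i.+1)) (m i) (M i).
  apply: (condexp_commute hX F1 (hm i)).
  by rewrite others_past; exact: hM.
have h := CEB F1 (L2_L1 (m2 i)) (@sg _) (hM i.+1) hm'.
apply: (CE_eq (L2_L1 (D2 i)) (L2_L1 (D2 i)) (@sg _) (hxi i) h).
exact: aeP.
Qed.

Let M2 n : L2 P (M n). Proof. exact: (mart_L2 F2 hM n).1. Qed.

(** The same commutation in the other order: conditioning [M i.+1] on [others i] gives [M i], which
    is already measurable there. *)
Let xi_centered i : CE P (gen X (others i)) (xi i) (fun=> 0).
Proof.
have h1 : CE P (gen X (others i)) (M i.+1) (M i).
  apply: (condexp_commute hX F1 (hM i.+1)).
  by rewrite setIC others_past; exact: hM.
have h2 : CE P (gen X (others i)) (M i) (M i).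
  apply: CE_id; last exact: L2_L1.
  have [_ mM _] := hM i; apply: gmeas_sub mM; apply: gen_sub => k.
  by rewrite /past /others /= => ki; rewrite neq_ltn ki.
have h := CEB (L2_L1 (M2 i.+1)) (L2_L1 (M2 i)) (@sg _) h1 h2.
have {}h : CE P (gen X (others i)) (fun w => M i.+1 w - M i w) (fun=> 0).
  by rewrite (_ : (fun=> 0) = (fun w => M i w - M i w))//; apply/funext => w; rewrite subrr.
apply: (CE_ext (@sg _) h).
- exact: (L2_meas (L2B (M2 i.+1) (M2 i))).
- exact: L2_meas.
- by apply: filterS (xiE i) => w ->.
Qed.

(** Telescoping from [M 0 = 0] almost surely: the sigma-algebra generated by no variable is trivial
    and [F] is centred. *)
Let sum_xi n (U : T -> R) : L2 P U ->
  \sum_(i < n) E (fun w => xi i w * U w) = E (fun w => M n w * U w).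
Proof.
move=> U2; elim: n => [|n ih].
  have M0 : {ae P, forall w, M 0%N w = 0}.
    have h0 : CE P (gen X (past 0%N)) F (fun=> 0).
      split; [exact: L1_cst|exact: measurable_cst|] => A.
      rewrite (_ : gen X (past 0%N) = set0); last first.
        by apply/seteqP; split=> // B [k]; rewrite /past/= ltn0.
      have -> : E (fun w => 0 * \1_A w) = 0.
        by rewrite -[RHS](E_cst P 0); apply: eqE => w; rewrite mul0r.
      have sub : <<s set0 >> `<=` [set A : set T | A = set0 \/ A = setT].
        apply: smallest_sub => //; split=> [|B [->|->]|B BT]; first by left.
        - by right; rewrite setD0.
        - by left; rewrite setDv.
        - have [[k Bk]|H] := pselect (exists k, B k = setT).
            by right; apply/seteqP; split=> // w _; exists k => //; rewrite Bk.
          left; apply/seteqP; split=> // w [k _]; have [->//|Bk] := BT k.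
          by case: H; exists k.
      move=> /sub[->|->].
        by rewrite -[LHS](E_cst P 0); apply: eqE => w; rewrite indic0 mulr0.
      by rewrite -F0; apply: eqE => w; rewrite indicT mulr1.
    apply: (CE_eq F1 F1 (@sg _) (hM 0%N) h0); exact: aeP.
  rewrite big_ord0 -(E_cst P 0); apply: E_eq_ae.
  - exact: measurable_cst.
  - exact: (L1_meas (L2_mul (M2 0%N) U2)).
  - by apply: filterS M0 => w ->; rewrite mul0r.
rewrite big_ord_recr/= ih.
have -> : E (fun w => xi n w * U w) = E (fun w => M n.+1 w * U w - M n w * U w).
  apply: E_eq_ae; first exact: (L1_meas (L2_mul (xi2 n) U2)).
    exact: (L1_meas (L1B (L2_mul (M2 n.+1) U2) (L2_mul (M2 n) U2))).
  by apply: filterS (xiE n) => w ->; rewrite mulrBl.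
by rewrite EB; [rewrite addrC subrK|exact: L2_mul..].
Qed.

Let Z_term1 i : L1 P (Z_term P X F i).
Proof. exact: (L2_mul (D2 i) (xi2 i)). Qed.

(** [D i = F - m i], and [m i] is measurable for the other variables, given which [xi i] has mean
    zero. *)
Let EZ_term i : E (Z_term P X F i) = E (fun w => xi i w * F w).
Proof.
have xiF := L2_mul (xi2 i) F2; have xim := L2_mul (xi2 i) (m2 i).
have [_ gm _] := hm i.
have [_ e0] := pullout (L2_L1 (xi2 i)) (@sg _) (xi_centered i) gm xim.
have e1 : E (fun w => xi i w * m i w) = 0.
  by rewrite -e0 -[RHS](E_cst P 0); apply: eqE => w; rewrite mul0r.
rewrite -[RHS]subr0 -e1 -EB//; apply: eqE => w.
by rewrite /Z_term -/(D i) -/(xi i) /D /diffop -/(m i); ring.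
Qed.

Let L1_sum_E (u : nat -> T -> R) V : (forall i, L1 P (u i)) -> is_L1_sum P u V ->
  \sum_(i < n) E (u i) @[n --> \oo] --> E V.
Proof.
move=> u1 uV; have b1 (w : T) : `|1 : R| <= 1 by rewrite normr1.
have := L1_sum_cvg u1 uV (measurable_cst (1 : R)) b1.
have e h : E (fun w => h w * 1) = E h by apply: eqE => w; rewrite mulr1.
by rewrite e; under eq_fun do under eq_bigr do rewrite e.
Qed.

(** The partial sums of expectations telescope to [E[M_n F] = E[M_n ^+ 2]], whose limit is given by
    [mart_norm]. *)
Lemma mean_Z Z : is_L1_sum P (Z_term P X F) Z -> E Z = s ^+ 2.
Proof.
move=> hZ; rewrite -Fs.
apply: (cvg_unique _ (L1_sum_E Z_term1 hZ)) => //.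
have := mart_norm F2 mF hM.
rewrite (_ : (fun n => E (fun w => M n w ^+ 2)) = (fun n => \sum_(i < n) E (Z_term P X F i)))//.
apply/funext => n; under eq_bigr do rewrite EZ_term.
rewrite sum_xi//.
have [_ gM _] := hM n; have FM := L2_mul F2 (M2 n).
have [_ h] := pullout F1 (@sg _) (hM n) gM FM.
transitivity (E (fun w => M n w * M n w)); first by apply: eqE => w; rewrite expr2.
by rewrite h; apply: eqE => w; rewrite mulrC.
Qed.

Let A i w : R := `|xi i w|.
Let N i := Ei P X i (A i).
Let U i w := D i w * (A i w + N i w).
Let EU i := Ei P X i (U i).

Let A2 i : L2 P (A i). Proof. exact: L2_norm (xi2 i). Qed.

Let hN i : CE P (gen X (others i)) (A i) (N i).
Proof. exact: (condexpP (@sg _) (L2_L1 (A2 i))). Qed.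

Let U1 i : L1 P (U i).
Proof. by apply: L2_mul (D2 i) _; apply: L2D (A2 i) _; exact: (CE_L2 (@sg _) (A2 i) (hN i)).1. Qed.

Let hEU i : CE P (gen X (others i)) (U i) (EU i).
Proof. exact: (condexpP (@sg _) (U1 i)). Qed.

Let Zbar_term1 i : L1 P (Zbar_term P X F i).
Proof. by apply: (L1B (U1 i)); have [] := hEU i. Qed.

Lemma mean_Zbar Zbar : is_L1_sum P (Zbar_term P X F) Zbar -> E Zbar = 0.
Proof.
move=> hZ; apply: (cvg_unique _ (L1_sum_E Zbar_term1 hZ)) => //.
apply: cvg_near_cst; apply: nearW => n; rewrite big1// => i _.
have [EU1 _ _] := hEU i.
by rewrite (EB (U1 i) EU1) (CE_E (hEU i)) subrr.
Qed.

Variable z : R.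
Let W w := s^-1 * F w.

(** [one_step] for [F / s]. Each of [D i] and [xi i] carries a factor [1 / s], whence the square in
    front of the [Z] and [Zbar] terms and the cube in front of the remainder, its sixth moment being
    under a root. *)
Let claim i : L1 P (fun w => `|D i w| ^+ 6) ->
  `|s^-1 * E (fun w => xi i w * stein z (W w)) -
    s^-1 ^+ 2 * E (fun w => Z_term P X F i w * dstein z (W w))| <=
  s^-1 ^+ 3 * (Num.sqrt (E (fun w => `|D i w| ^+ 6)) + stein_cst * E (fun w => `|D i w| ^+ 3)) +
  s^-1 ^+ 2 * E (fun w => Zbar_term P X F i w * ind_gt z (W w)).
Proof.
move=> D6; pose t := s^-1; have t0 : 0 < t by rewrite invr_gt0.
have W2 : L2 P W by exact: L2Z.
have EW : E (fun w => W w ^+ 2) <= 1.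
  rewrite (@eqE _ _ _ P _ (fun w => t ^+ 2 * F w ^+ 2)); last by move=> w; rewrite /W exprMn.
  by rewrite EZ ?Fs; [rewrite -exprMn mulVf ?gt_eqF// expr1n|exact: F2.2].
have mD := L2_meas (D2 i).
have D3 := L1_pow_le mD (isT : (3 <= 6)%N) D6.
have hW := CEZ t F1 (@sg _) (hm i).
have scale (h : T -> R) (k : nat) w : `|t * h w| ^+ k = t ^+ k * `|h w| ^+ k.
  by rewrite normrM exprMn (ger0_norm (ltW t0)).
have Escale (h : T -> R) (k : nat) : L1 P (fun w => `|h w| ^+ k) ->
    E (fun w => `|t * h w| ^+ k) = t ^+ k * E (fun w => `|h w| ^+ k).
  by move=> hk; rewrite (eqE _ (scale h k)) EZ.
have L1scale (h : T -> R) (k : nat) : L1 P (fun w => `|h w| ^+ k) -> L1 P (fun w => `|t * h w| ^+ k).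
  by move=> hk; apply: eq_L1 (L1Z (t ^+ k) hk) => w; rewrite scale.
have DlE w : W w - t * m i w = t * D i w.
  by rewrite /W -/t /D /diffop -/(m i) mulrBr.
have DlE' (k : nat) w : `|W w - t * m i w| ^+ k = `|t * D i w| ^+ k by rewrite DlE.
have h6 : L1 P (fun w => `|W w - t * m i w| ^+ 6).
  by apply: eq_L1 (L1scale _ _ D6) => w; rewrite DlE'.
have [x31 x3le] := CE_pow (L2_L1 (D2 i)) (@sg _) (hxi i) D3.
have [x61 x6le] := CE_pow (L2_L1 (D2 i)) (@sg _) (hxi i) D6.
have mxi := L2_meas (L2Z t (xi2 i)).
have cxi : CE P (gen X (others i)) (fun w => t * xi i w) (fun=> 0).
  have := CEZ t (L2_L1 (xi2 i)) (@sg _) (xi_centered i).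
  by rewrite (_ : (fun=> t * 0) = (fun=> 0))//; apply/funext => w; rewrite mulr0.
have y6 := L1scale _ _ x61.
have y3le : E (fun w => `|t * xi i w| ^+ 3) <= E (fun w => `|W w - t * m i w| ^+ 3).
  by rewrite (eqE _ (DlE' 3)) !Escale// ler_wpM2l// exprn_ge0// ltW.
have y6le : E (fun w => `|t * xi i w| ^+ 6) <= E (fun w => `|W w - t * m i w| ^+ 6).
  by rewrite (eqE _ (DlE' 6)) !Escale// ler_wpM2l// exprn_ge0// ltW.
have cN : CE P (gen X (others i)) (fun w => `|t * xi i w|) (fun w => t * N i w).
  have := CEZ t (L2_L1 (A2 i)) (@sg _) (hN i).
  rewrite (_ : (fun w => t * A i w) = (fun w => `|t * xi i w|))//.
  by apply/funext => w; rewrite normrM (ger0_norm (ltW t0)).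
have hU' w : t ^+ 2 * U i w = (W w - t * m i w) * (`|t * xi i w| + t * N i w).
  by rewrite DlE normrM (ger0_norm (ltW t0)) /U /A; ring.
have cEU := CEZ (t ^+ 2) (U1 i) (@sg _) (hEU i).
have := @one_step _ _ _ P (gen X (others i)) (@sg _) W _ _ _ _ _ z W2 EW hW h6 mxi cxi y6 y3le y6le
  cN hU' cEU.
rewrite (eqE _ (DlE' 6)) (eqE _ (DlE' 3)) !Escale//.
rewrite sqrtrM ?exprn_ge0 ?(ltW t0)// (_ : t ^+ 6 = (t ^+ 3) ^+ 2); last by rewrite -exprM.
rewrite sqrtr_sqr (ger0_norm (exprn_ge0 _ (ltW t0))).
have b1 w : `|stein z (W w)| <= stein_cst by exact: stein_bnd.
have b2 w : `|dstein z (W w)| <= 1 by exact: dstein_bnd.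
have b3 w : `|ind_gt z (W w)| <= 1 by exact: ind_gt_bnd.
have mW := L2_meas W2.
have ms := measurableT_comp (measurable_stein z) mW.
have md := measurableT_comp (measurable_dstein z) mW.
have mg := measurableT_comp (measurable_ind_gt z) mW.
rewrite (@eqE _ _ _ P (fun w => t * xi i w * stein z (W w)) (fun w => t * (xi i w * stein z (W w)))); last first.
  by move=> w; rewrite -mulrA.
rewrite EZ; last exact: (L1_mul_bnd (L2_L1 (xi2 i)) ms b1).
rewrite (@eqE _ _ _ P (fun w => (W w - t * m i w) * (t * xi i w) * dstein z (W w))
  (fun w => t ^+ 2 * (Z_term P X F i w * dstein z (W w)))); last first.
  by move=> w; rewrite DlE /Z_term -/(D i) -/(xi i); ring.
rewrite EZ; last exact: (L1_mul_bnd (Z_term1 i) md b2).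
rewrite (@eqE _ _ _ P (fun w => (t ^+ 2 * U i w - t ^+ 2 * EU i w) * ind_gt z (W w))
  (fun w => t ^+ 2 * (Zbar_term P X F i w * ind_gt z (W w)))); last first.
  by move=> w; rewrite /Zbar_term /diffop -/(D i) -/(xi i); rewrite -/(EU i) -/(U i w); ring.
rewrite EZ; last exact: (L1_mul_bnd (Zbar_term1 i) mg b3).
by rewrite mulrDr [stein_cst * (_ * _)]mulrCA.
Qed.

Lemma cdf_bound (Z Zbar : T -> R) (S6 S3 : R) :
  is_L1_sum P (Z_term P X F) Z -> is_L1_sum P (Zbar_term P X F) Zbar ->
  (forall i, L1 P (fun w => `|diffop P X i F w| ^+ 6)) ->
  (forall n, \sum_(i < n) Num.sqrt (E (fun w => `|diffop P X i F w| ^+ 6)) <= S6) ->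
  (forall n, \sum_(i < n) E (fun w => `|diffop P X i F w| ^+ 3) <= S3) ->
  `|E (\1_[set w | s^-1 * F w <= z] : T -> R) - gcdf z| <=
  s^-1 ^+ 2 * E (fun w => `|Z w - E Z|) + s^-1 ^+ 2 * E (fun w => `|Zbar w - E Zbar|) +
  s^-1 ^+ 3 * (S6 + stein_cst * S3).
Proof.
move=> hZ hZbar D6 hS6 hS3; rewrite (mean_Z hZ) (mean_Zbar hZbar).
have [/Lfun1_integrable Z1 _] := hZ; have [/Lfun1_integrable Zb1 _] := hZbar.
pose t := s^-1; have t0 : 0 < t by rewrite invr_gt0.
have W2 : L2 P W by exact: L2Z.
have mW := L2_meas W2.
have gW : gmeas (gen X setT) W by exact: (measurable_funM (measurable_cst _) mF).
have b1 w : `|stein z (W w)| <= (Num.truncn (stein_cst : R)).+1%:R.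
  by rewrite (le_trans (stein_bnd _ _))// ltW// truncnS_gt.
have b2 w : `|dstein z (W w)| <= 1 by exact: dstein_bnd.
have b3 w : `|ind_gt z (W w)| <= 1 by exact: ind_gt_bnd.
have ms := measurableT_comp (measurable_stein z) mW.
have gs := measurableT_comp (measurable_stein z) gW.
have md := measurableT_comp (measurable_dstein z) mW.
have mg := measurableT_comp (measurable_ind_gt z) mW.
have f2 : L2 P (fun w => stein z (W w)) by exact: (L2_bnd P ms b1).
have cA : \sum_(i < n) E (fun w => xi i w * stein z (W w)) @[n --> \oo] -->
    E (fun w => F w * stein z (W w)).
  under eq_fun do rewrite sum_xi//.
  exact: (mart_weak F2 hM gs b1).
have cB := L1_sum_cvg Z_term1 hZ md b2.
have cC := L1_sum_cvg Zbar_term1 hZbar mg b3.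
set a := E _ in cA; set b := E _ in cB; set cc := E _ in cC.
(* The one-step estimates are summed over [i < n], their remainders being bounded by the full
   series; then [n] tends to infinity on both sides. *)
have key : `|t * a - t ^+ 2 * b| <= t ^+ 3 * (S6 + stein_cst * S3) + t ^+ 2 * cc.
  pose an n := \sum_(i < n) E (fun w => xi i w * stein z (W w)).
  pose bn n := \sum_(i < n) E (fun w => Z_term P X F i w * dstein z (W w)).
  pose cn n := \sum_(i < n) E (fun w => Zbar_term P X F i w * ind_gt z (W w)).
  have cv : t ^+ 3 * (S6 + stein_cst * S3) + t ^+ 2 * cn n -
      `|t * an n - t ^+ 2 * bn n| @[n --> \oo] -->
      t ^+ 3 * (S6 + stein_cst * S3) + t ^+ 2 * cc - `|t * a - t ^+ 2 * b|.
    apply: cvgB; first by apply: cvgD; [exact: cvg_cst|apply: cvgM; [exact: cvg_cst|]].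
    apply: cvg_norm; apply: cvgB; first by apply: cvgM => //; exact: cvg_cst.
    by apply: cvgM => //; exact: cvg_cst.
  rewrite -subr_ge0; apply: (cvgr_to_ge cv).
  apply: nearW => n; rewrite subr_ge0 /an /bn /cn !mulr_sumr -sumrB.
  rewrite (le_trans (ler_norm_sum _ _ _))//.
  apply: le_trans; first by apply: ler_sum => i _; exact: (claim (D6 i)).
  rewrite big_split/= lerD2r -mulr_sumr ler_wpM2l ?exprn_ge0 ?(ltW t0)//.
  rewrite big_split/= -mulr_sumr; apply: lerD; first exact: hS6.
  by apply: ler_wpM2l; [exact: stein_cst_ge0|exact: hS3].
have mI : measurable [set w | W w <= z].
  by have := measurable_fun_le measurableT mW (measurable_cst z); rewrite setTI.
have I1 : L1 P (\1_[set w | W w <= z] : T -> R).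
  apply: (@L1_bnd _ _ _ P _ 1) => [|w]; first exact: indic_meas.
  by rewrite ger0_norm ?indic_le1 ?indic_ge0.
have Wf1 : L1 P (fun w => W w * stein z (W w)) by exact: L2_mul.
have d1 : L1 P (fun w => dstein z (W w)) by exact: (L1_bnd P md b2).
(* Stein's equation in expectation, which holds by the definition of [dstein]. *)
have dE : E (fun w => dstein z (W w)) = t * a + E (\1_[set w | W w <= z] : T -> R) - gcdf z.
  have -> : t * a = E (fun w => W w * stein z (W w)).
    rewrite -EZ; last exact: (L1_mul_bnd F1 ms b1).
    by apply: eqE => w; rewrite mulrA.
  rewrite -[X in _ - X](E_cst P (gcdf z)) -ED// -EB; [|exact: L1D|exact: L1_cst].
  apply: eqE => w; rewrite /dstein indicE; congr (_ + (nat_of_bool _)%:R - _).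
  by apply/idP/idP; rewrite ?inE.
have Zd1 := L1_mul_bnd Z1 md b2.
have ZE : `|E (fun w => dstein z (W w)) - t ^+ 2 * b| <= t ^+ 2 * E (fun w => `|Z w - s ^+ 2|).
  have Zs1 : L1 P (fun w => Z w - s ^+ 2) by apply: L1B => //; exact: L1_cst.
  have dZ1 := L1B d1 (L1Z (t ^+ 2) Zd1).
  rewrite -EZ// -EB//; last exact: L1Z.
  rewrite -EZ; last exact: L1_norm.
  apply: (le_trans (E_abs dZ1)).
  apply: (E_le (L1_norm dZ1) (L1Z _ (L1_norm Zs1))) => w.
  (* As [t ^+ 2 * s ^+ 2 = 1], the coefficient 1 of [dstein] is what centres [Z] at its mean
     [s ^+ 2]. *)
  have -> : dstein z (W w) - t ^+ 2 * (Z w * dstein z (W w)) =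
      - (t ^+ 2 * ((Z w - s ^+ 2) * dstein z (W w))).
    have ts : t ^+ 2 * s ^+ 2 = 1 by rewrite -exprMn mulVf ?gt_eqF// expr1n.
    rewrite -{1}[dstein z (W w)]mul1r -ts; ring.
  rewrite normrN normrM (ger0_norm (exprn_ge0 _ (ltW t0))) ler_wpM2l ?exprn_ge0 ?(ltW t0)//.
  by rewrite normrM ler_piMr.
have cle : cc <= E (fun w => `|Zbar w - 0|).
  have Zg1 := L1_mul_bnd Zb1 mg b3.
  rewrite (@eqE _ _ _ P (fun w => `|Zbar w - 0|) (fun w => `|Zbar w|)); last by move=> w; rewrite subr0.
  apply: (E_le Zg1 (L1_norm Zb1)) => w.
  by apply: le_trans (ler_norm _) _; rewrite normrM ler_piMr//; exact: b3.
(* The first difference measures how far [t ^+ 2 * Z] is from 1; the second is the remainder bounded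
   in [key]. *)
have -> : E (\1_[set w | s^-1 * F w <= z] : T -> R) - gcdf z =
    (E (fun w => dstein z (W w)) - t ^+ 2 * b) - (t * a - t ^+ 2 * b).
  by rewrite dE; ring.
apply: (le_trans (ler_normB _ _)); rewrite -addrA; apply: lerD; first exact: ZE.
apply: (le_trans key); rewrite [leRHS]addrC lerD2l.
by rewrite ler_wpM2l// exprn_ge0// ltW.
Qed.

End Main.

(** * Reduction to finite terms and return to extended reals *)

Theorem corollary3p3 (R : realType)
    (d : measure_display) (T : measurableType d) (P : probability T R)
    (d' : measure_display) (S : measurableType d')
    (X : nat -> {RV P >-> S}) (hX : independent_seq P X)
    (f : (nat -> S) -> R)
    (hf : measurable_fun [set: seq_space S] (f : seq_space S -> R))
    (F : T -> R) (hF : F = fun w => f (fun k => X k w))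
    (hF2 : F \in Lfun P 2%:E) (hF0 : ('E_P[F] = 0)%E)
    (sigma : R) (hsigma : 0 < sigma) (hvar : ('V_P[F] = (sigma ^+ 2)%:E)%E)
    (Z Zbar : T -> R)
    (hZ : is_L1_sum P (Z_term P X F) Z)
    (hZbar : is_L1_sum P (Zbar_term P X F) Zbar) :
  (kolmogorov_dist P (fun w => (sigma^-1 * F w)%R) (normal_prob 0 1)
   <= sqrte 'V_P[Z] / (sigma ^+ 2)%:E
      + sqrte 'V_P[Zbar] / (sigma ^+ 2)%:E
      + (\sum_(0 <= i <oo) sqrte 'E_P[fun w => (`|diffop P X i F w| ^+ 6)%R])
        / (sigma ^+ 3)%:E
      + (Num.sqrt (2 * pi) / (4 * sigma ^+ 3))%:E * lyapunov P X 3 F)%E.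
Proof.
have F2 := L2_of_Lfun hF2; have F1 := L2_L1 F2.
have mF : gmeas (gen X setT) F by rewrite hF; exact: gmeas_seq.
have F0 : Rintegral P setT F = 0 by move: hF0; rewrite L1_expectation// => -[].
have Fs : Rintegral P setT (fun w => F w ^+ 2) = sigma ^+ 2.
  move: hvar; rewrite varianceE// hF0 expe2 mule0 sube0.
  rewrite (_ : F ^+ 2 = fun w => F w ^+ 2); last by apply/funext => w; rewrite expr2.
  by rewrite L1_expectation; [case|exact: F2.2].
have s2 : sigma ^+ 2 != 0 by rewrite gt_eqF// exprn_gt0.
have s3 : sigma ^+ 3 != 0 by rewrite gt_eqF// exprn_gt0.
have i2 : ((sigma ^+ 2)%:E^-1 = (sigma^-1 ^+ 2)%:E)%E by rewrite inver (negbTE s2) exprVn.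
have i3 : ((sigma ^+ 3)%:E^-1 = (sigma^-1 ^+ 3)%:E)%E by rewrite inver (negbTE s3) exprVn.
have t0 : 0 < sigma^-1 by rewrite invr_gt0.
have mD i := L2_meas (L2_diffop X F2 i).
have [Z1 _] := hZ; have [Zb1 _] := hZbar; move/Lfun1_integrable in Z1; move/Lfun1_integrable in Zb1.
apply: ub_ereal_sup => _ [x _ <-].
set S6e := (\sum_(0 <= i <oo) sqrte _)%E; set S3e := lyapunov _ _ _ _.
have v6ge0 i : (0 <= sqrte 'E_P[fun w => (`|diffop P X i F w| ^+ 6)%R])%E by exact: sqrte_ge0.
have l3ge0 i : (0 <= 'E_P[fun w => (`|diffop P X i F w| `^ 3)%R])%E.
  by apply: expectation_ge0 => w; exact: powR_ge0.
have S6ge0 : (0 <= S6e)%E by apply: nneseries_ge0 => i _ _; exact: v6ge0.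
have S3ge0 : (0 <= S3e)%E by apply: nneseries_ge0 => i _ _; exact: l3ge0.
have V1ge0 : (0 <= sqrte 'V_P[Z] / (sigma ^+ 2)%:E)%E.
  by rewrite i2 mule_ge0 ?sqrte_ge0// lee_fin exprn_ge0// ltW.
have V2ge0 : (0 <= sqrte 'V_P[Zbar] / (sigma ^+ 2)%:E)%E.
  by rewrite i2 mule_ge0 ?sqrte_ge0// lee_fin exprn_ge0// ltW.
have T3ge0 : (0 <= S6e / (sigma ^+ 3)%:E)%E.
  by rewrite i3 mule_ge0// lee_fin exprn_ge0// ltW.
have kpos : 0 < Num.sqrt (2 * pi) / (4 * sigma ^+ 3).
  by rewrite divr_gt0 ?sqrtr_gt0 ?mulr_gt0 ?pi_gt0 ?exprn_gt0.
have T4ge0 : (0 <= (Num.sqrt (2 * pi) / (4 * sigma ^+ 3))%:E * S3e)%E.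
  by rewrite mule_ge0// lee_fin ltW.
have neNy (y : \bar R) : (0 <= y)%E -> y != -oo%E by case: y.
(* If one of the two series diverges, the right-hand side is infinite, all its terms being
   nonnegative. Infinite variances are dealt with in [var_abs]. *)
have [S6y|S6fin] := eqVneq S6e +oo%E.
  rewrite S6y i3 gt0_mulye; last by rewrite lte_fin exprn_gt0.
  rewrite addey; last by apply: neNy; exact: adde_ge0.
  by rewrite addye ?leey//; exact: neNy.
have [S3y|S3fin] := eqVneq S3e +oo%E.
  rewrite S3y gt0_muley ?lte_fin// addey ?leey//.
  by apply: neNy; rewrite !adde_ge0.
(* A finite sum of the roots forces each sixth moment to be finite. *)
have D6 i : L1 P (fun w => `|diffop P X i F w| ^+ 6).
  apply: L1_ge0 => [|w|].
  - by apply: measurable_funX; exact: measurableT_comp.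
  - exact: exprn_ge0.
  - rewrite ltey; apply/eqP => Ey; move/eqP: S6fin; apply.
    apply: (@nneseries_pinfty _ _ _ i) => //.
    by rewrite Ey.
have D3 i : L1 P (fun w => `|diffop P X i F w| ^+ 3) by exact: (L1_pow_le (mD i) (isT : (3 <= 6)%N) (D6 i)).
pose u6 i := Num.sqrt (Rintegral P setT (fun w => `|diffop P X i F w| ^+ 6)).
pose u3 i := Rintegral P setT (fun w => `|diffop P X i F w| ^+ 3).
have hS6 : (\sum_(0 <= i <oo) (u6 i)%:E = (fine S6e)%:E)%E.
  rewrite fineK ?ge0_fin_numE ?ltey//; apply: eq_eseriesr => i _.
  by rewrite L1_expectation.
have hS3 : (\sum_(0 <= i <oo) (u3 i)%:E = (fine S3e)%:E)%E.
  rewrite fineK ?ge0_fin_numE ?ltey//; apply: eq_eseriesr => i _.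
  rewrite -L1_expectation//; congr expectation; apply/funext => w.
  by rewrite -powR_mulrn.
have u60 i : 0 <= u6 i by exact: sqrtr_ge0.
have u30 i : 0 <= u3 i by apply: E_ge0 => w; exact: exprn_ge0.
have := @cdf_bound _ _ _ _ _ P X hX F sigma F2 mF F0 hsigma Fs x Z Zbar (fine S6e) (fine S3e) hZ hZbar D6
  (fun n => nneseries_partial_le n u60 hS6) (fun n => nneseries_partial_le n u30 hS3).
have mI : measurable [set w | sigma^-1 * F w <= x].
  have mW := L2_meas (L2Z sigma^-1 F2).
  by have := measurable_fun_le measurableT mW (measurable_cst x); rewrite setTI.
rewrite gcdfE.
have -> : P [set w | sigma^-1 * F w <= x] =
    (Rintegral P setT (\1_[set w | sigma^-1 * F w <= x] : T -> R))%:E.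
  rewrite EFin_E ?integral_indic ?setIT//.
  apply: (@L1_bnd _ _ _ P _ 1) => [|w]; first exact: indic_meas.
  by rewrite ger0_norm ?indic_le1 ?indic_ge0.
rewrite -EFinB abse_EFin -lee_fin => /le_trans; apply.
rewrite mulrDr !EFinD i2 i3 addeA.
have scale2 (Y : T -> R) : L1 P Y ->
   ((sigma^-1 ^+ 2 * Rintegral P setT (fun w => `|Y w - Rintegral P setT Y|))%:E <=
    sqrte 'V_P[Y] * (sigma^-1 ^+ 2)%:E)%E.
  move=> Y1; rewrite EFinM muleC; apply: lee_wpmul2r; last exact: var_abs.
  by rewrite lee_fin exprn_ge0// ltW.
apply: leeD; first apply: leeD; first apply: leeD.
- exact: scale2.
- exact: scale2.
- by rewrite EFinM muleC fineK// ge0_fin_numE// ltey.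
- rewrite -[in leRHS](@fineK _ S3e); last by rewrite ge0_fin_numE// ltey.
  rewrite -EFinM lee_fin le_eqVlt; apply/orP; left; apply/eqP.
  by rewrite /stein_cst; field; rewrite gt_eqF.
Qed.
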